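(* Let $H: S^{2n-1}\to S^{2m-1}$ be a rational map of degree $d$, and let $V_H$ be its associated $K(n,d)\times m$ matrix of holomorphic polynomials. Then: (a) $H$ is finitely nondegenerate at $p\in S^{2n-1}$ if and only if $V_H$ is of rank $m$ at $p$. (b) $H$ is holomorphically nondegenerate if and only if $V_H$ is generically of rank $m$ on $S^{2n-1}$ (i.e. of rank $m$ at all points of a dense open subset of $S^{2n-1}$).
   Context: Let $n\ge 2$, $m\ge 1$, $d\geq 1$. $S^{2n-1}=\{z\in\mathbb C^n:\|z\|=1\}$, and $v\cdot w=\sum_j v_jw_j$ (bilinear, no conjugation). A rational map $H:S^{2n-1}\to S^{2m-1}$ of degree $d$ is $H=P/Q$ in lowest terms with $P=(P_1,\dots,P_m)$ and $Q$ holomorphic polynomials on $\mathbb C^n$, $Q\neq 0$ on $S^{2n-1}$, $H(S^{2n-1})\subset S^{2m-1}$, $d=\max\{\deg P,\deg Q\}$. $K(n,d)=\binom{n+d-1}{d}$, and $H^d_n(z)=\left(\sqrt{d!/\alpha!}\;z^\alpha\right)_{|\alpha|=d}$ (multiindices $\alpha\in\mathbb N^n$ of length $d$ in lexicographic order) is the homogeneous sphere map $S^{2n-1}\to S^{2K(n,d)-1}$. Matrix $V_H$: write $P=\sum_{k=0}^d P^k$ with $P^k$ homogeneous of degree $k$. $V_H=V_H(z)$ is the $K(n,d)\times m$ matrix with holomorphic polynomial entries in $z$ determined by $$V_H(z)X\cdot \overline{H^d_n(z)} = X\cdot \sum_{k=0}^d \overline{P^k(z)}\,\|z\|^{2(d-k)}\qquad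 (X\in\mathbb C^m,\ z\in\mathbb C^n).$$ Finite nondegeneracy: let $\bar L_1,\dots,\bar L_{n-1}$ be a real-analytic local basis near $p$ of the CR (i.e. type $(0,1)$) vector fields tangent to $S^{2n-1}$, $\bar L^\alpha=\bar L_1^{\alpha_1}\cdots\bar L_{n-1}^{\alpha_{n-1}}$, and $E'_k(p)=\operatorname{span}_{\mathbb C}\{\bar L^\alpha\bar H|_p:|\alpha|\le k\}\subset\mathbb C^m$. $H$ is finitely nondegenerate at $p$ if $E'_k(p)=\mathbb C^m$ for some $k$. Holomorphic nondegeneracy: $H$ is holomorphically nondegenerate if there is no map $Y\not\equiv 0$ into $\mathbb C^m$, holomorphic in a neighborhood of $S^{2n-1}$, with $Y\cdot\bar H=0$ on $S^{2n-1}$. *)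

(* Defs.v *)
(* MathComp-Analysis, with multinomials and real-closed.  [mpoly] has to be
   imported before mathcomp-analysis, since their notations otherwise clash. *)
From HB Require Import structures.
From mathcomp.multinomials Require Import mpoly.
From mathcomp Require Import all_boot all_order all_algebra.
From mathcomp Require Import all_classical all_reals all_analysis.
From mathcomp Require Import complex.
From mathcomp Require Import ring.

Set Implicit Arguments.
Unset Strict Implicit.
Unset Printing Implicit Defensive.

Import Order.TTheory GRing.Theory Num.Theory numFieldNormedType.Exports.
Local Open Scope classical_set_scope.
Local Open Scope ring_scope.

(* R[i] carries no topology of its own; viewed as a numClosedFieldType it gets
   the norm topology, and so do the column vectors over it. *)
Definition CC (R : realType) : numClosedFieldType := R[i].

Section Space.
Context {R : realType}.
Local Notation C := (CC R).

(* bilinear, not Hermitian *)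
Definition dot {m} (v w : 'cV[C]_m) : C := \sum_i v i 0 * w i 0.

Definition conjv {m} (v : 'cV[C]_m) : 'cV[C]_m := map_mx Num.conj v.

Definition sqnorm {n} (z : 'cV[C]_n) : C := \sum_i `|z i 0| ^+ 2.

(* The real sphere S^(2n-1). *)
Definition sphere n : set 'cV[C]_n := [set z | sqnorm z = 1].

End Space.

Section PowerSeries.
Context {R : realType}.
Local Notation C := (CC R).

Definition monom {N} (w : 'cV[C]_N) (a : 'X_{1..N}) : C :=
  \prod_i w i 0 ^+ a i.

(* The power series with coefficients [c] converges absolutely at [w], with sum
   [s].  Its terms are grouped by total degree. *)
Definition power_series_sum {N} (c : 'X_{1..N} -> C) (w : 'cV[C]_N) (s : C) :=
  let sum_deg (F : 'X_{1..N} -> C) (k : nat) : C :=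
    \sum_(a : 'X_{1..N < k.+1} | mdeg a == k) F a in
  cvg (series (sum_deg (fun a => `|c a * monom w a|)) @ \oo) /\
  series (sum_deg (fun a => c a * monom w a)) @ \oo --> s.

Definition holomorphic_at {n} (f : 'cV[C]_n -> C) (p : 'cV[C]_n) :=
  exists c : 'X_{1..n} -> C,
    \forall w \near (0 : 'cV[C]_n), power_series_sum c w (f (p + w)).

(* C^n = R^(2n): the series is in the real and imaginary parts of [w]. *)
Definition real_analytic_at {n} (f : 'cV[C]_n -> C) (p : 'cV[C]_n) :=
  exists c : 'X_{1..n + n} -> C,
    \forall w \near (0 : 'cV[C]_n),
      power_series_sum c
        (col_mx (map_mx (fun x => 'Re x) w) (map_mx (fun x => 'Im x) w))
        (f (p + w)).

End PowerSeries.

Section CRVectorFields.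
Context {R : realType} {n : nat}.
Local Notation C := (CC R).
Implicit Types (f : 'cV[C]_n -> C) (z p : 'cV[C]_n).

(* Derivative of f at z in the direction v along a real parameter. *)
Definition real_deriv (v : 'cV[C]_n) f z : C :=
  let g (t : R) : R[i] := f (z + (t%:C)%C *: v) in
  (derive1 (fun t => complex.Re (g t)) 0
     +i* derive1 (fun t => complex.Im (g t)) 0)%C.

(* d/d(conj z_j) = (d/dx_j + i d/dy_j) / 2 *)
Definition dbar (j : 'I_n) f z : C :=
  (real_deriv (delta_mx j 0) f z + 'i * real_deriv ('i *: delta_mx j 0) f z) / 2.

(* The (0,1) vector field \sum_j a_j d/d(conj z_j), acting on functions. *)
Definition Lbar (a : 'cV[C]_n -> 'cV[C]_n) f : 'cV[C]_n -> C :=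
  fun z => \sum_j a z j 0 * dbar j f z.

(* L_1^(al_1) ... L_(n-1)^(al_(n-1)) f, the last field acting first. *)
Definition Lbar_pow (a : 'I_n.-1 -> 'cV[C]_n -> 'cV[C]_n) (al : 'X_{1..n.-1}) f
    : 'cV[C]_n -> C :=
  foldr (fun k => iter (al k) (Lbar (a k))) f (enum 'I_n.-1).

(* A real-analytic local basis near p of the CR vector fields of the sphere.
   The coefficients are extended real-analytically to a neighbourhood U of p
   in C^n; at points of the sphere, what tangential fields do to a function
   depends only on its restriction to the sphere.  The tangential (0,1) vectors
   at a point form a space of dimension n - 1, so that n - 1 independent ones
   are a basis. *)
Definition cr_frame p (a : 'I_n.-1 -> 'cV[C]_n -> 'cV[C]_n) :=
  exists U : set 'cV[C]_n,
    [/\ open U /\ U p,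
        forall k j z, U z -> real_analytic_at (fun w => a k w j 0) z,
        forall k z, U z -> sphere z -> Lbar (a k) sqnorm z = 0
      & forall z, U z -> sphere z -> free [tuple a k z | k < n.-1]].

Definition Lbar_conj {m} (a : 'I_n.-1 -> 'cV[C]_n -> 'cV[C]_n)
    (H : 'cV[C]_n -> 'cV[C]_m) (al : 'X_{1..n.-1}) p : 'cV[C]_m :=
  \col_i Lbar_pow a al (fun z => conjv (H z) i 0) p.

(* E'_k(p) *)
Definition E' {m} (a : 'I_n.-1 -> 'cV[C]_n -> 'cV[C]_n)
    (H : 'cV[C]_n -> 'cV[C]_m) (k : nat) p : {vspace 'cV[C]_m} :=
  <<[seq Lbar_conj a H al p | al : 'X_{1..n.-1 < k.+1}]>>%VS.

(* Meant for [cr_frame p a]; does not depend on the choice of [a] then. *)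
Definition finitely_nondegenerate {m} (a : 'I_n.-1 -> 'cV[C]_n -> 'cV[C]_n)
    (H : 'cV[C]_n -> 'cV[C]_m) p :=
  exists k, E' a H k p = fullv.

End CRVectorFields.

(* The neighbourhood is taken connected, so that Y <> 0 cannot be due to
   components which do not meet the sphere. *)
Definition holomorphically_nondegenerate {R : realType} {n m : nat}
    (H : 'cV[CC R]_n -> 'cV[CC R]_m) :=
  ~ exists (U : set 'cV[CC R]_n) (Y : 'cV[CC R]_n -> 'cV[CC R]_m),
      [/\ [/\ open U, connected U & @sphere R n `<=` U],
          forall i z, U z -> holomorphic_at (fun w => Y w i 0) z,
          exists2 z, U z & Y z != 0
        & forall z, sphere z -> dot (Y z) (conjv (H z)) = 0].

Section RationalMaps.
Context {R : realType} {n m : nat}.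
Local Notation C := (CC R).
Implicit Types (P : 'I_m -> {mpoly C[n]}) (Q : {mpoly C[n]}).

Definition ratmap P Q (z : 'cV[C]_n) : 'cV[C]_m :=
  \col_i ((P i).@[z^~ 0] / Q.@[z^~ 0]).

Definition lowest_terms P Q :=
  forall g : {mpoly C[n]},
    (forall i, exists h, P i = h * g) -> (exists h, Q = h * g) ->
    g \is a GRing.unit.

(* msize is the degree plus one *)
Definition rational_sphere_map (d : nat) P Q :=
  [/\ lowest_terms P Q,
      forall z, sphere z -> Q.@[z^~ 0] != 0,
      forall z, sphere z -> sphere (ratmap P Q z)
    & (maxn (\max_i msize (P i)) (msize Q)).-1 = d].

End RationalMaps.

Definition K (n d : nat) : nat := 'C((n + d).-1, d).

(* The multiindices of length d in lexicographic order, z_1^d first. *)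
Definition multiindices (n d : nat) : seq 'X_{1..n} :=
  sort (fun a b : 'X_{1..n} => ((b : seqlexi nat) <= (a : seqlexi nat))%O)
    [seq a <- [seq bmnm a | a : 'X_{1..n < d.+1}] | mdeg a == d].

Section VH.
Context {R : realType} {n m : nat}.
Local Notation C := (CC R).

Definition Hnd (d : nat) (z : 'cV[C]_n) : 'cV[C]_(K n d) :=
  \col_j (let a := nth 0%MM (multiindices n d) j in
          sqrtC ((d`!)%:R / \prod_i ((a i)`!)%:R) * monom z a).

Definition mx_at {k l} (V : 'M[{mpoly C[n]}]_(k, l)) (z : 'cV[C]_n)
    : 'M[C]_(k, l) :=
  map_mx (fun p : {mpoly C[n]} => p.@[z^~ 0]) V.

(* V is the matrix V_H of H = P / Q; [pihomog mdeg k p] is the homogeneous part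
   of degree k of p. *)
Definition is_VH (d : nat) (P : 'I_m -> {mpoly C[n]})
    (V : 'M[{mpoly C[n]}]_(K n d, m)) :=
  forall (X : 'cV[C]_m) (z : 'cV[C]_n),
    dot (mx_at V z *m X) (conjv (Hnd d z)) =
    dot X (\sum_(k < d.+1) sqnorm z ^+ (d - k) *:
             conjv (\col_i (pihomog mdeg k (P i)).@[z^~ 0])).

(* V has rank m at all points of a dense relatively open subset of the sphere *)
Definition generically_rank_m {k} (V : 'M[{mpoly C[n]}]_(k, m)) :=
  exists W : set 'cV[C]_n,
    [/\ open W, @sphere R n `<=` closure (W `&` @sphere R n)
      & forall z, W z -> sphere z -> \rank (mx_at V z) = m].

End VH.

Arguments is_VH {R n m} d P V.

(* The hypotheses on V and on the local basis can be met. *)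

Lemma mem_multiindices n d (a : 'X_{1..n}) :
  (a \in multiindices n d) = (mdeg a == d).
Proof.
rewrite mem_sort mem_filter; case: eqP => //= ad.
have ltad : (mdeg a < d.+1)%N by rewrite ad.
by apply/mapP; exists (BMultinom ltad); rewrite ?mem_enum.
Qed.

Lemma uniq_multiindices n d : uniq (multiindices n d).
Proof.
rewrite sort_uniq filter_uniq // map_inj_uniq ?enum_uniq //.
exact: val_inj.
Qed.

Lemma size_multiindices n d : (0 < n)%N -> size (multiindices n d) = K n d.
Proof.
case: n => // n _; rewrite /K addSn /= addnC -mpoly.size_basis.
apply: perm_size; apply: uniq_perm; first exact: uniq_multiindices.
  exact: uniq_basis.
by move=> a; rewrite mem_multiindices basis_cover.
Qed.

Section VHExists.
Context {R : realType} {n m : nat}.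
Local Notation C := (CC R).

Definition conjform k (f : 'cV[C]_n -> C) :=
  exists q : 'X_{1..n} -> {mpoly C[n]}, forall z,
    f z = \sum_(a <- multiindices n k) (q a).@[z^~ 0] * (monom z a)^*.

Lemma conjform_sum k (I : finType) (f : I -> 'cV[C]_n -> C) :
  (forall i, conjform k (f i)) -> conjform k (fun z => \sum_i f i z).
Proof.
move=> /(_ _)/cid-/all_sig[q qP].
exists (fun a => \sum_i q i a) => z.
under eq_bigr do rewrite qP.
rewrite exchange_big /=; apply: eq_bigr => a _.
by rewrite [in RHS]raddf_sum mulr_suml.
Qed.

Lemma monomE (z : 'cV[C]_n) a : monom z a = ('X_[a] : {mpoly C[n]}).@[z^~ 0].
Proof. by rewrite mevalX. Qed.

Lemma conjform_conj k (p : {mpoly C[n]}) :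
  conjform k (fun z => ((pihomog mdeg k p).@[z^~ 0])^*).
Proof.
exists (fun a => (p@_a)^* %:MP) => z.
have -> : pihomog mdeg k p = \sum_(a <- multiindices n k) p@_a *: 'X_[a].
  rewrite pihomogE -big_filter; apply: etrans (_ :
    \sum_(a <- [seq a <- multiindices n k | a \in msupp p]) p@_a *: 'X_[a] = _).
    apply: perm_big; apply: uniq_perm; rewrite ?filter_uniq ?uniq_multiindices //.
    by move=> a; rewrite !mem_filter mem_multiindices andbC.
  rewrite big_filter [RHS](bigID (mem (msupp p))) /= [X in _ = _ + X]big1 ?addr0 //.
  by move=> a /memN_msupp_eq0 ->; rewrite scale0r.
rewrite [X in X^*](raddf_sum (meval _)) [LHS]raddf_sum; apply: eq_bigr => a _.
by rewrite /= mevalZ rmorphM mevalC monomE.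
Qed.

Lemma conjform_mul k (f : 'cV[C]_n -> C) :
  conjform k f -> conjform k.+1 (fun z => sqnorm z * f z).
Proof.
move=> [q qP].
rewrite (_ : (fun z => _) = fun z : 'cV[C]_n => \sum_j (z j 0 * (z j 0)^* * f z)); last first.
  by apply/funext => z; rewrite /sqnorm mulr_suml; under eq_bigr do rewrite normCK.
apply: conjform_sum => j.
exists (fun b => \sum_(a <- multiindices n k | b == (a + U_(j))%MM) 'X_j * q a) => z.
transitivity (\sum_(b <- multiindices n k.+1) \sum_(a <- multiindices n k | b == (a + U_(j))%MM)
   (z j 0 * (q a).@[z^~0]) * (monom z b)^*); last first.
  apply: eq_bigr => b _; rewrite raddf_sum mulr_suml; apply: eq_bigr => a _.
  by rewrite /= mevalM mevalXU.
rewrite (exchange_big_dep predT) //= qP mulr_sumr; apply: eq_big_seq => a.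
rewrite mem_multiindices => /eqP ak.
rewrite -big_filter (_ : [seq b <- multiindices n k.+1 | b == (a + U_(j))%MM] =
    [:: (a + U_(j))%MM]); last first.
  have := filter_pred1_uniq (uniq_multiindices n k.+1) (x := (a + U_(j))%MM).
  by rewrite mem_multiindices mdegD mdeg1 ak addn1 eqxx => ->.
rewrite big_seq1 !monomE mpolyXD mevalM mevalXU rmorphM /=.
by rewrite -!mulrA; congr (_ * _); rewrite mulrCA; congr (_ * _); rewrite mulrC.
Qed.

Lemma VH_exists d (P : 'I_m -> {mpoly C[n]}) : (0 < n)%N ->
  exists V : 'M[{mpoly C[n]}]_(K n d, m), is_VH d P V.
Proof.
move=> n0.
have F i : conjform d (fun z => \sum_(k < d.+1) sqnorm z ^+ (d - k) *
     ((pihomog mdeg k (P i)).@[z^~ 0])^*).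
  apply: conjform_sum => k.
  have : (k <= d)%N by rewrite -ltnS.
  have -> : conjform d = conjform (k + (d - k))%N by rewrite subnKC // -ltnS.
  move: (d - k)%N => l _; elim: l => [|l IH].
    rewrite addn0; have := @conjform_conj k (P i).
    by congr conjform; apply/funext => z; rewrite expr0 mul1r.
  rewrite addnS; have := conjform_mul IH.
  by congr conjform; apply/funext => z; rewrite exprS mulrA.
have [q qP] := all_sig (fun i => cid (F i)).
pose s (a : 'X_{1..n}) : C := sqrtC ((d`!)%:R / \prod_i ((a i)`!)%:R).
have s0 a : 0 < s a.
  rewrite sqrtC_gt0 divr_gt0 ?ltr0n ?fact_gt0 //.
  by apply: prodr_gt0 => i _; rewrite ltr0n fact_gt0.
exists (\matrix_(j, i) let a := nth 0%MM (multiindices n d) j in (s a)^-1 *: q i a) => X z.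
rewrite /dot.
transitivity (\sum_i X i 0 * \sum_(k < d.+1) sqnorm z ^+ (d - k) *
     ((pihomog mdeg k (P i)).@[z^~ 0])^*); last first.
  apply: eq_bigr => i _; congr (_ * _).
  by rewrite summxE; apply: eq_bigr => k _; rewrite !mxE.
under [RHS]eq_bigr do rewrite qP (big_nth 0%MM) size_multiindices // big_mkord mulr_sumr.
rewrite exchange_big /=; apply: eq_bigr => j _.
rewrite !mxE mulr_suml; apply: eq_bigr => i _.
rewrite !mxE /= mevalZ -/(s _).
set a := nth _ _ _; rewrite rmorphM /= (conj_Creal (x := s a)) ?gtr0_real //.
rewrite [_ * X _ _]mulrC -!mulrA; congr (_ * _).
by rewrite mulrCA; congr (_ * _); rewrite mulKf ?lt0r_neq0.
Qed.
End VHExists.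

Section PolynomialSeries.
Context {R : realType}.
Local Notation C := (CC R).

Lemma series_finite (u : nat -> C) M : (forall k, (M <= k)%N -> u k = 0) ->
  series u @ \oo --> \sum_(0 <= k < M) u k.
Proof.
move=> u0; apply: cvg_near_cst; near=> k.
have Mk : (M <= k)%N by near: k; exists M.
rewrite /series /= (big_cat_nat (n := M)) //= [X in _ + X]big1_seq ?addr0 //.
by move=> i /andP[_]; rewrite mem_index_iota => /andP[/u0].
Unshelve. all: by end_near. Qed.

Lemma poly_power_series N (p : {mpoly C[N]}) (w : 'cV[C]_N) :
  power_series_sum (fun a => p@_a) w p.@[w^~ 0].
Proof.
have z k (a : 'X_{1..N}) : (msize p <= k)%N -> mdeg a = k -> p@_a = 0.
  move=> pk ak; apply: memN_msupp_eq0; apply: contraTN pk => /msize_mdeg_lt.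
  by rewrite ak ltnNge.
split.
  apply/cvg_ex; eexists; apply: (@series_finite _ (msize p)) => k pk.
  by apply: big1 => a /eqP/(z _ _ pk) ->; rewrite mul0r normr0.
rewrite (_ : p.@[w^~ 0] = \sum_(0 <= k < msize p)
    \sum_(a : 'X_{1..N < k.+1} | mdeg a == k) p@_a * monom w a).
  apply: series_finite => k pk.
  by apply: big1 => a /eqP/(z _ _ pk) ->; rewrite mul0r.
rewrite [in LHS](pihomog_partitionE (leqnn (msize p))) big_mkord raddf_sum.
apply: eq_bigr => k _ /=.
have -> : pihomog mdeg k p =
    \sum_(a : 'X_{1..N < k.+1} | mdeg a == k) p@_a *: 'X_[a].
  rewrite -(pihomog_id mdeg) (@pihomogwE _ _ _ _ k.+1).
    apply: eq_bigr => a /eqP ak; congr (_ *: _).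
    rewrite (@pihomogwE _ _ _ _ (maxn (msize p) k.+1)) ?leq_maxl // raddf_sum /=.
    have lta : (mdeg a < maxn (msize p) k.+1)%N by rewrite leq_max ak ltnSn orbT.
    rewrite (bigD1 (BMultinom lta)) /= ?ak //.
    rewrite mcoeffZ mcoeffX eqxx mulr1 big1 ?addr0 // => b /andP[_ ba].
    rewrite mcoeffZ mcoeffX; case: eqP => [E|]; last by rewrite mulr0.
    by case/eqP: ba; apply: val_inj.
  rewrite mmeasureE; apply/bigmax_leqP_seq => a ap _.
  by move/dhomogP: (pihomogP mdeg k p) => /(_ _ ap) /= ->.
rewrite raddf_sum; apply: eq_bigr => a _ /=.
by rewrite mevalZ mevalX.
Qed.

End PolynomialSeries.

Section FrameExists.
Context {R : realType} {n : nat}.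
Local Notation C := (CC R).

Lemma real_analytic_poly (f : 'cV[C]_n -> C) p (P : {mpoly C[n + n]}) :
  (forall w, f (p + w) =
    P.@[(col_mx (map_mx (fun x => 'Re x) w) (map_mx (fun x => 'Im x) w))^~ 0]) ->
  real_analytic_at f p.
Proof.
move=> fP; exists (fun a => P@_a); near=> w.
by rewrite fP; exact: poly_power_series.
Unshelve. all: by end_near. Qed.

Lemma real_analytic_linear (c1 c2 : C) (j1 j2 : 'I_n) p :
  real_analytic_at (fun w : 'cV[C]_n => w j1 0 * c1 - w j2 0 * c2) p.
Proof.
pose X j : {mpoly C[n + n]} :=
  (p j 0)%:MP + 'X_(lshift n j) + 'i *: 'X_(rshift n j).
apply: (@real_analytic_poly _ _ (c1 *: X j1 - c2 *: X j2)) => w.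
rewrite mevalB !mevalZ !mevalD !mevalC !mevalZ !mevalXU.
by rewrite !col_mxEu !col_mxEd !mxE -!addrA -!Crect [c1 * _]mulrC [c2 * _]mulrC.
Qed.

Lemma sqnorm_line (c : C) (j : 'I_n) (z : 'cV[C]_n) (t : R) :
  sqnorm (z + (t%:C)%C *: (c *: delta_mx j 0) : 'cV[C]_n) =
  \sum_(i | i != j) `|z i 0| ^+ 2 + `|z j 0 + (t%:C)%C * c| ^+ 2 :> C.
Proof.
rewrite /sqnorm (bigD1 j) //= addrC; congr (_ + _).
  by apply: eq_bigr => i ij; rewrite !mxE (negPf ij) /= !mulr0 addr0.
by rewrite !mxE !eqxx !mulr1.
Qed.

Lemma real_deriv_sqnorm (c : C) (j : 'I_n) (z : 'cV[C]_n) :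
  real_deriv (c *: delta_mx j 0) sqnorm z = (z j 0)^* * c + z j 0 * c^*.
Proof.
rewrite /real_deriv; under eq_fun do rewrite sqnorm_line.
under [X in (_ +i* derive1 X _)%C]eq_fun do rewrite sqnorm_line.
move: (\sum_(i | _) _) (z j 0) => [s s'] [a b]; move: c => [e f].
have E t : (Complex s s' : C) + `|(Complex a b : C) + (t%:C)%C * (Complex e f : C)| ^+ 2
   = Complex (s + ((a + t * e) ^+ 2 + (b + t * f) ^+ 2)) s'.
  rewrite normCK; rewrite /=; simpc; congr Complex; ring.
under eq_fun do rewrite E /=.
under [X in (_ +i* derive1 X _)%C]eq_fun do rewrite E /=.
rewrite !derive1E derive_cst.
have -> : 'D_1 (fun t : R => s + ((a + t * e) ^+ 2 + (b + t * f) ^+ 2)) 0 = 2 * (a * e + b * f).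
  by rewrite derive_val /GRing.scale /=; ring.
by rewrite /=; simpc; congr Complex; ring.
Qed.

Lemma dbar_sqnorm (j : 'I_n) (z : 'cV[C]_n) : dbar j sqnorm z = z j 0.
Proof.
have e := real_deriv_sqnorm 1 j z; rewrite scale1r in e.
rewrite /dbar e real_deriv_sqnorm conjC1 conjCi.
set x := z j 0; set y := x^*.
rewrite (_ : _ + _ = (1 - 'i ^+ 2) * x + (1 + 'i ^+ 2) * y); last by ring.
by rewrite sqrCi; field.
Qed.

Lemma cr_frame_exists (p : 'cV[C]_n) : sphere p ->
  exists a : 'I_n.-1 -> 'cV[C]_n -> 'cV[C]_n, cr_frame p a.
Proof.
move=> Sp.
have [i0 pi0] : exists i, p i 0 != 0.
  apply/existsP; apply/contraT => /existsPn p0.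
  move: Sp; rewrite /sphere /= /sqnorm big1 => [/esym/eqP|i _].
    by rewrite oner_eq0.
  by move: (p0 i); rewrite negbK => /eqP ->; rewrite normr0 expr0n.
exists (fun k z => z i0 0 *: delta_mx (lift i0 k) 0 - z (lift i0 k) 0 *: delta_mx i0 0).
exists [set z | z i0 0 != 0]; split.
- split=> //; apply: (@open_comp _ _ (fun z : 'cV[C]_n => z i0 0) [set x | x != 0]).
    by move=> z _; exact: coord_continuous.
  rewrite (_ : mkset _ = ~` [set 0 : C]).
    exact/closed_openC/accessible_closed_set1/hausdorff_accessible/norm_hausdorff.
  by apply/seteqP; split => x /=; [move/eqP | move/eqP].
- move=> k j z _.
  have := real_analytic_linear ((delta_mx (lift i0 k) 0 : 'cV[C]_n) j 0)
     ((delta_mx i0 0 : 'cV[C]_n) j 0) i0 (lift i0 k) z.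
  by congr real_analytic_at; apply/funext => w; rewrite !mxE.
- move=> k z _ _; rewrite /Lbar.
  under eq_bigr do rewrite dbar_sqnorm !mxE eqxx !andbT mulrBl.
  rewrite sumrB (bigD1 (lift i0 k)) //= eqxx big1 => [|i /negPf ->]; last first.
    by rewrite mulr0 mul0r.
  rewrite (bigD1 i0) //= eqxx [X in _ - (_ + X)]big1 => [|i /negPf ->]; last first.
    by rewrite mulr0 mul0r.
  by rewrite !addr0 !mulr1 mulrC subrr.
- move=> z zi0 _; apply/freeP => c c0 k.
  move/matrixP: c0 => /(_ (lift i0 k) 0).
  rewrite summxE (bigD1 k) //= big1 => [|i ik].
    rewrite nth_mktuple !mxE eqxx eq_sym.
    rewrite (negPf (neq_lift _ _)) !mulr0 subr0 mulr1 addr0.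
    by move/eqP; rewrite mulf_eq0 (negPf zi0) orbF => /eqP.
  rewrite nth_mktuple !mxE (inj_eq lift_inj) eq_sym (negPf ik).
  by rewrite (eq_sym _ i0) (negPf (neq_lift _ _)) !mulr0 subr0 mulr0.
Qed.

End FrameExists.

(* Main.v *)
Require Import Defs.
From mathcomp.multinomials Require Import mpoly.
From mathcomp Require Import all_boot all_order all_algebra.
From mathcomp Require Import all_classical all_reals all_analysis.
From mathcomp Require Import complex ring zify.

(** Let S be the unit sphere and call a field L = \sum_j a_j d/d(conj z_j)
    tangential when a(z) . z = 0 on S. Three facts carry the proof.

    - Tangential derivatives on S only depend on values on S ([Lbar_sphere0]),
      and they treat holomorphic functions as constants ([Lbars_holo_comb]).

    - Let q be a polynomial, u a smooth function with u(p) <> 0 and p a point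
      of S. All the iterated derivatives of u(z) q(conj z) along a basis of
      tangential fields vanish at p if and only if q vanishes on the
      hyperplane of the points w with w . p = 1, the conjugate of the Segre
      variety of p ([Lbar_pow_hyperplane]). Indeed a composition of r fields
      is an r-fold derivative of q at conj p along the hyperplane, plus terms
      of lower order that are again derivatives along the hyperplane:
      differentiating the equation a(z) . z = 0 along a tangential field shows
      that the derivatives of a are tangential too.

    - If q is homogeneous and vanishes on that hyperplane, then q = 0
      ([hpoly_hyperplane]).

    On S the definition of V_H reads X . conj P = V_H X . conj (H^d), where
    V_H X is holomorphic and the components of H^d are independent homogeneous
    polynomials. The three facts give that the tangential derivatives of X .
    conj H at p all vanish if and only if V_H(p) X = 0 ([Lbar_pow_Hnd]). So
    the derivatives of conj H at p span C^m if and only if V_H(p) is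
    injective, which is the statement about finite nondegeneracy.

    For holomorphic nondegeneracy, the same facts applied to a holomorphic Y
    with Y . conj H = 0 on S show that V_H Y = 0 on S ([orthogonal_kernel]).
    If V_H has rank m on a dense subset, Y vanishes on S. A holomorphic
    function vanishing on S has all its derivatives zero there, because the
    tangent spaces of S span C^n over C ([holo_vanish_derivative]), so Y = 0
    by the identity theorem. Conversely, either some maximal minor of V_H is a
    nonzero polynomial, and it is nonzero on a dense subset of S for the same
    reason, or V_H has a nonzero polynomial kernel vector Y
    ([minor_or_kernel]), and then Y . conj H = 0 on S.

    The frames have real-analytic coefficients, given by power series.
    Termwise differentiation of power series ([psum_derivative]) provides the
    derivatives of all orders of such functions, and those of holomorphic
    ones. *)

Set Implicit Arguments.
Unset Strict Implicit.
Unset Printing Implicit Defensive.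
Import Order.TTheory GRing.Theory Num.Theory numFieldNormedType.Exports.
Local Open Scope classical_set_scope.
Local Open Scope ring_scope.

(** * Real differentiability in complex coordinates *)

Section Wirtinger.
Context {R : realType} {n : nat}.
Local Notation C := (CC R).
Implicit Types (f g r : 'cV[C]_n -> C) (z p v w : 'cV[C]_n).

Lemma norm_coord_le N (w : 'cV[C]_N) i : `|w i 0| <= `|w|.
Proof.
suff h (e : C) : 0 <= e -> `|w| <= e -> `|w i 0| <= e by exact: h.
move=> /nonnegP[{}e]; rewrite [X in X <= _ -> _]/Num.Def.normr /= mx_normE num_le.
by move=> /bigmax_leP[_ /(_ (i, 0) isT)]; rewrite -num_le.
Qed.

Lemma norm_cV_le N (w : 'cV[C]_N) (e : C) :
  0 <= e -> (forall i, `|w i 0| <= e) -> `|w| <= e.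
Proof.
move=> /nonnegP[{}e] we; rewrite [leLHS]/Num.Def.normr /= mx_normE num_le.
apply/bigmax_leP; split => [|[i j] _]; first by rewrite -num_le /=.
by rewrite -num_le /= ord1 we.
Qed.

Lemma cV_addE N (v w : 'cV[C]_N) i : (v + w) i 0 = v i 0 + w i 0.
Proof. by rewrite mxE. Qed.

Lemma cV_scaleE N k (v : 'cV[C]_N) i : (k *: v) i 0 = k * v i 0.
Proof. by rewrite mxE. Qed.

Lemma cV_eqP N (v w : 'cV[C]_N) : (forall i, v i 0 = w i 0) -> v = w.
Proof. by move=> vw; apply/matrixP => i j; rewrite ord1. Qed.

Lemma conjvE (w : 'cV[C]_n) i : conjv w i 0 = (w i 0)^*.
Proof. by rewrite mxE. Qed.

Lemma norm_dot_le N (al w : 'cV[C]_N) :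
  `|dot al w| <= (\sum_i `|al i 0|) * `|w|.
Proof.
rewrite /dot mulr_suml; apply: le_trans (ler_norm_sum _ _ _) _.
by apply: ler_sum => i _; rewrite normrM ler_wpM2l // norm_coord_le.
Qed.

Lemma norm_conjv N (w : 'cV[C]_N) : `|conjv w| <= `|w|.
Proof. by apply: norm_cV_le => // i; rewrite mxE norm_conjC norm_coord_le. Qed.

Lemma open_neq0 : open [set x : C | x != 0].
Proof.
rewrite (_ : mkset _ = ~` [set 0 : C]).
  exact/closed_openC/accessible_closed_set1/hausdorff_accessible/norm_hausdorff.
by apply/seteqP; split => x /=; [move/eqP | move/eqP].
Qed.

Lemma near0_norm_le N (e : C) : 0 < e -> \forall w \near (0 : 'cV[C]_N), `|w| <= e.
Proof. by move=> e0; apply/nbhs_norm0P; exists e => // w /= /ltW. Qed.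

(** The constants A and the errors e are complex numbers, since the norm of
    C^n takes its values in C. *)
Definition bounded0 r := exists A : C, \forall w \near (0 : 'cV[C]_n), `|r w| <= A.
Definition bigO0 r := exists A : C, \forall w \near (0 : 'cV[C]_n), `|r w| <= A * `|w|.
Definition littleo0 r :=
  forall e : C, 0 < e -> \forall w \near (0 : 'cV[C]_n), `|r w| <= e * `|w|.

Lemma littleo0D r s : littleo0 r -> littleo0 s -> littleo0 (fun w => r w + s w).
Proof.
move=> hr hs e e0; have e2 : 0 < e / 2 by rewrite divr_gt0.
near=> w; rewrite [e](splitr e) mulrDl; apply: le_trans (ler_normD _ _) _.
by apply: lerD; near: w; [exact: hr | exact: hs].
Unshelve. all: by end_near. Qed.

Lemma littleo0_eq r s : (\forall w \near (0 : 'cV[C]_n), r w = s w) ->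
  littleo0 r -> littleo0 s.
Proof.
move=> rs hr e e0; near=> w.
have <- : r w = s w by near: w.
by near: w; exact: hr.
Unshelve. all: by end_near. Qed.

Lemma littleo0_cst0 : littleo0 (fun=> 0).
Proof.
by move=> e e0; near=> w; rewrite normr0 mulr_ge0 // ltW.
Unshelve. all: by end_near. Qed.

Lemma littleo0_bounded r s : bounded0 r -> littleo0 s -> littleo0 (fun w => r w * s w).
Proof.
move=> [A hA] hs e e0; pose B := `|A| + 1.
have B0 : 0 < B by rewrite ltr_wpDl.
have eB : 0 < e / B by rewrite divr_gt0.
near=> w; rewrite normrM.
have rA : `|r w| <= B.
  apply: (le_trans (y := `|A|)); last by rewrite lerDl.
  have h : `|r w| <= A by near: w.
  by rewrite (le_trans h) // real_ler_norm // ger0_real // (le_trans _ h).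
have sA : `|s w| <= e / B * `|w| by near: w; exact: hs.
apply: le_trans (ler_pM _ _ rA sA) _ => //.
by rewrite mulrA mulrCA divff ?mulr1 // gt_eqF.
Unshelve. all: by end_near. Qed.

Lemma bounded0_cst (c : C) : bounded0 (fun=> c).
Proof. by exists `|c|; near=> w. Unshelve. all: by end_near. Qed.

Lemma bigO0_small r : bigO0 r ->
  forall e : C, 0 < e -> \forall w \near (0 : 'cV[C]_n), `|r w| <= e.
Proof.
move=> [A hA] e e0; pose B := `|A| + 1.
have B0 : 0 < B by rewrite ltr_wpDl.
have eB : 0 < e / B by rewrite divr_gt0.
near=> w.
have h : `|r w| <= A * `|w| by near: w.
apply: le_trans h _.
have [->|w0] := eqVneq w 0; first by rewrite normr0 mulr0 ltW.
have w1 : `|w| <= e / B by near: w; exact: near0_norm_le.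
have A0 : 0 <= A.
  have h : `|r w| <= A * `|w| by near: w.
  by rewrite -(@pmulr_lge0 _ `|w|) ?normr_gt0 // (le_trans _ h).
apply: le_trans (ler_wpM2l A0 w1) _.
rewrite mulrA ler_pdivrMr // mulrC ler_pM2l //.
by rewrite /B ger0_norm // lerDl.
Unshelve. all: by end_near. Qed.

Lemma littleo0_mulO r s : bigO0 r -> bigO0 s -> littleo0 (fun w => r w * s w).
Proof.
move=> hr [A hA] e e0; pose B := `|A| + 1.
have B0 : 0 < B by rewrite ltr_wpDl.
have eB : 0 < e / B by rewrite divr_gt0.
near=> w; rewrite normrM.
have h1 : `|r w| <= e / B by near: w; exact: bigO0_small.
have h2 : `|s w| <= B * `|w|.
  have h : `|s w| <= A * `|w| by near: w.
  apply: le_trans h _.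
  have [->|w0] := eqVneq w 0; first by rewrite normr0 !mulr0.
  have A0 : 0 <= A.
    have h : `|s w| <= A * `|w| by near: w.
    by rewrite -(@pmulr_lge0 _ `|w|) ?normr_gt0 // (le_trans _ h).
  by rewrite ler_wpM2r // /B ger0_norm // lerDl.
apply: le_trans (ler_pM _ _ h1 h2) _ => //.
by rewrite mulrA divfK // gt_eqF.
Unshelve. all: by end_near. Qed.

Lemma bigO0_dot al be : bigO0 (fun w => dot al w + dot be (conjv w)).
Proof.
exists (\sum_i `|al i 0| + \sum_i `|be i 0|); near=> w.
apply: le_trans (ler_normD _ _) _; rewrite mulrDl; apply: lerD.
  exact: norm_dot_le.
apply: le_trans (norm_dot_le _ _) _; apply: ler_wpM2l; first by apply: sumr_ge0.
exact: norm_conjv.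
Unshelve. all: by end_near. Qed.

Lemma bigO0_littleo r : littleo0 r -> bigO0 r.
Proof. by move=> h; exists 1; exact: h. Qed.

Lemma bigO0D r s : bigO0 r -> bigO0 s -> bigO0 (fun w => r w + s w).
Proof.
move=> [A hA] [B hB]; exists (A + B); near=> w.
by apply: le_trans (ler_normD _ _) _; rewrite mulrDl lerD //; near: w.
Unshelve. all: by end_near. Qed.

(** The function f is differentiable at z over the real numbers, with
    differential w |-> al . w + be . conj w. So al and be are the gradients
    of f with respect to z and to conj z, and f satisfies the Cauchy-Riemann
    equations at z when be = 0. *)
Definition wdiff f z (al be : 'cV[C]_n) :=
  littleo0 (fun w => f (z + w) - f z - (dot al w + dot be (conjv w))).

Lemma wdiff_bigO f z al be : wdiff f z al be -> bigO0 (fun w => f (z + w) - f z).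
Proof.
move=> /bigO0_littleo h; have := bigO0D h (bigO0_dot al be).
by congr bigO0; apply/funext => w; rewrite subrK.
Qed.

Lemma wdiff_continuous f z al be : wdiff f z al be -> {for z, continuous f}.
Proof.
move=> /wdiff_bigO/bigO0_small h A /nbhs_ballP[e /= e0 eA].
have e2 : 0 < e / 2 by rewrite divr_gt0.
suff: \forall w \near z, A (f w) by [].
apply/nbhs0P; near=> w; apply: eA; rewrite -ball_normE /= distrC.
apply: (@le_lt_trans _ _ (e / 2)); first by near: w; exact: h.
by rewrite ltr_pdivrMr // mulr_natr mulr2n ltrDl.
Unshelve. all: by end_near. Qed.

Lemma dot0v N (w : 'cV[C]_N) : dot 0 w = 0.
Proof. by rewrite /dot big1 // => i _; rewrite mxE mul0r. Qed.

Lemma dotv0 N (w : 'cV[C]_N) : dot w 0 = 0.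
Proof. by rewrite /dot big1 // => i _; rewrite mxE mulr0. Qed.

Lemma dotC N (v w : 'cV[C]_N) : dot v w = dot w v.
Proof. by apply: eq_bigr => i _; rewrite mulrC. Qed.

Lemma dotDl N (v1 v2 w : 'cV[C]_N) : dot (v1 + v2) w = dot v1 w + dot v2 w.
Proof. by rewrite -big_split /=; apply: eq_bigr => i _; rewrite mxE mulrDl. Qed.

Lemma dotDr N (v1 v2 w : 'cV[C]_N) : dot w (v1 + v2) = dot w v1 + dot w v2.
Proof. by rewrite dotC dotDl !(dotC w). Qed.

Lemma dotZl N (c : C) (v w : 'cV[C]_N) : dot (c *: v) w = c * dot v w.
Proof. by rewrite mulr_sumr; apply: eq_bigr => i _; rewrite mxE mulrA. Qed.

Lemma dotZr N (c : C) (v w : 'cV[C]_N) : dot v (c *: w) = c * dot v w.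
Proof. by rewrite dotC dotZl dotC. Qed.

Lemma dotNl N (v w : 'cV[C]_N) : dot (- v) w = - dot v w.
Proof. by rewrite -scaleN1r dotZl mulN1r. Qed.

Lemma dot_delta N (v : 'cV[C]_N) j : dot v (delta_mx j 0) = v j 0.
Proof.
rewrite /dot (bigD1 j) //= big1 ?mxE ?eqxx ?mulr1 ?addr0 // => i ij.
by rewrite mxE (negPf ij) mulr0.
Qed.

Lemma delta_dot N (v : 'cV[C]_N) j : dot (delta_mx j 0) v = v j 0.
Proof. by rewrite dotC dot_delta. Qed.

Lemma dot_sumr N (I : Type) (s : seq I) (F : I -> 'cV[C]_N) (v : 'cV[C]_N) :
  dot v (\sum_(i <- s) F i) = \sum_(i <- s) dot v (F i).
Proof.
by apply: (big_morph (dot v)) => [x y|]; rewrite ?dotDr ?dotv0.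
Qed.

Lemma conjvD (v w : 'cV[C]_n) : conjv (v + w) = conjv v + conjv w.
Proof. by apply/matrixP => i j; rewrite !mxE rmorphD. Qed.

Lemma conjvZ c (v : 'cV[C]_n) : conjv (c *: v) = c^* *: conjv v.
Proof. by apply/matrixP => i j; rewrite !mxE rmorphM. Qed.

Lemma conjvK (v : 'cV[C]_n) : conjv (conjv v) = v.
Proof. by apply/matrixP => i j; rewrite !mxE conjCK. Qed.

Lemma wdiff_cst c z : wdiff (fun=> c) z 0 0.
Proof.
apply: littleo0_eq littleo0_cst0; near=> w; rewrite !dot0v; ring.
Unshelve. all: by end_near. Qed.

Lemma wdiff_coord j z : wdiff (fun w => w j 0) z (delta_mx j 0) 0.
Proof.
apply: littleo0_eq littleo0_cst0; near=> w; rewrite delta_dot dot0v mxE; ring.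
Unshelve. all: by end_near. Qed.

Lemma wdiff_conj_coord j z : wdiff (fun w => (w j 0)^*) z 0 (delta_mx j 0).
Proof.
apply: littleo0_eq littleo0_cst0; near=> w.
rewrite delta_dot dot0v !mxE rmorphD; ring.
Unshelve. all: by end_near. Qed.

Lemma wdiffD f g z a b c d : wdiff f z a b -> wdiff g z c d ->
  wdiff (fun w => f w + g w) z (a + c) (b + d).
Proof.
move=> hf hg; have := littleo0D hf hg; congr littleo0; apply/funext => w.
by rewrite !dotDl; ring.
Qed.

(** Besides the remainders of f and g there is the product of the two
    increments, which is quadratic in w. *)
Lemma wdiffM f g z a b c d : wdiff f z a b -> wdiff g z c d ->
  wdiff (fun w => f w * g w) z (f z *: c + g z *: a) (f z *: d + g z *: b).
Proof.
move=> hf hg.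
have h1 := littleo0_bounded (bounded0_cst (f z)) hg.
have h2 := littleo0_bounded (bounded0_cst (g z)) hf.
have h3 := littleo0_mulO (wdiff_bigO hf) (wdiff_bigO hg).
have := littleo0D (littleo0D h1 h2) h3; congr littleo0; apply/funext => w.
by rewrite !dotDl !dotZl; ring.
Qed.

Lemma wdiff_near f g z a b :
  (\forall w \near z, f w = g w) -> wdiff f z a b -> wdiff g z a b.
Proof.
move=> fg; apply: littleo0_eq; have := nbhs_singleton fg => fgz.
move/nbhs0P : fg => fg; near=> w.
by rewrite fgz; congr (_ - _ - _); near: w.
Unshelve. all: by end_near. Qed.

Lemma wdiffV g z a b : g z != 0 -> wdiff g z a b ->
  wdiff (fun w => (g w)^-1) z (- (g z)^-1 ^+ 2 *: a) (- (g z)^-1 ^+ 2 *: b).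
Proof.
move=> g0 h.
have gz : 0 < `|g z| / 2 by rewrite divr_gt0 // normr_gt0.
have low : \forall w \near (0 : 'cV[C]_n), `|g z| / 2 <= `|g (z + w)|.
  have := bigO0_small (wdiff_bigO h) gz; apply: filterS => w hw.
  have := ler_normB (g (z + w)) (g (z + w) - g z).
  rewrite (_ : g (z + w) - (g (z + w) - g z) = g z); last by ring.
  move=> h'; rewrite -(lerD2r (`|g z| / 2)) -splitr.
  by apply: le_trans h' _; rewrite lerD2l.
have bd : bounded0 (fun w => ((g z)^-1 ^+ 2) * (g (z + w))^-1).
  exists (`|(g z)^-1 ^+ 2| * (`|g z| / 2)^-1); near=> w.
  rewrite normrM ler_wpM2l // normfV lef_pV2 ?posrE //; first by near: w.
  by apply: lt_le_trans gz _; near: w.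
have h1 := littleo0_mulO (bigO0_dot a b) (wdiff_bigO h).
have h2 := littleo0_bounded (bounded0_cst (- g z)) h.
apply: littleo0_eq (littleo0_bounded bd (littleo0D h1 h2)).
near=> w; rewrite !dotZl.
have gw : g (z + w) != 0.
  by rewrite -normr_gt0; apply: lt_le_trans gz _; near: w.
set x := dot a w; set y := dot b _.
by field; rewrite g0 gw.
Unshelve. all: by end_near. Qed.

End Wirtinger.

(** * Series of complex numbers *)

Section ComplexSeries.
Context {R : realType}.
Local Notation C := (CC R).

Lemma ReD (x y : C) : complex.Re (x + y) = complex.Re x + complex.Re y.
Proof. by case: x y => [a b] [c d]. Qed.

Lemma ImD (x y : C) : complex.Im (x + y) = complex.Im x + complex.Im y.
Proof. by case: x y => [a b] [c d]. Qed.

Lemma Re_sum (u : nat -> C) k : complex.Re (series u k) = series (fun i => complex.Re (u i)) k.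
Proof. by apply: (big_morph (@complex.Re R)); [exact: ReD | ]. Qed.

Lemma Im_sum (u : nat -> C) k : complex.Im (series u k) = series (fun i => complex.Im (u i)) k.
Proof. by apply: (big_morph (@complex.Im R)); [exact: ImD | ]. Qed.

Lemma norm_Complex_le (a b : R) : `|(a +i* b)%C : C| <= (`|a| + `|b|)%:C%C.
Proof.
rewrite (_ : (a +i* b)%C = (a%:C)%C + (0 +i* b)%C :> C); last first.
  by rewrite /GRing.add /= addr0 add0r.
apply: le_trans (ler_normD _ _) _; rewrite (rmorphD (real_complex R)).
apply: lerD; rewrite normc_def lecR /= ?expr0n /= ?addr0 ?add0r sqrtr_sqr //.
Qed.

Lemma cvg_complex (u : nat -> C) (a b : R) :
  (fun k => complex.Re (u k)) @ \oo --> a -> (fun k => complex.Im (u k)) @ \oo --> b ->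
  u @ \oo --> ((a +i* b)%C : C).
Proof.
move=> /cvgrPdist_le ua /cvgrPdist_le ub; apply/cvgrPdist_le => e e0.
have [e' ee'] : exists e' : R, e = (e'%:C)%C.
  by have /complex_realP[e' ?] := gtr0_real e0; exists e'.
have e'0 : 0 < e' / 2 by move: e0; rewrite ee' ltcR => ?; rewrite divr_gt0.
near=> k.
have h1 : `|a - complex.Re (u k)| <= e' / 2 by near: k; exact: ua.
have h2 : `|b - complex.Im (u k)| <= e' / 2 by near: k; exact: ub.
move: h1 h2; case: (u k) => [x y] /= h1 h2.
rewrite (_ : _ - _ = ((a - x) +i* (b - y))%C) //.
by apply: le_trans (norm_Complex_le _ _) _; rewrite ee' lecR [e']splitr lerD.
Unshelve. all: by end_near. Qed.

Lemma norm_Re_le (x : C) (b : R) : `|x| <= (b%:C)%C -> `|complex.Re x| <= b.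
Proof. by move=> h; rewrite -lecR; apply: le_trans h; exact: normc_ge_Re. Qed.

Lemma norm_Im_le (x : C) (b : R) : `|x| <= (b%:C)%C -> `|complex.Im x| <= b.
Proof.
move=> h; have := norm_Re_le (x := 'i%C * x) (b := b).
case: x h => x y h /=; rewrite !mul0r !mul1r sub0r normrN; apply.
by rewrite normrM normc_def /= expr0n expr1n add0r sqrtr1 mul1r.
Qed.

(** The real and imaginary parts converge absolutely, by comparison with a
    geometric series. All the power series below are compared in this way. *)
Lemma geometric_cvg (u : nat -> C) (B : C) : (forall k, `|u k| <= B / 2 ^+ k) ->
  exists2 s : C, series u @ \oo --> s & `|s| <= B *+ 2.
Proof.
move=> uB.
have B0 : 0 <= B by have := uB 0%N; rewrite expr0 divr1; exact: le_trans.
have [b Bb] : exists b : R, B = (b%:C)%C.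
  by have /complex_realP[e' ?] := ger0_real B0; exists e'.
have b0 : 0 <= b by move: B0; rewrite Bb lecR.
have Bk k : B / 2 ^+ k = ((b / 2 ^+ k)%:C)%C.
  by rewrite Bb rmorphM fmorphV rmorphXn rmorph_nat.
have gc : cvgn (series (fun k => b / 2 ^+ k)).
  have := @is_cvg_geometric_series _ b 2^-1; rewrite ger0_norm ?invr_ge0 // => h.
  have := h (_ : 2^-1 < 1); rewrite invf_lt1 ?ltr1n // => /(_ isT).
  by congr (cvgn (series _)); apply/funext => k; rewrite /geometric /= exprVn.
have cR (v : nat -> R) : (forall k, `|v k| <= b / 2 ^+ k) -> cvgn (series v).
  move=> vb; apply: normed_cvg; apply: series_le_cvg gc => k //=.
  by rewrite divr_ge0 // exprn_ge0.
have cRe : cvgn (series (fun k => complex.Re (u k))).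
  by apply: cR => k; apply: norm_Re_le; rewrite -Bk.
have cIm : cvgn (series (fun k => complex.Im (u k))).
  by apply: cR => k; apply: norm_Im_le; rewrite -Bk.
move: cRe cIm => /cvg_ex[a ha] /cvg_ex[a' ha'].
have us : series u @ \oo --> ((a +i* a')%C : C).
  apply: cvg_complex.
    by under eq_fun do rewrite Re_sum.
  by under eq_fun do rewrite Im_sum.
exists ((a +i* a')%C : C) => //.
have bnd k : `|series u k| <= B *+ 2.
  apply: le_trans (ler_norm_sum _ _ _) _.
  apply: le_trans (ler_sum _ (fun i _ => uB i)) _.
  suff -> : \sum_(0 <= i < k) B / 2 ^+ i = B *+ 2 - B / 2 ^+ k *+ 2.
    by rewrite lerBlDr lerDl mulrn_wge0 // divr_ge0 // exprn_ge0.
  elim: k => [|k IH]; first by rewrite big_nil expr0 divr1 subrr.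
  rewrite big_nat_recr //= IH exprS.
  by rewrite -[X in X = _]/(_ + _); field; rewrite expf_neq0 // pnatr_eq0.
move: us => /cvgrPdist_le us; apply/ler_addgt0Pr => e e0.
have [k _ /(_ k (leqnn k)) /= hk] := us e e0.
rewrite -[X in `|X|](subrK (series u k)) addrC.
by apply: le_trans (ler_normD _ _) _; apply: lerD.
Qed.

Lemma cvg_series_unique (u : nat -> C) (s t : C) :
  series u @ \oo --> s -> series u @ \oo --> t -> s = t.
Proof. by move=> us ut; apply: (cvg_unique _ us ut); exact: norm_hausdorff. Qed.

End ComplexSeries.

(** * Second-order estimates for monomials *)

Section HomogeneousPolynomials.
Context {R : realType} {N : nat}.
Local Notation C := (CC R).
Implicit Types (c : 'X_{1..N} -> C) (x h : 'cV[C]_N) (p : {mpoly C[N]}).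

Definition dirderiv p x h : C := \sum_j h j 0 * (mderiv j p).@[x^~ 0].

Lemma multinom_succ (a : 'X_{1..N}) k : mdeg a = k.+1 ->
  exists b i, a = (b + U_(i))%MM /\ mdeg b = k.
Proof.
move=> ak.
have [i ai] : exists i, a i != 0%N.
  apply/existsP; apply/contraT => /existsPn a0; move: ak; rewrite mdegE big1 // => i _.
  by move: (a0 i); rewrite negbK => /eqP.
have E : a = ((a - U_(i)) + U_(i))%MM.
  by rewrite submK //; apply/mnm_lepP => j; rewrite mnm1E; case: eqP => [<-|]; rewrite ?lt0n.
exists (a - U_(i))%MM, i; split=> //.
by move: ak; rewrite {1}E mdegD mdeg1 addn1 => -[].
Qed.

(** Taylor's formula for a monomial with a quadratic remainder whose
    constant grows only polynomially with the degree, which is what makes it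
    summable over all degrees. The factors s and s ^+ 2 on the left avoid
    negative powers of s. *)
Lemma monomial_estimate (x h : 'cV[C]_N) (s e : C) (a : 'X_{1..N}) :
  0 <= s -> 0 <= e ->
  (forall i, `|x i 0| <= s) -> (forall i, `|(x + h) i 0| <= s) ->
  (forall i, `|h i 0| <= e) ->
  let q : {mpoly C[N]} := 'X_[a] in
  [/\ `|q.@[x^~ 0]| <= s ^+ mdeg a,
      s * `|dirderiv q x h| <= (mdeg a)%:R * s ^+ mdeg a * e
    & s ^+ 2 * `|q.@[(x + h)^~ 0] - q.@[x^~ 0] - dirderiv q x h|
        <= (mdeg a ^ 2)%:R * s ^+ mdeg a * e ^+ 2].
Proof.
move=> s0 e0 xs xhs he; move E: (mdeg a) => k.
elim: k a E => [|k IH] a ak q.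
  have a0 : a = 0%MM by apply/eqP; rewrite -mdeg_eq0 ak.
  have d0 : dirderiv q x h = 0.
    by rewrite /dirderiv big1 // => j _; rewrite /q a0 mpolyX0 mderivC meval0 mulr0.
  rewrite d0 /q a0 mpolyX0 !meval1 expr0 normr1 normr0 !mulr0 !mul0r; split=> //.
  by rewrite (_ : 1 - 1 - 0 = 0) ?normr0 ?mulr0 //; ring.
have [b [i [ab bk]]] := multinom_succ ak.
pose p : {mpoly C[N]} := 'X_[b].
have qE : q = p * 'X_i by rewrite /q ab mpolyXD.
have dE : dirderiv q x h = dirderiv p x h * x i 0 + p.@[x^~ 0] * h i 0.
  rewrite /dirderiv mulr_suml.
  rewrite (_ : p.@[x^~ 0] * h i 0 = \sum_j h j 0 * (p.@[x^~ 0] * (i == j)%:R)); last first.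
    rewrite (bigD1 i) //= eqxx mulr1 big1 ?addr0 1?mulrC // => j /negPf.
    by rewrite eq_sym => ->; rewrite !mulr0.
  rewrite -big_split /=; apply: eq_bigr => j _.
  rewrite qE mderivM mevalD !mevalM mderivX mevalXU mulrDr mulrA; congr (_ + _ * (_ * _)).
  rewrite mevalZ mnm1E; case: eqP => [->|]; last by rewrite mul0r.
  rewrite (_ : (U_(j) - U_(j))%MM = 0%MM) ?mpolyX0 ?meval1 ?mulr1 //.
  by apply/mnmP => l; rewrite mnmBE mnm0E subnn.
have [IH1 IH2 IH3] := IH b bk.
move: IH1 IH2 IH3; rewrite -/p => IH1 IH2 IH3.
have sk : 0 <= s ^+ k by rewrite exprn_ge0.
split.
- by rewrite qE mevalM mevalXU normrM exprSr ler_pM.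
- rewrite dE; apply: le_trans (ler_wpM2l s0 (ler_normD _ _)) _.
  rewrite mulrDr !normrM.
  have -> : k.+1%:R * s ^+ k.+1 * e = k%:R * s ^+ k * e * s + s * (s ^+ k * e).
    by rewrite -natr1 exprSr; ring.
  apply: lerD; first by rewrite mulrA ler_pM // mulr_ge0.
  by rewrite ler_wpM2l // ler_pM.
- have -> : q.@[(x + h)^~ 0] - q.@[x^~ 0] - dirderiv q x h =
     (p.@[(x + h)^~ 0] - p.@[x^~ 0] - dirderiv p x h) * (x + h) i 0 + dirderiv p x h * h i 0.
    by rewrite dE qE !mevalM !mevalXU mxE; ring.
  apply: le_trans (ler_wpM2l (exprn_ge0 _ s0) (ler_normD _ _)) _.
  rewrite mulrDr !normrM.
  apply: (@le_trans _ _ ((k ^ 2)%:R * s ^+ k * e ^+ 2 * s + s * ((k%:R * s ^+ k * e) * e))).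
    apply: lerD; first by rewrite mulrA ler_pM // mulr_ge0 // exprn_ge0.
    rewrite expr2 -mulrA ler_wpM2l // mulrA ler_pM // mulr_ge0 //.
  have -> : (k ^ 2)%:R * s ^+ k * e ^+ 2 * s + s * (k%:R * s ^+ k * e * e) =
    (k ^ 2 + k)%:R * (s ^+ k.+1 * e ^+ 2) by rewrite natrD (exprSr s k); ring.
  rewrite -[leRHS]mulrA ler_wpM2r ?mulr_ge0 ?exprn_ge0 // ler_nat.
  by rewrite -!mulnn mulSn mulnS; apply: leq_trans (leq_addl k.+1 _); rewrite addnC.
Qed.

End HomogeneousPolynomials.

(** * Termwise differentiation of power series *)

Section PowerSeries.
Context {R : realType} {N : nat}.
Local Notation C := (CC R).
Implicit Types (c : 'X_{1..N} -> C) (x h w : 'cV[C]_N) (p : {mpoly C[N]}).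

(** Working with polynomials lets the formal derivative [mderiv] do the
    bookkeeping. *)
Definition hpart c k : {mpoly C[N]} :=
  \sum_(a : 'X_{1..N < k.+1} | mdeg a == k) c a *: 'X_[a].

Definition coef_norm c k : C := \sum_(a : 'X_{1..N < k.+1} | mdeg a == k) `|c a|.

Lemma coef_norm_ge0 c k : 0 <= coef_norm c k.
Proof. exact: sumr_ge0. Qed.

Lemma mcoeff_hpart c k a : (hpart c k)@_a = if mdeg a == k then c a else 0.
Proof.
rewrite /hpart raddf_sum /=; case: eqP => ak.
  have lta : (mdeg a < k.+1)%N by rewrite ak.
  rewrite (bigD1 (BMultinom lta)) /= ?ak // mcoeffZ mcoeffX eqxx mulr1.
  rewrite big1 ?addr0 // => b /andP[_ ba]; rewrite mcoeffZ mcoeffX.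
  case: eqP => [E|]; last by rewrite mulr0.
  by case/eqP: ba; apply: val_inj.
apply: big1 => b /eqP bk; rewrite mcoeffZ mcoeffX; case: eqP => [E|]; last by rewrite mulr0.
by case: ak; rewrite -E.
Qed.

Lemma hpart_eval c k x :
  (hpart c k).@[x^~ 0] = \sum_(a : 'X_{1..N < k.+1} | mdeg a == k) c a * monom x a.
Proof. by rewrite raddf_sum; apply: eq_bigr => a _; rewrite /= mevalZ monomE. Qed.

Definition dcoef (j : 'I_N) c : 'X_{1..N} -> C := fun a => c (a + U_(j))%MM *+ (a j).+1.

Lemma mderiv_hpart c k j : mderiv j (hpart c k.+1) = hpart (dcoef j c) k.
Proof.
apply/mpolyP => a; rewrite mcoeff_deriv !mcoeff_hpart mdegD mdeg1 addn1 eqSS.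
by case: eqP => // _; rewrite mul0rn.
Qed.

Lemma mderiv_hpart0 c j : mderiv j (hpart c 0) = 0.
Proof.
apply/mpolyP => a; rewrite mcoeff_deriv mcoeff_hpart mdegD mdeg1 addn1 /= mul0rn.
by rewrite mcoeff0.
Qed.

Lemma dirderiv_hpart c k x h : dirderiv (hpart c k) x h =
  \sum_(a : 'X_{1..N < k.+1} | mdeg a == k) c a * dirderiv ('X_[a] : {mpoly C[N]}) x h.
Proof.
rewrite /dirderiv; under [RHS]eq_bigr do rewrite mulr_sumr.
rewrite exchange_big /=; apply: eq_bigr => j _.
rewrite /hpart (raddf_sum (mderiv j)) (raddf_sum (meval _)) mulr_sumr.
apply: eq_bigr => a _ /=.
by rewrite mderivZ mevalZ mulrCA.
Qed.

(** A bound at the radius r alone; absolute convergence at smaller radii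
    follows by comparison with a geometric series. *)
Definition bounded_terms c (r M : C) := forall k, coef_norm c k * r ^+ k <= M.

Lemma coef_norm_dcoef j c k : coef_norm (dcoef j c) k <= k.+1%:R * coef_norm c k.+1.
Proof.
have ones (b : 'X_{1..N}) : monom (const_mx 1 : 'cV[C]_N) b = 1.
  by rewrite /monom big1 // => i _; rewrite mxE expr1n.
have E (c' : 'X_{1..N} -> C) l :
    coef_norm c' l = (hpart (fun a => `|c' a|) l).@[(const_mx 1 : 'cV[C]_N)^~ 0].
  by rewrite hpart_eval; apply: eq_bigr => a _; rewrite ones mulr1.
have -> : coef_norm (dcoef j c) k =
    (mderiv j (hpart (fun a => `|c a|) k.+1)).@[(const_mx 1 : 'cV[C]_N)^~ 0].
  rewrite mderiv_hpart E; congr (meval _ (hpart _ _)).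
  by apply/funext => a; rewrite /dcoef normrMn.
rewrite /hpart (raddf_sum (mderiv j)) (raddf_sum (meval _)) mulr_sumr.
apply: ler_sum => a /eqP ak /=.
rewrite mderivZ mevalZ mderivX mevalZ -monomE ones mulr1 mulrC ler_wpM2r // ler_nat.
apply: (@leq_trans (mdeg a)); last by rewrite ak.
by rewrite mdegE (bigD1 j) //= leq_addr.
Qed.

(** Halving the radius absorbs the factor k + 1 that a derivative produces
    in degree k, since k + 1 <= 2 ^ k. *)
Lemma bounded_dcoef j c (r M : C) : 0 < r -> bounded_terms c r M ->
  bounded_terms (dcoef j c) (r / 2) (M / r).
Proof.
move=> r0 cM k.
have rk : 0 <= (r / 2) ^+ k by rewrite exprn_ge0 // divr_ge0 // ltW.
apply: le_trans (ler_wpM2r rk (coef_norm_dcoef j c k)) _.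
have -> : k.+1%:R * coef_norm c k.+1 * (r / 2) ^+ k =
    (k.+1%:R / 2 ^+ k) * (coef_norm c k.+1 * r ^+ k.+1) / r.
  rewrite expr_div_n exprSr; field.
  by rewrite (gt_eqF r0) expf_neq0 // pnatr_eq0.
rewrite ler_pM2r ?invr_gt0 //; apply: le_trans (cM k.+1).
rewrite ler_piMl ?mulr_ge0 ?coef_norm_ge0 ?exprn_ge0 // ?(ltW r0) //.
by rewrite ler_pdivrMr ?exprn_gt0 // mul1r -natrX ler_nat ltn_expl.
Qed.

Lemma norm_monom x (s : C) b : (forall i, `|x i 0| <= s) -> `|monom x b| <= s ^+ mdeg b.
Proof.
move=> xs; rewrite /monom normr_prod mdegE -prodrXr.
by apply: ler_prod => i _; rewrite normr_ge0 normrX lerXn2r ?nnegrE // (le_trans _ (xs i)).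
Qed.

Lemma monom_const (s : C) b : monom (const_mx s : 'cV[C]_N) b = s ^+ mdeg b.
Proof. by rewrite mdegE -prodrXr; apply: eq_bigr => i _; rewrite mxE. Qed.

Lemma norm_monom_le c x (s : C) k : (forall i, `|x i 0| <= s) ->
  \sum_(a : 'X_{1..N < k.+1} | mdeg a == k) `|c a * monom x a| <= coef_norm c k * s ^+ k.
Proof.
move=> xs; rewrite mulr_suml; apply: ler_sum => a /eqP ak.
by rewrite normrM ler_wpM2l //; have := norm_monom a xs; rewrite ak.
Qed.

Lemma geometric_decay c (r M : C) k : 0 <= r -> bounded_terms c r M ->
  coef_norm c k * (r / 2) ^+ k <= M / 2 ^+ k.
Proof.
by move=> r0 cM; rewrite expr_div_n mulrA ler_wpM2r // invr_ge0 exprn_ge0.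
Qed.

(** The sum of the power series, with the default value 0 where it diverges. *)
Definition psum c x : C :=
  xget 0 [set s | series (fun k => (hpart c k).@[x^~ 0]) @ \oo --> s].

Lemma psum_unique c x s :
  series (fun k => (hpart c k).@[x^~ 0]) @ \oo --> s -> psum c x = s.
Proof.
move=> cs; rewrite /psum; case: xgetP => [t _ ct|/(_ s)//].
exact: cvg_series_unique ct cs.
Qed.

Lemma power_series_sum_psum c x s : power_series_sum c x s -> psum c x = s.
Proof.
move=> [_ cs]; apply: psum_unique; apply: cvg_trans cs.
by under eq_fun do rewrite hpart_eval.
Qed.

Lemma hpart_le c x (r M : C) k : 0 <= r -> bounded_terms c r M ->
  (forall i, `|x i 0| <= r / 2) -> `|(hpart c k).@[x^~ 0]| <= M / 2 ^+ k.
Proof.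
move=> r0 cM xr; rewrite hpart_eval; apply: le_trans (ler_norm_sum _ _ _) _.
by apply: le_trans (norm_monom_le _ _ xr) _; exact: geometric_decay.
Qed.

Lemma psum_cvg c x (r M : C) : 0 <= r -> bounded_terms c r M ->
  (forall i, `|x i 0| <= r / 2) ->
  series (fun k => (hpart c k).@[x^~ 0]) @ \oo --> psum c x.
Proof.
move=> r0 cM xr; have [s us _] := geometric_cvg (fun k => hpart_le k r0 cM xr).
by rewrite (psum_unique us).
Qed.

Lemma power_series_sum_bounded c (r s : C) : 0 <= r ->
  power_series_sum c (const_mx r) s -> exists M, bounded_terms c r M.
Proof.
move=> r0 [/cvg_ex[l ul] _]; move: ul.
set u := (X in series X); move=> ul.
have uE k : u k = coef_norm c k * r ^+ k.
  rewrite /u mulr_suml; apply: eq_bigr => a /eqP ak.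
  by rewrite normrM monom_const ak (ger0_norm (exprn_ge0 k r0)).
have u0 k : 0 <= u k by rewrite uE mulr_ge0 ?coef_norm_ge0 ?exprn_ge0.
exists `|l| => k; rewrite -uE.
have le_series m : (k < m)%N -> u k <= series u m.
  move=> km; rewrite /series /= (bigD1_seq k) ?iota_uniq ?mem_index_iota //=.
  by rewrite lerDl sumr_ge0.
move/cvgrPdist_le : ul => ul; apply/ler_addgt0Pr => e e0.
have [m _ hm] := ul e e0.
have /= hk := hm (maxn m k.+1) (leq_maxl _ _).
apply: le_trans (le_series (maxn m k.+1) (leq_maxr _ _)) _.
have -> : series u (maxn m k.+1) = `|series u (maxn m k.+1)|.
  by rewrite ger0_norm // sumr_ge0.
set t := series u _ in hk *.
rewrite (_ : t = l - (l - t)); last by ring.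
by apply: le_trans (ler_normB _ _) _; rewrite lerD2l.
Qed.

Lemma hpart_estimate c x h (s e : C) k : 0 <= s -> 0 <= e ->
  (forall i, `|x i 0| <= s) -> (forall i, `|(x + h) i 0| <= s) ->
  (forall i, `|h i 0| <= e) ->
  s ^+ 2 * `|(hpart c k).@[(x + h)^~ 0] - (hpart c k).@[x^~ 0] - dirderiv (hpart c k) x h|
    <= coef_norm c k * ((k ^ 2)%:R * s ^+ k * e ^+ 2).
Proof.
move=> s0 e0 xs xhs he; rewrite !hpart_eval dirderiv_hpart -!sumrB.
apply: le_trans (ler_wpM2l (exprn_ge0 _ s0) (ler_norm_sum _ _ _)) _.
rewrite mulr_sumr mulr_suml; apply: ler_sum => a /eqP ak.
rewrite -!mulrBr normrM mulrCA ler_wpM2l //.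
have [_ _] := @monomial_estimate _ _ x h s e a s0 e0 xs xhs he.
by rewrite -!monomE ak.
Qed.

(** This is how the factor k ^ 2 of [hpart_estimate] is absorbed by a
    geometric series. *)
Lemma sqr_le_exp2 k : (k ^ 2 <= 4 * 2 ^ k)%N.
Proof.
suff : (k ^ 2 <= 4 * 2 ^ k)%N && (2 * k + 1 <= 4 * 2 ^ k)%N by case/andP.
elim: k => [//|k]; rewrite (expnS 2) -!mulnn; have := expn_gt0 2 k; move: (2 ^ k)%N.
by move=> t /= t0 /andP[IH1 IH2]; apply/andP; split; lia.
Qed.

Lemma cvg_finite_sum (I : Type) (r : seq I) (u : I -> nat -> C) (l : I -> C) :
  (forall i, u i @ \oo --> l i) ->
  (fun k => \sum_(i <- r) u i k) @ \oo --> \sum_(i <- r) l i.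
Proof.
move=> ul; elim: r => [|i r IH].
  rewrite big_nil; under eq_fun do rewrite big_nil; exact: cvg_cst.
rewrite big_cons (_ : (fun k => _) = (fun k => u i k + \sum_(i <- r) u i k)).
  exact: (cvgD (ul i) IH).
by apply/funext => k; rewrite big_cons.
Qed.

(** Power series can be differentiated termwise: the quadratic remainders of
    the homogeneous parts have a finite sum. *)
Lemma psum_derivative c (r M : C) : 0 < r -> bounded_terms c r M ->
  exists B, forall x h, `|x| <= r / 8 -> `|h| <= r / 8 ->
    `|psum c (x + h) - psum c x - \sum_j h j 0 * psum (dcoef j c) x| <= B * `|h| ^+ 2.
Proof.
move=> r0 cM; pose s := r / 4.
have s0 : 0 < s by rewrite divr_gt0.
have s4 : r / 2 / 2 = s by rewrite /s; field.
exists (M * 8 / s ^+ 2) => x h xr hr.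
have r84 : r / 8 <= s by rewrite /s ler_pM2l // lef_pV2 ?posrE // ler_nat.
have r82 : r / 8 + r / 8 = s by rewrite /s; field.
have xs i : `|x i 0| <= s by apply: le_trans (norm_coord_le _ _) (le_trans xr r84).
have xhs i : `|(x + h) i 0| <= s.
  by apply: le_trans (norm_coord_le _ _) _; apply: le_trans (ler_normD _ _) _; rewrite -r82 lerD.
have s_r : s <= r / 2 by rewrite /s ler_pM2l // lef_pV2 ?posrE // ler_nat.
have xr2 i : `|x i 0| <= r / 2 := le_trans (xs i) s_r.
have xhr2 i : `|(x + h) i 0| <= r / 2 := le_trans (xhs i) s_r.
have c1 := psum_cvg (ltW r0) cM xhr2.
have c2 := psum_cvg (ltW r0) cM xr2.
have c3 j : series (fun k => (hpart (dcoef j c) k).@[x^~ 0]) @ \oo --> psum (dcoef j c) x.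
  apply: psum_cvg (bounded_dcoef j r0 cM) _; first by rewrite divr_ge0 // ltW.
  by move=> i; rewrite s4.
(* the derivative lowers the degree by one, hence the shift *)
have c4 : series (fun k => dirderiv (hpart c k) x h) @ \oo -->
    \sum_j h j 0 * psum (dcoef j c) x.
  rewrite -cvg_shiftS /=.
  have -> : (fun k => series (fun i => dirderiv (hpart c i) x h) k.+1) =
     (fun k => \sum_j h j 0 * series (fun i => (hpart (dcoef j c) i).@[x^~ 0]) k).
    apply/funext => k; rewrite /series /= big_nat_recl //.
    rewrite {1}/dirderiv big1 ?add0r; last by move=> j _; rewrite mderiv_hpart0 meval0 mulr0.
    under [RHS]eq_bigr do rewrite mulr_sumr.
    rewrite exchange_big /=; apply: eq_bigr => i _; apply: eq_bigr => j _.
    by rewrite mderiv_hpart.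
  apply: cvg_finite_sum => j; apply: cvgM; first exact: cvg_cst.
  exact: c3.
pose u k := (hpart c k).@[(x + h)^~ 0] - (hpart c k).@[x^~ 0] - dirderiv (hpart c k) x h.
have cu : series u @ \oo --> psum c (x + h) - psum c x - \sum_j h j 0 * psum (dcoef j c) x.
  have FF : Filter (\oo : set_system nat) by exact: eventually_filter.
  have h1 := @cvgB _ _ _ _ FF _ _ _ _ c1 c2.
  have h2 := @cvgB _ _ _ _ FF _ _ _ _ h1 c4.
  set v := (X in X @ _ --> _) in h2.
  have -> : series u = v by apply/funext => k; rewrite /series /= !sumrB.
  exact: h2.
have uB k : `|u k| <= (M * 4 / s ^+ 2 * `|h| ^+ 2) / 2 ^+ k.
  have := hpart_estimate c k (ltW s0) (normr_ge0 h) xs xhs (norm_coord_le h).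
  rewrite -/(u k) -ler_pdivlMl ?exprn_gt0 // => hu; apply: le_trans hu _.
  have -> : M * 4 / s ^+ 2 * `|h| ^+ 2 / 2 ^+ k =
      (s ^+ 2)^-1 * (M * (4 / 2 ^+ k) * `|h| ^+ 2) by ring.
  rewrite ler_pM2l ?invr_gt0 ?exprn_gt0 // mulrA mulrA ler_wpM2r ?exprn_ge0 //.
  have -> : coef_norm c k * (k ^ 2)%:R * s ^+ k =
      (coef_norm c k * r ^+ k) * ((k ^ 2)%:R / 4 ^+ k).
    by rewrite /s expr_div_n; ring.
  have t0 : 0 <= (k ^ 2)%:R / 4 ^+ k :> C by rewrite divr_ge0 // exprn_ge0.
  have M0 : 0 <= M.
    by apply: le_trans (cM 0%N); rewrite expr0 mulr1 coef_norm_ge0.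
  apply: le_trans (ler_wpM2r t0 (cM k)) _; apply: (ler_wpM2l M0).
  have p0 j : 0 < (j.+1%:R : C) ^+ k by rewrite exprn_gt0.
  (* s = r / 4, so the factor 4 ^- k beats k ^ 2 and leaves 2 ^- k *)
  have e4 : 4 ^+ k = 2 ^+ k * 2 ^+ k :> C by rewrite -exprMn -natrM.
  rewrite ler_pdivrMr // e4.
  have -> : 4 / 2 ^+ k * (2 ^+ k * 2 ^+ k) = 4 * 2 ^+ k :> C.
    by field; rewrite expf_neq0 // pnatr_eq0.
  by rewrite -natrX -natrM ler_nat sqr_le_exp2.
have [t ct tb] := geometric_cvg uB.
rewrite (cvg_series_unique cu ct); apply: le_trans tb _.
have e : M * 4 / s ^+ 2 * `|h| ^+ 2 *+ 2 = M * 8 / s ^+ 2 * `|h| ^+ 2.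
  by rewrite mulr2n; field; rewrite (gt_eqF s0).
by rewrite e.
Qed.

End PowerSeries.

(** * Wirtinger derivatives *)

Section RealDerivatives.
Context {R : realType} {n : nat}.
Local Notation C := (CC R).
Implicit Types (f : 'cV[C]_n -> C) (z v w : 'cV[C]_n).

Lemma derive1_at0 (h : R -> R) y l : h 0 = y ->
  (forall e, 0 < e -> exists2 d, 0 < d &
     forall t, `|t| < d -> `|h t - y - t * l| <= e * `|t|) ->
  derive1 h 0 = l.
Proof.
move=> hy hl; rewrite /derive1; apply: cvg_lim; first exact: Rhausdorff.
apply/cvgrPdist_le => e /hl[d d0 hd]; near=> t.
have t0 : t != 0 by near: t; exact: nbhs_dnbhs_neq.
have td : `|t| < d by near: t; exact: dnbhs0_lt.
rewrite addr0 hy -(ler_pM2r (_ : 0 < `|t|)) ?normr_gt0 // -normrM.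
apply: le_trans (hd t td); rewrite -normrN.
have -> : - ((l - t^-1 *: (h t - y)) * t) = h t - y - t * l.
  by rewrite /GRing.scale /=; field.
by [].
Unshelve. all: by end_near. Qed.

Lemma Re_lin (x y l : C) (t : R) :
  complex.Re (x - y - (t%:C)%C * l) = complex.Re x - complex.Re y - t * complex.Re l.
Proof. by case: x y l => [? ?] [? ?] [? ?] /=; rewrite mul0r subr0. Qed.

Lemma Im_lin (x y l : C) (t : R) :
  complex.Im (x - y - (t%:C)%C * l) = complex.Im x - complex.Im y - t * complex.Im l.
Proof. by case: x y l => [? ?] [? ?] [? ?] /=; rewrite mul0r addr0. Qed.

Lemma real_derivE f z v al be : wdiff f z al be ->
  real_deriv v f z = dot al v + dot be (conjv v).
Proof.
move=> hf; rewrite /real_deriv.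
set l := dot al v + _.
have [b vb] : exists b : R, `|v| = (b%:C)%C.
  by have /complex_realP[e' ?] := ger0_real (normr_ge0 v); exists e'.
have b0 : 0 <= b by move: (normr_ge0 v); rewrite vb lecR.
have b1 : 0 < b + 1 by rewrite ltr_wpDl.
have key e : 0 < e -> exists2 d, 0 < d & forall t : R, `|t| < d ->
    `|f (z + (t%:C)%C *: v) - f z - (t%:C)%C * l| <= ((e * `|t|)%:C)%C.
  move=> e0; have e1 : 0 < ((e / (b + 1))%:C)%C :> C by rewrite ltcR divr_gt0.
  have /nbhs_norm0P[d' /= d'0 hd'] := hf _ e1.
  have [d dE] : exists d : R, d' = (d%:C)%C.
    by have /complex_realP[e' ?] := gtr0_real d'0; exists e'.
  have d0 : 0 < d by move: d'0; rewrite dE ltcR.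
  exists (d / (b + 1)) => [|t td]; first by rewrite divr_gt0.
  have nt : `|(t%:C)%C : C| = (`|t|%:C)%C.
    by rewrite normc_def /= expr0n addr0 sqrtr_sqr.
  have := hd' ((t%:C)%C *: v); rewrite /= normrZ nt vb dE -rmorphM ltcR.
  move=> /(_ _)/le_trans h; rewrite (_ : (t%:C)%C * l = dot al ((t%:C)%C *: v) +
    dot be (conjv ((t%:C)%C *: v))); last first.
    rewrite conjvZ !dotZr /l mulrDr; congr (_ + _ * _).
    by apply/esym/conj_Creal; apply/complex_realP; exists t.
  apply: h.
    apply: le_lt_trans (_ : `|t| * (b + 1) < d); last by rewrite -ltr_pdivlMr.
    by rewrite ler_wpM2l // lerDl.
  rewrite -rmorphM lecR (_ : e / (b + 1) * (`|t| * b) = e * `|t| * (b / (b + 1)));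
    last by field; rewrite gt_eqF.
  by rewrite ler_piMr ?mulr_ge0 ?(ltW e0) // ler_pdivrMr // mul1r lerDl.
have g0 : f (z + (0%:C)%C *: v) = f z by rewrite scale0r addr0.
have -> : derive1 (fun t => complex.Re (f (z + (t%:C)%C *: v))) 0 = complex.Re l.
  apply: (@derive1_at0 _ (complex.Re (f z))); first exact: (f_equal _ g0).
  by move=> e /key[d d0 hd]; exists d => // t /hd/norm_Re_le; rewrite Re_lin.
have -> : derive1 (fun t => complex.Im (f (z + (t%:C)%C *: v))) 0 = complex.Im l.
  apply: (@derive1_at0 _ (complex.Im (f z))); first exact: (f_equal _ g0).
  by move=> e /key[d d0 hd]; exists d => // t /hd/norm_Im_le; rewrite Im_lin.
by case: (l).
Qed.

Lemma dbarE f z al be j : wdiff f z al be -> dbar j f z = be j 0.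
Proof.
move=> hf; rewrite /dbar !(real_derivE _ hf) conjvZ !dotZr conjCi.
have -> : conjv (delta_mx j 0 : 'cV[C]_n) = delta_mx j 0.
  by apply/matrixP => i k; rewrite !mxE; case: (_ && _); rewrite ?rmorph1 ?rmorph0.
rewrite !dot_delta; set x := al j 0; set y := be j 0.
rewrite (_ : _ + _ = (1 + 'i ^+ 2) * x + (1 - 'i ^+ 2) * y); last by ring.
by rewrite sqrCi; field.
Qed.

Lemma dbar_near f g z j : (\forall w \near z, f w = g w) -> 
  (exists al be, wdiff f z al be) -> dbar j f z = dbar j g z.
Proof.
by move=> fg [al [be hf]]; rewrite (dbarE j hf) (dbarE j (wdiff_near fg hf)).
Qed.

End RealDerivatives.

(** * Derivatives of analytic functions *)

Section AnalyticFunctions.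
Context {R : realType} {n : nat}.
Local Notation C := (CC R).
Implicit Types (f : 'cV[C]_n -> C) (z v w : 'cV[C]_n).

Lemma near0_near0D (P : 'cV[C]_n -> Prop) : (\forall w \near (0 : 'cV[C]_n), P w) ->
  \forall w \near (0 : 'cV[C]_n), \forall h \near (0 : 'cV[C]_n), P (w + h).
Proof.
move=> /nbhs_norm0P[d /= d0 hd]; have d2 : 0 < d / 2 by rewrite divr_gt0.
apply/nbhs_norm0P; exists (d / 2) => // w /= wd.
apply/nbhs_norm0P; exists (d / 2) => // h /= hd2; apply: hd => /=.
by apply: le_lt_trans (ler_normD _ _) _; rewrite [d]splitr ltrD.
Qed.

Lemma littleo0_sqr (r : 'cV[C]_n -> C) (B : C) :
  (\forall h \near (0 : 'cV[C]_n), `|r h| <= B * `|h| ^+ 2) -> littleo0 r.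
Proof.
move=> rB e e0; pose A := `|B| + 1.
have A0 : 0 < A by rewrite ltr_wpDl.
have eA : 0 < e / A by rewrite divr_gt0.
near=> h.
have h1 : `|r h| <= B * `|h| ^+ 2 by near: h.
have h2 : `|h| <= e / A by near: h; exact: near0_norm_le.
have [->|h0] := eqVneq (r h) 0; first by rewrite normr0 mulr_ge0 // ltW.
have hp : 0 < B * `|h| ^+ 2 by apply: lt_le_trans h1; rewrite normr_gt0.
have B0 : 0 < B.
  have hn : 0 < `|h|.
    rewrite normr_gt0; apply: contraTneq hp => ->.
    by rewrite normr0 expr0n mulr0 ltxx.
  by rewrite -(@pmulr_lgt0 _ (`|h| ^+ 2)) // exprn_gt0.
apply: le_trans h1 _; rewrite expr2 mulrA ler_wpM2r //.
apply: le_trans (ler_wpM2l (ltW B0) h2) _.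
rewrite mulrA ler_pdivrMr // mulrC ler_pM2l // /A.
by rewrite gtr0_norm // lerDl.
Unshelve. all: by end_near. Qed.

(** The function f is near z the sum of a convergent power series,
    precomposed with an additive contraction phi: the identity for
    holomorphic functions, the real coordinates of C^n = R^(2n) for
    real-analytic ones. *)
Definition psum_at N (phi : 'cV[C]_n -> 'cV[C]_N) f z (c : 'X_{1..N} -> C) :=
  exists r M : C, [/\ 0 < r, bounded_terms c r M
    & \forall w \near (0 : 'cV[C]_n), f (z + w) = psum c (phi w)].

Section Composition.
Context {N : nat} (phi : 'cV[C]_n -> 'cV[C]_N).
Hypothesis phiD : forall v w, phi (v + w) = phi v + phi w.
Hypothesis phi_le : forall w, `|phi w| <= `|w|.

Lemma psum_at_littleo f z c : psum_at phi f z c ->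
  \forall w \near (0 : 'cV[C]_n), littleo0 (fun h => f (z + w + h) - f (z + w) -
     \sum_j phi h j 0 * psum (dcoef j c) (phi w)).
Proof.
move=> [r [M [r0 cM fc]]].
have [B hB] := psum_derivative r0 cM.
have r8 : 0 < r / 8 by rewrite divr_gt0.
have fcD := near0_near0D fc.
near=> w.
have wr : `|phi w| <= r / 8.
  by apply: le_trans (phi_le _) _; near: w; exact: near0_norm_le.
have fw : f (z + w) = psum c (phi w) by near: w.
have fwh : \forall h \near (0 : 'cV[C]_n), f (z + (w + h)) = psum c (phi (w + h)) by near: w.
apply: (@littleo0_sqr _ `|B|); near=> h.
have hr : `|phi h| <= r / 8.
  by apply: le_trans (phi_le _) _; near: h; exact: near0_norm_le.
rewrite -(addrA z w h) (near fwh h) // fw phiD.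
have hBh := hB _ _ wr hr; apply: le_trans hBh _.
have [->|h0] := eqVneq (phi h) 0.
  by rewrite normr0 expr0n mulr0 mulr_ge0 // exprn_ge0.
have B0 : 0 <= B.
  have := hB _ _ wr hr; move/(le_trans (normr_ge0 _)).
  by rewrite pmulr_lge0 // exprn_gt0 // normr_gt0.
by rewrite ger0_norm // ler_wpM2l // lerXn2r ?nnegrE.
Unshelve. all: by end_near. Qed.

End Composition.

(** The expansion at z also gives the derivatives of f at the points near z,
    which are thus sums of power series at z themselves. *)
Lemma psum_at_wdiff f z c : psum_at id f z c ->
  \forall w \near (0 : 'cV[C]_n), wdiff f (z + w) (\col_j psum (dcoef j c) w) 0.
Proof.
move=> h; have := psum_at_littleo (fun v w => erefl) (fun w => lexx _) h.
apply: filterS => w; congr littleo0; apply/funext => v.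
rewrite dot0v addr0; congr (_ - _).
by apply: eq_bigr => j _; rewrite mxE mulrC.
Qed.

Lemma psum_at_partial f z c j : psum_at id f z c ->
  psum_at id (real_deriv (delta_mx j 0) f) z (dcoef j c).
Proof.
move=> h; have hw := psum_at_wdiff h; have [r [M [r0 cM fc]]] := h.
exists (r / 2), (M / r); split; [by rewrite divr_gt0 | exact: bounded_dcoef | ].
by apply: filterS hw => w /real_derivE ->; rewrite dot0v addr0 dot_delta mxE.
Qed.

Lemma near0_const N (P : 'cV[C]_N -> Prop) : (\forall w \near (0 : 'cV[C]_N), P w) ->
  exists2 d : C, 0 < d & forall x : C, `|x| <= d -> P (const_mx x).
Proof.
move=> /nbhs_norm0P[d /= d0 hd]; exists (d / 2) => [|x xd]; first by rewrite divr_gt0.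
apply: hd => /=; apply: (@le_lt_trans _ _ (d / 2)).
  by apply: norm_cV_le => [|i]; rewrite ?mxE // divr_ge0 // ltW.
by rewrite ltr_pdivrMr // mulr_natr mulr2n ltrDl.
Qed.

Lemma holomorphic_psum_at f z : holomorphic_at f z -> exists c, psum_at id f z c.
Proof.
move=> [c hc]; exists c; have [r r0 hr] := near0_const hc.
have [M cM] : exists M, bounded_terms c r M.
  by apply: power_series_sum_bounded (ltW r0) (hr r _); rewrite gtr0_norm.
by exists r, M; split=> //; apply: filterS hc => w /power_series_sum_psum.
Qed.

Definition re_im (w : 'cV[C]_n) : 'cV[C]_(n + n) :=
  col_mx (map_mx (fun x => 'Re x) w) (map_mx (fun x => 'Im x) w).

Lemma re_imD v w : re_im (v + w) = re_im v + re_im w.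
Proof.
rewrite /re_im add_col_mx; congr col_mx; apply/matrixP => i j; rewrite !mxE;
by rewrite raddfD.
Qed.

Lemma re_im_lshift w j : re_im w (lshift n j) 0 = 'Re (w j 0).
Proof. by rewrite /re_im col_mxEu mxE. Qed.

Lemma re_im_rshift w j : re_im w (rshift n j) 0 = 'Im (w j 0).
Proof. by rewrite /re_im col_mxEd mxE. Qed.

Lemma norm_imag_le (x : C) : `|'Im x| <= `|x|.
Proof.
rewrite ImE !normrM normCi mul1r normfV normr_nat ler_pdivrMr // mulr_natr mulr2n.
by apply: le_trans (ler_normB _ _) _; rewrite norm_conjC.
Qed.

Lemma re_im_le w : `|re_im w| <= `|w|.
Proof.
apply: norm_cV_le => // i; case: (splitP i) => j ij.
  rewrite (_ : i = lshift n j) ?re_im_lshift; last exact: val_inj.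
  by apply: le_trans (norm_coord_le w j); exact: (leif_normC_Re_Creal _).1.
rewrite (_ : i = rshift n j) ?re_im_rshift; last exact: val_inj.
by apply: le_trans (norm_coord_le w j); exact: norm_imag_le.
Qed.

Lemma real_analytic_psum_at f z : real_analytic_at f z -> exists c, psum_at re_im f z c.
Proof.
move=> [c hc]; exists c; have [d d0 hd] := near0_const hc.
(* the point with all real and imaginary parts equal to r *)
pose r := d / 2; have r0 : 0 < r by rewrite divr_gt0.
have rr : r \is Num.real by exact: gtr0_real.
have := hd (r + 'i * r) _.
have -> : col_mx (map_mx (fun x => 'Re x) (const_mx (r + 'i * r) : 'cV[C]_n))
     (map_mx (fun x => 'Im x) (const_mx (r + 'i * r) : 'cV[C]_n)) = const_mx r.
  apply/matrixP => i j; rewrite mxE ord1; case: (splitP i) => k ik.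
    rewrite (_ : i = lshift n k) ?col_mxEu ?mxE; last exact: val_inj.
    by rewrite Re_rect.
  rewrite (_ : i = rshift n k) ?col_mxEd ?mxE; last exact: val_inj.
  by rewrite Im_rect.
move=> /(_ _)/(power_series_sum_bounded (ltW r0)) [].
  apply: le_trans (ler_normD _ _) _.
  by rewrite (normrM 'i r) normCi mul1r gtr0_norm // /r -splitr.
move=> M cM; exists r, M; split=> //.
by apply: filterS hc => w /power_series_sum_psum.
Qed.

Lemma psum_lin N (c1 c2 : 'X_{1..N} -> C) (k1 k2 r M1 M2 : C) (x : 'cV[C]_N) : 0 <= r ->
  bounded_terms c1 r M1 -> bounded_terms c2 r M2 -> (forall i, `|x i 0| <= r / 2) ->
  psum (fun a => k1 * c1 a + k2 * c2 a) x = k1 * psum c1 x + k2 * psum c2 x.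
Proof.
move=> r0 b1 b2 xr; apply: psum_unique.
have FF : Filter (\oo : set_system nat) by exact: eventually_filter.
have h1 := cvgM (cvg_cst k1) (psum_cvg r0 b1 xr).
have h2 := cvgM (cvg_cst k2) (psum_cvg r0 b2 xr).
have h := @cvgD _ _ _ _ FF _ _ _ _ (h1 FF FF) (h2 FF FF).
set u := (X in X @ _ --> _).
set v := (X in X @ _ --> _) in h.
have -> : u = v; last exact: h.
apply/funext => k; rewrite /u /v /series.
transitivity (k1 * \sum_(0 <= i < k) (hpart c1 i).@[x^~ 0] +
  k2 * \sum_(0 <= i < k) (hpart c2 i).@[x^~ 0]) => //.
rewrite !mulr_sumr -big_split /=; apply: eq_bigr => i _.
rewrite !hpart_eval !mulr_sumr -big_split /=; apply: eq_bigr => a _.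
by rewrite mulrDl !mulrA.
Qed.

Lemma bounded_terms_lin N (c1 c2 : 'X_{1..N} -> C) (k1 k2 r M1 M2 : C) : 0 <= r ->
  bounded_terms c1 r M1 -> bounded_terms c2 r M2 ->
  bounded_terms (fun a => k1 * c1 a + k2 * c2 a) r (`|k1| * M1 + `|k2| * M2).
Proof.
move=> r0 b1 b2 k; have rk : 0 <= r ^+ k by rewrite exprn_ge0.
apply: (@le_trans _ _ ((`|k1| * coef_norm c1 k + `|k2| * coef_norm c2 k) * r ^+ k)).
  rewrite ler_wpM2r // /coef_norm !mulr_sumr -big_split /=; apply: ler_sum => a _.
  by apply: le_trans (ler_normD _ _) _; rewrite !normrM.
by rewrite mulrDl -!mulrA lerD // ler_wpM2l.
Qed.

(** In the real coordinates x + i y, the operators d/dz and d/d(conj z) are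
    (d/dx - i d/dy) / 2 and (d/dx + i d/dy) / 2. *)
Lemma real_analytic_wdiff f z c : psum_at re_im f z c ->
  \forall w \near (0 : 'cV[C]_n),
    wdiff f (z + w)
     (\col_j ((psum (dcoef (lshift n j) c) (re_im w) -
        'i * psum (dcoef (rshift n j) c) (re_im w)) / 2))
     (\col_j ((psum (dcoef (lshift n j) c) (re_im w) +
        'i * psum (dcoef (rshift n j) c) (re_im w)) / 2)).
Proof.
move=> h; have := psum_at_littleo re_imD re_im_le h.
apply: filterS => w; congr littleo0; apply/funext => v; congr (_ - _).
rewrite big_split_ord /= /dot -!big_split /=; apply: eq_bigr => j _.
rewrite re_im_lshift re_im_rshift !mxE ReE ImE.
set x := psum _ _; set y := psum _ _; set a := v j 0; set b := a^*.
have -> : 'i * (b - a) / 2 * y = - ('i * (a - b) / 2 * y) by ring.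
by field.
Qed.

Lemma psum_at_dbar f z c j : psum_at re_im f z c ->
  exists c', psum_at re_im (dbar j f) z c'.
Proof.
move=> h; have hw := real_analytic_wdiff h; have [r [M [r0 cM fc]]] := h.
exists (fun a => 2^-1 * dcoef (lshift n j) c a + ('i / 2) * dcoef (rshift n j) c a).
have b1 := bounded_dcoef (lshift n j) r0 cM.
have b2 := bounded_dcoef (rshift n j) r0 cM.
have r2 : 0 < r / 2 by rewrite divr_gt0.
have r4 : 0 < r / 2 / 2 by rewrite divr_gt0.
exists (r / 2), (`|2^-1| * (M / r) + `|'i / 2| * (M / r)).
split; [exact: r2 | exact: bounded_terms_lin (ltW r2) b1 b2 | ].
near=> w.
have ww : wdiff f (z + w)
     (\col_j ((psum (dcoef (lshift n j) c) (re_im w) -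
        'i * psum (dcoef (rshift n j) c) (re_im w)) / 2))
     (\col_j ((psum (dcoef (lshift n j) c) (re_im w) +
        'i * psum (dcoef (rshift n j) c) (re_im w)) / 2)).
  by near: w.
have xr i : `|re_im w i 0| <= r / 2 / 2.
  apply: le_trans (norm_coord_le _ _) _; apply: le_trans (re_im_le _) _.
  by near: w; exact: near0_norm_le.
have e := psum_lin 2^-1 ('i / 2) (ltW r2) b1 b2 xr.
apply: etrans (dbarE j ww) _; apply: etrans (esym e); rewrite mxE.
move: (psum _ _) (psum _ _) => x y; ring.
Unshelve. all: by end_near. Qed.

End AnalyticFunctions.

(** * Functions with iterated derivatives in the conjugate variables *)

Section PolynomialInduction.

Lemma mpoly_ring_ind (F : comNzRingType) n (P : {mpoly F[n]} -> Prop) :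
  (forall c, P c%:MP) -> (forall i, P 'X_i) ->
  (forall p q, P p -> P q -> P (p + q)) -> (forall p q, P p -> P q -> P (p * q)) ->
  forall p, P p.
Proof.
move=> PC PX PD PM; elim/mpolyind => [|c m p _ _ Pp]; first by rewrite -mpolyC0; exact: PC.
apply: (PD) => //; rewrite -mul_mpolyC; apply: (PM); first exact: (PC).
rewrite mpolyXE_id; elim/big_ind: _ => [||i _]; [exact: (PC 1) | exact: PM |].
by elim: (m i) => [|k IH]; rewrite ?expr0 ?exprS; [exact: (PC 1) | apply: PM].
Qed.

End PolynomialInduction.

Section SmoothFunctions.
Context {R : realType} {n : nat}.
Local Notation C := (CC R).
Implicit Types (f g : 'cV[C]_n -> C) (z v w : 'cV[C]_n) (U : set 'cV[C]_n).

Definition wdiffable f z := exists al be, wdiff f z al be.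

(** Iterated derivatives are only taken with respect to the conjugate
    coordinates, which are the ones that fields of type (0,1) contain. *)
Fixpoint smooth U k f : Prop :=
  if k is k'.+1 then (forall z, U z -> wdiffable f z) /\ forall j, smooth U k' (dbar j f)
  else True.

Definition holo U f := forall z, U z -> exists al, wdiff f z al 0.

Lemma open_near U z : open U -> U z -> \forall w \near z, U w.
Proof. by move=> oU Uz; exact: open_nbhs_nbhs. Qed.

Lemma wdiffable_near f g z : (\forall w \near z, f w = g w) -> wdiffable f z -> wdiffable g z.
Proof. by move=> fg [a [b h]]; exists a, b; exact: wdiff_near h. Qed.

Lemma wdiffableD f g z : wdiffable f z -> wdiffable g z -> wdiffable (fun w => f w + g w) z.
Proof. by move=> [a [b h]] [c [d h']]; do 2 eexists; exact: wdiffD h h'. Qed.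

Lemma wdiffableM f g z : wdiffable f z -> wdiffable g z -> wdiffable (fun w => f w * g w) z.
Proof. by move=> [a [b h]] [c [d h']]; do 2 eexists; exact: wdiffM h h'. Qed.

Lemma wdiffableV f z : f z != 0 -> wdiffable f z -> wdiffable (fun w => (f w)^-1) z.
Proof. by move=> f0 [a [b h]]; do 2 eexists; exact: wdiffV h. Qed.

Lemma dbarD f g z j : wdiffable f z -> wdiffable g z ->
  dbar j (fun w => f w + g w) z = dbar j f z + dbar j g z.
Proof.
by move=> [a [b h]] [c [d h']]; rewrite (dbarE j (wdiffD h h')) (dbarE j h) (dbarE j h') mxE.
Qed.

Lemma dbarM f g z j : wdiffable f z -> wdiffable g z ->
  dbar j (fun w => f w * g w) z = dbar j f z * g z + f z * dbar j g z.
Proof.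
move=> [a [b h]] [c [d h']].
by rewrite (dbarE j (wdiffM h h')) (dbarE j h) (dbarE j h') !mxE addrC mulrC.
Qed.

Lemma dbarV f z j : f z != 0 -> wdiffable f z ->
  dbar j (fun w => (f w)^-1) z = - dbar j f z * ((f z)^-1 * (f z)^-1).
Proof.
move=> f0 [a [b h]]; rewrite (dbarE j (wdiffV f0 h)) (dbarE j h) !mxE.
by rewrite mulNr mulrC mulNr expr2.
Qed.

Lemma dbar_holo U f z j : holo U f -> U z -> dbar j f z = 0.
Proof. by move=> hf /hf[al h]; rewrite (dbarE j h) mxE. Qed.

Lemma smooth_eq U k f g : open U -> (forall z, U z -> f z = g z) ->
  smooth U k f -> smooth U k g.
Proof.
move=> oU; elim: k f g => [//|k IH] f g fg [hf hd].
have fgn z : U z -> \forall w \near z, f w = g w.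
  by move=> Uz; apply: filterS (open_near oU Uz) => w; exact: fg.
split=> [z Uz|j]; first exact: wdiffable_near (fgn z Uz) (hf z Uz).
by apply: IH (hd j) => z Uz; exact: dbar_near (fgn z Uz) (hf z Uz).
Qed.

Lemma smoothW U k f : smooth U k.+1 f -> smooth U k f.
Proof.
by elim: k f => [//|k IH] f [hf hd]; split=> // j; apply: IH; exact: hd.
Qed.

(** All the derivatives with respect to the conjugate coordinates are zero. *)
Lemma smooth_holo U k f : open U -> holo U f -> smooth U k f.
Proof.
move=> oU; elim: k f => [//|k IH] f hf.
split=> [z /hf[al h]|j]; first by exists al, 0.
have h0 : smooth U k (fun=> 0 : C).
  by apply: IH => z _; exists 0; exact: wdiff_cst.
by apply: smooth_eq oU _ h0 => z Uz; rewrite (dbar_holo j hf).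
Qed.

Lemma holo_cst U (c : C) : holo U (fun=> c).
Proof. by move=> z _; exists 0; exact: wdiff_cst. Qed.

Lemma holo_coord U j : holo U (fun z => z j 0).
Proof. by move=> z _; exists (delta_mx j 0); exact: wdiff_coord. Qed.

Lemma holoD U f g : holo U f -> holo U g -> holo U (fun z => f z + g z).
Proof.
move=> hf hg z Uz; have [a ha] := hf z Uz; have [b hb] := hg z Uz.
by exists (a + b); have := wdiffD ha hb; rewrite addr0.
Qed.

Lemma holoM U f g : holo U f -> holo U g -> holo U (fun z => f z * g z).
Proof.
move=> hf hg z Uz; have [a ha] := hf z Uz; have [b hb] := hg z Uz.
by eexists; have := wdiffM ha hb; rewrite !scaler0 addr0; exact.
Qed.

Lemma holo_sum U (I : Type) (s : seq I) (F : I -> 'cV[C]_n -> C) :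
  (forall i, holo U (F i)) -> holo U (fun z => \sum_(i <- s) F i z).
Proof.
move=> h; elim: s => [|i s IH].
  by rewrite (_ : (fun=> _) = fun=> 0); [exact: holo_cst|apply/funext => z; rewrite big_nil].
rewrite (_ : (fun z => _) = fun z => F i z + \sum_(i <- s) F i z); first exact: holoD.
by apply/funext => z; rewrite big_cons.
Qed.

Lemma mderivXU (i j : 'I_n) : mderiv j ('X_i : {mpoly C[n]}) = (i == j)%:R%:MP.
Proof.
rewrite mderivX mnm1E -mul_mpolyC; case: eqP => [->|_]; last by rewrite mpolyC0 mul0r.
rewrite (_ : (U_(j) - U_(j))%MM = 0%MM) ?mpolyX0 ?mulr1 //.
by apply/mnmP => l; rewrite mnmBE mnm0E subnn.
Qed.

Lemma wdiff_poly q z : exists2 al, wdiff (fun w => q.@[w^~ 0]) z al 0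
  & forall j, al j 0 = (mderiv j q).@[z^~ 0].
Proof.
elim/mpoly_ring_ind: q => [c|i|p q [a hp ap] [b hq bq]|p q [a hp ap] [b hq bq]].
- exists 0 => [|j]; last by rewrite mderivC meval0 mxE.
  have -> : (fun w : 'cV[C]_n => (c%:MP).@[w^~ 0]) = fun=> c by apply/funext => w; exact: mevalC.
  exact: wdiff_cst.
- exists (delta_mx i 0) => [|j]; last by rewrite mderivXU mevalC mxE andbT eq_sym.
  have -> : (fun w : 'cV[C]_n => ('X_i).@[w^~ 0]) = fun w => w i 0.
    by apply/funext => w; exact: mevalXU.
  exact: wdiff_coord.
- exists (a + b) => [|j]; last by rewrite cV_addE mderivD mevalD ap bq.
  have -> : (fun w : 'cV[C]_n => (p + q).@[w^~ 0]) = fun w => p.@[w^~ 0] + q.@[w^~ 0].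
    by apply/funext => w; exact: mevalD.
  by have := wdiffD hp hq; rewrite addr0.
- exists (p.@[z^~ 0] *: b + q.@[z^~ 0] *: a) => [|j]; last first.
    rewrite cV_addE !cV_scaleE mderivM mevalD !mevalM ap bq addrC.
    by rewrite [q.@[_] * _]mulrC.
  have -> : (fun w : 'cV[C]_n => (p * q).@[w^~ 0]) = fun w => p.@[w^~ 0] * q.@[w^~ 0].
    by apply/funext => w; exact: mevalM.
  by have := wdiffM hp hq; rewrite !scaler0 addr0.
Qed.

Lemma holo_poly U (q : {mpoly C[n]}) : holo U (fun z => q.@[z^~ 0]).
Proof. by move=> z _; have [al h _] := wdiff_poly q z; exists al. Qed.

Definition conj_eval (q : {mpoly C[n]}) z : C := q.@[(conjv z)^~ 0].

Lemma conj_evalD p q z : conj_eval (p + q) z = conj_eval p z + conj_eval q z.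
Proof. exact: mevalD. Qed.

Lemma conj_evalM p q z : conj_eval (p * q) z = conj_eval p z * conj_eval q z.
Proof. exact: mevalM. Qed.

Lemma conj_evalC c z : conj_eval c%:MP z = c.
Proof. exact: mevalC. Qed.

Lemma conj_evalXU i z : conj_eval 'X_i z = (z i 0)^*.
Proof. by rewrite /conj_eval mevalXU mxE. Qed.

Lemma wdiff_conj_eval (q : {mpoly C[n]}) z :
  exists2 be, wdiff (conj_eval q) z 0 be & forall j, be j 0 = conj_eval (mderiv j q) z.
Proof.
elim/mpoly_ring_ind: q => [c|i|p q [a hp ap] [b hq bq]|p q [a hp ap] [b hq bq]].
- exists 0 => [|j]; last by rewrite mderivC -mpolyC0 conj_evalC mxE.
  have -> : conj_eval c%:MP = fun=> c by apply/funext => w; exact: conj_evalC.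
  exact: wdiff_cst.
- exists (delta_mx i 0) => [|j]; last by rewrite mderivXU conj_evalC mxE andbT eq_sym.
  have -> : conj_eval 'X_i = fun w => (w i 0)^* by apply/funext => w; exact: conj_evalXU.
  exact: wdiff_conj_coord.
- exists (a + b) => [|j]; last by rewrite cV_addE mderivD conj_evalD ap bq.
  have -> : conj_eval (p + q) = fun w => conj_eval p w + conj_eval q w.
    by apply/funext => w; exact: conj_evalD.
  by have := wdiffD hp hq; rewrite addr0.
- exists (conj_eval p z *: b + conj_eval q z *: a) => [|j]; last first.
    rewrite cV_addE !cV_scaleE mderivM conj_evalD !conj_evalM ap bq addrC.
    by rewrite [conj_eval q z * _]mulrC.
  have -> : conj_eval (p * q) = fun w => conj_eval p w * conj_eval q w.
    by apply/funext => w; exact: conj_evalM.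
  by have := wdiffM hp hq; rewrite !scaler0 addr0.
Qed.

Lemma dbar_conj_eval (q : {mpoly C[n]}) j : dbar j (conj_eval q) = conj_eval (mderiv j q).
Proof. by apply/funext => z; have [be h <-] := wdiff_conj_eval q z; exact: dbarE h. Qed.

Lemma smooth_conj_eval U k (q : {mpoly C[n]}) : smooth U k (conj_eval q).
Proof.
elim: k q => [//|k IH] q; split=> [z _|j].
  by have [be h _] := wdiff_conj_eval q z; exists 0, be.
by rewrite dbar_conj_eval.
Qed.

Lemma smooth_cst U k (c : C) : open U -> smooth U k (fun=> c).
Proof. by move=> oU; apply: smooth_holo => //; exact: holo_cst. Qed.

Lemma smoothD U k f g : open U -> smooth U k f -> smooth U k g ->
  smooth U k (fun w => f w + g w).
Proof.
move=> oU; elim: k f g => [//|k IH] f g [hf df] [hg dg]; split=> [z Uz|j].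
  by apply: wdiffableD; [exact: hf|exact: hg].
apply: smooth_eq oU _ (IH _ _ (df j) (dg j)) => z Uz.
by rewrite dbarD //; [exact: hf|exact: hg].
Qed.

Lemma smoothM U k f g : open U -> smooth U k f -> smooth U k g ->
  smooth U k (fun w => f w * g w).
Proof.
move=> oU; elim: k f g => [//|k IH] f g sf sg; have [hf df] := sf; have [hg dg] := sg.
split=> [z Uz|j]; first by apply: wdiffableM; [exact: hf|exact: hg].
have := smoothD oU (IH _ _ (df j) (smoothW sg)) (IH _ _ (smoothW sf) (dg j)).
apply: smooth_eq oU _ => z Uz.
by rewrite dbarM //; [exact: hf|exact: hg].
Qed.

Lemma smoothV U k f : open U -> (forall z, U z -> f z != 0) -> smooth U k f ->
  smooth U k (fun w => (f w)^-1).
Proof.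
move=> oU f0; elim: k => [//|k IH] sf; have [hf df] := sf.
split=> [z Uz|j]; first by apply: wdiffableV; [exact: f0|exact: hf].
have sV := IH (smoothW sf).
have := smoothM oU (smoothM oU (smooth_cst k (-1) oU) (df j)) (smoothM oU sV sV).
apply: smooth_eq oU _ => z Uz.
by rewrite dbarV ?mulN1r //; [exact: f0|exact: hf].
Qed.

Lemma smooth_sum U k (I : Type) (s : seq I) (F : I -> 'cV[C]_n -> C) : open U ->
  (forall i, smooth U k (F i)) -> smooth U k (fun z => \sum_(i <- s) F i z).
Proof.
move=> oU h; elim: s => [|i s IH].
  by apply: smooth_eq oU _ (smooth_cst k 0 oU) => z _; rewrite big_nil.
by apply: smooth_eq oU _ (smoothD oU (h i) IH) => z _; rewrite big_cons.
Qed.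

(** By [psum_at_dbar] real-analytic functions are stable under d/d(conj
    z_j), so that products of power series are never needed. *)
Lemma smooth_real_analytic U k f : open U ->
  (forall z, U z -> real_analytic_at f z) -> smooth U k f.
Proof.
move=> oU hf.
have {hf} : forall z, U z -> exists c, psum_at re_im f z c.
  by move=> z /hf/real_analytic_psum_at.
elim: k f => [//|k IH] f hf; split=> [z /hf[c hc]|j].
  have /nbhs_singleton := real_analytic_wdiff hc.
  by rewrite addr0 => ?; do 2 eexists; eassumption.
by apply: IH => z /hf[c hc]; exact: psum_at_dbar hc.
Qed.

Lemma holo_holomorphic U f : (forall z, U z -> holomorphic_at f z) -> holo U f.
Proof.
move=> hf z /hf/holomorphic_psum_at[c hc].
by have /nbhs_singleton := psum_at_wdiff hc; rewrite addr0 => ?; eexists; eassumption.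
Qed.

End SmoothFunctions.

(** * Functions vanishing on the sphere *)

Section Tangent.
Context {R : realType} {n : nat}.
Local Notation C := (CC R).
Implicit Types (f g : 'cV[C]_n -> C) (z v w : 'cV[C]_n).

Lemma sqnormE z : sqnorm z = dot z (conjv z).
Proof. by apply: eq_bigr => i _; rewrite normCK mxE. Qed.

Lemma conj_dot v w : (dot v w)^* = dot (conjv v) (conjv w).
Proof. by rewrite /dot rmorph_sum; apply: eq_bigr => i _; rewrite rmorphM !mxE. Qed.

Lemma small_zero (x A : C) : 0 <= x -> 0 <= A ->
  (forall e, 0 < e -> e <= 1 -> x <= e * A) -> x = 0.
Proof.
move=> x0 A0 h; apply/eqP/contraT => xn0.
have xp : 0 < x by rewrite lt_neqAle eq_sym xn0.
have d0 : 0 < 2 * (A + x) by rewrite mulr_gt0 // ltr_wpDl.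
have := h (x / (2 * (A + x))).
rewrite divr_gt0 // ler_pdivrMr // mul1r => /(_ isT) h'.
have {h'} : x <= x / (2 * (A + x)) * A.
  apply: h'; rewrite mulr_natl mulr2n; apply: ler_wpDl; last exact: ler_wpDl.
  by rewrite addr_ge0 // ltW.
rewrite mulrAC ler_pdivlMr // ler_pM2l //.
have -> : 2 * (A + x) = A + (A + x + x) by ring.
rewrite gerDl => /(lt_le_trans (_ : 0 < A + x + x)); rewrite ltxx => -> //.
by rewrite ltr_wpDl // addr_ge0 // ltW.
Qed.

Lemma sqnorm_ge0 z : 0 <= sqnorm z.
Proof. by apply: sumr_ge0 => i _; rewrite exprn_ge0. Qed.

(** The curve t |-> ((1 - tau) z + t v) / (1 + tau), with tau = t^2 |v|^2 /
    4, is the stereographic parametrization of a circle of the sphere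
    through z in the direction v. The hypothesis on v says that v is tangent
    to the sphere at z. Being rational, this curve needs no square root. *)
Lemma sphere_curve z v (t : C) : sphere z -> dot v (conjv z) + (dot v (conjv z))^* = 0 ->
  0 <= t -> let tau := t ^+ 2 * sqnorm v / 4 in
  sphere (z + (1 + tau)^-1 *: (t *: v - (2 * tau) *: z)).
Proof.
move=> Sz tv t0 tau.
have tau0 : 0 <= tau by rewrite divr_ge0 // mulr_ge0 ?exprn_ge0 ?sqnorm_ge0.
have tau1 : 1 + tau != 0 by rewrite gt_eqF // ltr_wpDr.
have -> : z + (1 + tau)^-1 *: (t *: v - (2 * tau) *: z) =
    (1 + tau)^-1 *: ((1 - tau) *: z + t *: v).
  apply/matrixP => i j; rewrite !mxE; field; exact: tau1.
have Sz' : dot z (conjv z) = 1 by rewrite -sqnormE.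
have tc : t^* = t by rewrite conj_Creal ?ger0_real.
have c1 : (1 - tau)^* = 1 - tau by rewrite conj_Creal // realB ?real1 ?ger0_real.
have c2 : ((1 + tau)^-1)^* = (1 + tau)^-1.
  by rewrite conj_Creal // realV realD ?real1 ?ger0_real.
rewrite /sphere /= sqnormE !conjvZ !conjvD !conjvZ !(dotZl, dotZr, dotDl, dotDr).
rewrite c1 c2 tc Sz' -sqnormE.
have zv : dot z (conjv v) = - dot v (conjv z).
  by apply/eqP; rewrite -addr_eq0 addrC -{2}[z]conjvK dotC -conj_dot dotC tv.
rewrite zv.
move: (dot v _) => x; have e : t * (t * sqnorm v) = 4 * tau by rewrite /tau; field.
rewrite (_ : _ * _ = (1 + tau)^-1 ^+ 2 * ((1 - tau) ^+ 2 + t * (t * sqnorm v))); last by ring.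
by rewrite e; field; exact: tau1.
Qed.

(** The differential of f at z, applied to the tangent vector v, is the
    derivative of f along [sphere_curve], on which f vanishes. *)
Lemma tangent_derivative f z al be v : sphere z -> wdiff f z al be ->
  (\forall w \near z, sphere w -> f w = 0) ->
  dot v (conjv z) + (dot v (conjv z))^* = 0 -> dot al v + dot be (conjv v) = 0.
Proof.
move=> Sz hf f0 tv.
have fz : f z = 0 by exact: (nbhs_singleton f0).
pose l w := dot al w + dot be (conjv w).
pose S := sqnorm v; have S0 : 0 <= S := sqnorm_ge0 v.
apply/eqP; rewrite -normr_eq0; apply/eqP.
apply: (@small_zero _ (S / 2 * `|l z| + (`|v| + S / 2 * `|z|))) => //.
  by rewrite !(addr_ge0, mulr_ge0).
move=> e e0 e1.
have /nbhs_norm0P[d /= d0 hd] : \forall w \near (0 : 'cV[C]_n),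
    `|f (z + w) - f z - l w| <= e * `|w| /\ (sphere (z + w) -> f (z + w) = 0).
  apply: filterI; first exact: hf.
  by apply/(@nbhs0P _ _ (fun w => sphere w -> f w = 0)).
(* The curve at the parameter t is at distance at most t D from z. The parameter
   below is at most e and at most d / D. *)
pose D := `|v| + S * `|z| + 1.
have D0 : 0 < D by rewrite ltr_wpDl // addr_ge0 // mulr_ge0.
pose rho := d / D; have rho0 : 0 < rho by rewrite divr_gt0.
have rho1 : 0 < 1 + rho by rewrite ltr_wpDl.
pose t := e * (rho / (1 + rho)).
have t0 : 0 < t by rewrite mulr_gt0 // divr_gt0.
have te : t <= e by rewrite /t ler_piMr ?(ltW e0) // ler_pdivrMr // mul1r lerDr.
have t1 : t <= 1 := le_trans te e1.
have trho : t <= rho.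
  apply: (@le_trans _ _ (rho / (1 + rho))); first by rewrite /t ler_piMl // divr_ge0 // ltW.
  by rewrite ler_pdivrMr // ler_peMr ?(ltW rho0) // lerDl ltW.
pose tau := t ^+ 2 * sqnorm v / 4; pose w := (1 + tau)^-1 *: (t *: v - (2 * tau) *: z).
have Sw : sphere (z + w) := sphere_curve Sz tv (ltW t0).
have tau0 : 0 <= tau by rewrite divr_ge0 // mulr_ge0 // exprn_ge0 // ltW.
have tau1 : 0 < 1 + tau by rewrite ltr_wpDr.
have tau2 : 2 * tau = t * (t * (S / 2)) by rewrite /tau -/S; field.
have tauE : 2 * tau <= t * (S / 2).
  by rewrite tau2 ler_wpM2l ?(ltW t0) // ler_piMl // divr_ge0.
have nw : (1 + tau) * `|w| <= t * (`|v| + S / 2 * `|z|).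
  rewrite /w (normrZ (1 + tau)^-1) normfV (gtr0_norm tau1) mulrA divff ?gt_eqF // mul1r.
  apply: le_trans (ler_normB _ _) _; rewrite (normrZ t v) (normrZ (2 * tau) z).
  rewrite (gtr0_norm t0) mulrDr lerD2l (mulrA t (S / 2)).
  by rewrite ler_wpM2r // ger0_norm // mulr_ge0.
have nw' : `|w| <= (1 + tau) * `|w| by rewrite ler_peMl // lerDl.
have wd : `|w| < d.
  apply: le_lt_trans nw' _; apply: le_lt_trans nw _.
  apply: (@le_lt_trans _ _ (rho * (`|v| + S * `|z|))).
    apply: ler_pM => //; rewrite ?(ltW t0) ?addr_ge0 ?mulr_ge0 // lerD2l ler_wpM2r //.
    by rewrite ler_piMr // invf_le1 // ler1n.
  by rewrite /rho mulrAC -mulrA gtr_pMr // ltr_pdivrMr // mul1r /D ltrDl.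
have [hw fw] := hd w wd.
move: hw; rewrite fw // fz subrr sub0r normrN => hw.
(* l is linear over the real numbers only, and t and tau are real *)
have lw : l w = (1 + tau)^-1 * (t * l v - 2 * tau * l z).
  have c1 : t^* = t by rewrite conj_Creal ?gtr0_real.
  have c2 : ((1 + tau)^-1)^* = (1 + tau)^-1 by rewrite conj_Creal // gtr0_real ?invr_gt0.
  have c3 : (- (2 * tau))^* = - (2 * tau) by rewrite conj_Creal // realN ger0_real // mulr_ge0.
  rewrite /l /w -scaleNr conjvZ c2 conjvD !conjvZ c1 c3 !dotZr !dotDr !dotZr.
  ring.
have : `|t * l v - 2 * tau * l z| <= e * (t * (`|v| + S / 2 * `|z|)).
  have -> : t * l v - 2 * tau * l z = (1 + tau) * l w.
    by rewrite lw mulVKf // gt_eqF.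
  rewrite normrM (gtr0_norm tau1).
  apply: le_trans (ler_wpM2l (ltW tau1) hw) _.
  by rewrite mulrCA ler_wpM2l ?(ltW e0).
move=> h; have : t * `|l v| <= t * (e * (S / 2 * `|l z| + (`|v| + S / 2 * `|z|))).
  have -> : t * `|l v| = `|(2 * tau * l z) + (t * l v - 2 * tau * l z)|.
    by rewrite addrC subrK (normrM t) gtr0_norm.
  apply: le_trans (ler_normD _ _) _; rewrite (mulrDr e) (mulrDr t); apply: lerD.
    have t20 : 0 <= 2 * tau by rewrite mulr_ge0.
    have t2 : 2 * tau <= t * (e * (S / 2)).
      by rewrite tau2 ler_wpM2l ?(ltW t0) // ler_wpM2r // divr_ge0.
    rewrite (normrM (2 * tau)) (ger0_norm t20).
    have -> : t * (e * (S / 2 * `|l z|)) = t * (e * (S / 2)) * `|l z| by ring.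
    by rewrite ler_wpM2r.
  by apply: le_trans h _; rewrite mulrCA.
by rewrite ler_pM2l.
Qed.

(** Both v = conj a and i v are tangent to the sphere, because a . z = 0.
    The differential of f is al . v + be . a at v and i (al . v - be . a) at
    i v, so that both terms vanish. *)
Lemma tangent_dbar f z al be a : sphere z -> wdiff f z al be ->
  (\forall w \near z, sphere w -> f w = 0) -> dot a z = 0 -> dot a be = 0.
Proof.
move=> Sz hf f0 az.
have va : dot (conjv a) (conjv z) = 0 by rewrite -conj_dot az conjC0.
have e1 := tangent_derivative (v := conjv a) Sz hf f0.
have e2 := tangent_derivative (v := 'i *: conjv a) Sz hf f0.
move: e1 e2; rewrite dotZl va mulr0 conjC0 addr0 => /(_ erefl) e1 /(_ erefl).
rewrite conjvZ !dotZr conjvK conjCi in e1 *; move: e1; rewrite (dotC be).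
set x := dot al _; set y := dot a be => e1 e2.
have : 2 * 'i * y = 'i * (x + y) - ('i * x + - 'i * y) by ring.
by rewrite e1 e2 mulr0 subr0 => /eqP; rewrite !mulf_eq0 pnatr_eq0 (negPf (neq0Ci _)) /= => /eqP.
Qed.

(** The tangent space of the sphere at z spans C^n over C: it contains the
    vectors Hermitian-orthogonal to z, and i z. The differential of f is
    C-linear and vanishes on it. *)
Lemma holo_vanish_derivative f z al : sphere z -> wdiff f z al 0 ->
  (\forall w \near z, sphere w -> f w = 0) -> al = 0.
Proof.
move=> Sz hf f0.
have Sz' : dot z (conjv z) = 1 by rewrite -sqnormE.
have h v : dot v (conjv z) + (dot v (conjv z))^* = 0 -> dot al v = 0.
  by move=> tv; have := tangent_derivative Sz hf f0 tv; rewrite dot0v addr0.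
have hz : dot al z = 0.
  have := h ('i *: z); rewrite !dotZr dotZl Sz' mulr1 conjCi subrr => /(_ erefl)/eqP.
  by rewrite mulf_eq0 (negPf (neq0Ci _)) /= => /eqP.
apply/matrixP => j k; rewrite ord1 mxE -dot_delta.
set v := delta_mx j 0.
have := h (v - dot v (conjv z) *: z).
rewrite dotDl dotDr -scaleNr dotZl dotZr Sz' hz mulr1 mulr0 addr0 subrr conjC0 addr0.
exact.
Qed.

End Tangent.

(** * Directional derivatives of polynomials *)

Section DirectionalDerivatives.
Context {R : realType} {n : nat}.
Local Notation C := (CC R).
Implicit Types (q : {mpoly C[n]}) (z v w : 'cV[C]_n) (vs : seq 'cV[C]_n).

Definition dpoly v q : {mpoly C[n]} := \sum_j v j 0 *: mderiv j q.

Definition dpolys vs q := foldr dpoly q vs.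

Lemma dpoly_is_linear v : linear (dpoly v).
Proof.
move=> k p q; rewrite /dpoly scaler_sumr -big_split /=; apply: eq_bigr => j _.
by rewrite mderivD mderivZ scalerDr !scalerA mulrC.
Qed.

Lemma mderiv_dpoly v q j : mderiv j (dpoly v q) = dpoly v (mderiv j q).
Proof.
rewrite /dpoly (raddf_sum (mderiv j)); apply: eq_bigr => i _.
by rewrite /= mderivZ mderiv_comm.
Qed.

Lemma dpolyE v q : dpoly v q = \sum_j v j 0 *: mderiv j q.
Proof. by []. Qed.

Lemma dpoly_scale_sum v (I : Type) (s : seq I) (c : I -> C) (F : I -> {mpoly C[n]}) :
  dpoly v (\sum_(i <- s) c i *: F i) = \sum_(i <- s) c i *: dpoly v (F i).
Proof.
elim: s => [|i s IH].
  rewrite !big_nil /dpoly big1 // => j _; by rewrite mderiv0 scaler0.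
by rewrite !big_cons dpoly_is_linear IH.
Qed.

Lemma dpolyC v w q : dpoly v (dpoly w q) = dpoly w (dpoly v q).
Proof.
rewrite [dpoly w q]dpolyE dpoly_scale_sum [RHS]dpolyE; apply: eq_bigr => j _.
by rewrite mderiv_dpoly.
Qed.

Lemma mderiv_dpolys vs q j : mderiv j (dpolys vs q) = dpolys vs (mderiv j q).
Proof. by elim: vs => [//|v vs IH] /=; rewrite mderiv_dpoly IH. Qed.

(** Directional derivatives commute, so the order of a list of directions is
    immaterial; this and [foldr_perm] are the underlying facts on lists. *)
Lemma foldr_mid (T S : Type) (f : T -> S -> S) (x0 : S) (s t : seq T) x :
  (forall x y s, f x (f y s) = f y (f x s)) ->
  foldr f x0 (s ++ x :: t) = f x (foldr f x0 (s ++ t)).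
Proof. by move=> fC; elim: s => [//|y s IH] /=; rewrite IH fC. Qed.

Lemma foldr_perm (T : eqType) (S : Type) (f : T -> S -> S) (x0 : S) (s t : seq T) :
  (forall x y s, f x (f y s) = f y (f x s)) ->
  perm_eq s t -> foldr f x0 s = foldr f x0 t.
Proof.
move=> fC; elim: s t => [|x s IH] t st; first by move: st; rewrite perm_sym => /perm_nilP ->.
have xt : x \in t by rewrite -(perm_mem st) mem_head.
case/splitPr: xt st => t1 t2 st; rewrite foldr_mid //= (IH (t1 ++ t2)) //.
rewrite -(perm_cons x); apply: perm_trans st _.
by apply/permPl/(perm_catCA t1 [:: x] t2).
Qed.

Lemma dpolys_perm (I : eqType) (a : I -> 'cV[C]_n) (s t : seq I) q :
  perm_eq s t -> dpolys (map a s) q = dpolys (map a t) q.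
Proof.
move=> st; rewrite /dpolys !foldr_map; apply: foldr_perm st.
by move=> x y z; exact: dpolyC.
Qed.

Lemma dpolys_mid vs1 vs2 v q : dpolys (vs1 ++ v :: vs2) q = dpoly v (dpolys (vs1 ++ vs2) q).
Proof. by apply: foldr_mid => x y z; exact: dpolyC. Qed.

Lemma conj_eval_sum (I : Type) (s : seq I) (c : I -> C) (F : I -> {mpoly C[n]}) z :
  conj_eval (\sum_(i <- s) c i *: F i) z = \sum_(i <- s) c i * conj_eval (F i) z.
Proof.
rewrite /conj_eval raddf_sum; apply: eq_bigr => i _; exact: mevalZ.
Qed.

Lemma dpoly_suml (I : Type) (s : seq I) (c : I -> C) (a : I -> 'cV[C]_n) q :
  dpoly (\sum_(i <- s) c i *: a i) q = \sum_(i <- s) c i *: dpoly (a i) q.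
Proof.
elim: s => [|i s IH].
  by rewrite !big_nil /dpoly big1 // => j _; rewrite mxE scale0r.
rewrite !big_cons -IH /dpoly scaler_sumr -big_split /=; apply: eq_bigr => j _.
by rewrite cV_addE cV_scaleE scalerDl scalerA.
Qed.

(** The restriction of q to the complex line through z in the direction v.
    Taylor's formula and derivatives along a hyperplane reduce to one
    variable through it. *)
Definition linep z v q : {poly C} := mmap polyC (fun j => (z j 0)%:P + v j 0 *: 'X) q.

Lemma linepC z v c : linep z v c%:MP = c%:P.
Proof. exact: mmapC. Qed.

Lemma linepXU z v i : linep z v 'X_i = (z i 0)%:P + v i 0 *: 'X.
Proof. by rewrite /linep mmapX mmap1U. Qed.

Lemma linepD z v p q : linep z v (p + q) = linep z v p + linep z v q.
Proof. exact: raddfD. Qed.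

Lemma linepM z v p q : linep z v (p * q) = linep z v p * linep z v q.
Proof. exact: rmorphM. Qed.

Lemma linep_horner z v q t : (linep z v q).[t] = q.@[(z + t *: v)^~ 0].
Proof.
elim/mpoly_ring_ind: q => [c|i|p q hp hq|p q hp hq].
- by rewrite linepC hornerC mevalC.
- by rewrite linepXU mevalXU cV_addE cV_scaleE !hornerE mulrC.
- by rewrite linepD mevalD hornerD hp hq.
- by rewrite linepM mevalM hornerM hp hq.
Qed.

Lemma dpolyM v p q : dpoly v (p * q) = dpoly v p * q + p * dpoly v q.
Proof.
rewrite /dpoly mulr_suml mulr_sumr -big_split /=; apply: eq_bigr => j _.
by rewrite mderivM scalerDr scalerAl scalerAr.
Qed.

Lemma dpolyD v p q : dpoly v (p + q) = dpoly v p + dpoly v q.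
Proof. by have := dpoly_is_linear v 1 p q; rewrite !scale1r. Qed.

Lemma linep_deriv z v q : deriv (linep z v q) = linep z v (dpoly v q).
Proof.
elim/mpoly_ring_ind: q => [c|i|p q hp hq|p q hp hq].
- rewrite linepC derivC /dpoly big1 ?linepC -?mpolyC0 ?linepC // => j _.
  by rewrite mderivC scaler0 mpolyC0.
- rewrite linepXU derivD derivC derivZ derivX add0r /dpoly (bigD1 i) //= big1.
    by rewrite addr0 mderivXU eqxx -mul_mpolyC -mpolyCM linepC mulr1 alg_polyC.
  by move=> j /negPf; rewrite eq_sym mderivXU => ->; rewrite mpolyC0 scaler0.
- by rewrite linepD derivD dpolyD linepD hp hq.
- by rewrite linepM derivM dpolyM linepD !linepM hp hq.
Qed.

Lemma linep_derivn z v q r : derivn r (linep z v q) = linep z v (iter r (dpoly v) q).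
Proof. by elim: r => [//|r IH]; rewrite derivnS IH linep_deriv. Qed.

(** Taylor's formula at z for the restriction of q to the line through z and
    z + v. *)
Lemma meval_taylor0 z v q : (forall r, (iter r (dpoly v) q).@[z^~ 0] = 0) ->
  q.@[(z + v)^~ 0] = 0.
Proof.
move=> h; rewrite -[v in LHS]scale1r -linep_horner.
suff -> : linep z v q = 0 by rewrite horner0.
apply/polyP => r; rewrite coef0; apply/eqP.
have := coef_derivn r (linep z v q) 0.
rewrite addn0 ffactnn -horner_coef0 linep_derivn linep_horner scale0r addr0 h.
by move/eqP; rewrite eq_sym mulrn_eq0 -[_ == 0%N]negbK -lt0n fact_gt0.
Qed.

Lemma poly_eq0_fun (p : {poly C}) : (forall t, p.[t] = 0) -> p = 0.
Proof.
move=> p0; apply: (@roots_geq_poly_eq0 _ p [seq i%:R | i <- iota 0 (size p)]).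
- by apply/allP => x _; rewrite /root p0.
- rewrite map_inj_uniq ?iota_uniq // => i j /eqP; rewrite eqr_nat => /eqP //.
- by rewrite size_map size_iota.
Qed.

(** A vector v with v . p = 0 is parallel to the hyperplane, on whose lines
    in the direction v the polynomial q is identically zero. *)
Lemma dpoly_hyperplane (p : 'cV[C]_n) v q : dot v p = 0 ->
  (forall z, dot z p = 1 -> q.@[z^~ 0] = 0) ->
  forall z, dot z p = 1 -> (dpoly v q).@[z^~ 0] = 0.
Proof.
move=> vp q0 z zp.
have l0 : linep z v q = 0.
  by apply: poly_eq0_fun => t; rewrite linep_horner q0 // dotDl dotZl vp mulr0 addr0.
have := linep_horner z v (dpoly v q) 0.
by rewrite -linep_deriv l0 deriv0 horner0 scale0r addr0.
Qed.

Lemma dpolys_hyperplane (p : 'cV[C]_n) vs q : (forall v, v \in vs -> dot v p = 0) ->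
  (forall z, dot z p = 1 -> q.@[z^~ 0] = 0) ->
  forall z, dot z p = 1 -> (dpolys vs q).@[z^~ 0] = 0.
Proof.
elim: vs => [//|v vs IH] vp q0 /=; apply: dpoly_hyperplane; first by rewrite vp ?mem_head.
by apply: IH => // w ws; rewrite vp // inE ws orbT.
Qed.

(** The n - 1 independent vectors a_k and conj p, which is not in their span
    since conj p . p = 1, form a basis of C^n. *)
Lemma tangent_span (p : 'cV[C]_n) (a : 'I_n.-1 -> 'cV[C]_n) v : (0 < n)%N -> sphere p ->
  free [tuple a k | k < n.-1] -> (forall k, dot (a k) p = 0) -> dot v p = 0 ->
  exists c : 'I_n.-1 -> C, v = \sum_k c k *: a k.
Proof.
move=> n0 Sp fa ap vp; set X := [tuple a k | k < n.-1].
have Xp w : w \in <<X>>%VS -> dot w p = 0.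
  move/coord_span => ->; rewrite dotC dot_sumr big1 // => k _.
  by rewrite dotZr nth_mktuple dotC ap mulr0.
have pp : dot (conjv p) p = 1 by rewrite dotC -sqnormE.
have fX : free (conjv p :: X).
  rewrite free_cons fa andbT; apply/negP => /Xp; rewrite pp => /eqP.
  by rewrite oner_eq0.
have full : <<conjv p :: X>>%VS = fullv.
  have dX : \dim <<conjv p :: X>>%VS = n.
    by rewrite (eqP fX); have := size_tuple X => /= ->; rewrite prednK.
  by apply/eqP; rewrite eqEdim subvf dX dimvf /dim /= muln1.
have : v \in <<conjv p :: X>>%VS by rewrite full memvf.
rewrite span_cons => /memv_addP[_ /vlineP[k ->] [x xX vE]].
move: vp; rewrite vE dotDl dotZl pp mulr1 (Xp x xX) addr0 => k0.
exists (fun i => coord X i x); rewrite k0 scale0r add0r {1}(coord_span xX).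
by apply: eq_bigr => i _; rewrite nth_mktuple.
Qed.

End DirectionalDerivatives.

(** * Tangential fields of type (0,1) *)

Section TangentialFields.
Context {R : realType} {n : nat}.
Local Notation C := (CC R).
Local Notation field := ('cV[C]_n -> 'cV[C]_n).
Variable U : set 'cV[C]_n.
Hypothesis oU : open U.
Implicit Types (f g u : 'cV[C]_n -> C) (a b : field) (bs : seq field) (q : {mpoly C[n]})
  (z p v : 'cV[C]_n).

Definition Smooth f := forall k, smooth U k f.

Lemma Smooth_wdiffable f z : Smooth f -> U z -> wdiffable f z.
Proof. by move=> /(_ 1%N)[h _]; exact: h. Qed.

Lemma Smooth_dbar f j : Smooth f -> Smooth (dbar j f).
Proof. by move=> h k; have [_] := h k.+1; apply. Qed.

Lemma Smooth_eq f g : (forall z, U z -> f z = g z) -> Smooth f -> Smooth g.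
Proof. by move=> fg h k; exact: smooth_eq (h k). Qed.

Lemma SmoothM f g : Smooth f -> Smooth g -> Smooth (fun z => f z * g z).
Proof. by move=> hf hg k; exact: smoothM. Qed.

Lemma SmoothD f g : Smooth f -> Smooth g -> Smooth (fun z => f z + g z).
Proof. by move=> hf hg k; exact: smoothD. Qed.

Lemma Smooth_sum (I : Type) (s : seq I) (F : I -> 'cV[C]_n -> C) :
  (forall i, Smooth (F i)) -> Smooth (fun z => \sum_(i <- s) F i z).
Proof. by move=> h k; apply: smooth_sum => // i; exact: h. Qed.

Lemma Smooth_holo f : holo U f -> Smooth f.
Proof. by move=> h k; exact: smooth_holo. Qed.

Lemma Smooth_conj_eval q : Smooth (conj_eval q).
Proof. by move=> k; exact: smooth_conj_eval. Qed.

Lemma Lbar_eq a f g z : (forall w, U w -> f w = g w) -> wdiffable f z -> U z ->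
  Lbar a f z = Lbar a g z.
Proof.
move=> fg hf Uz; apply: eq_bigr => j _; congr (_ * _); apply: dbar_near hf.
by apply: filterS (open_near oU Uz) => w; exact: fg.
Qed.

Lemma LbarD a f g z : wdiffable f z -> wdiffable g z ->
  Lbar a (fun w => f w + g w) z = Lbar a f z + Lbar a g z.
Proof.
move=> hf hg; rewrite /Lbar -big_split /=; apply: eq_bigr => j _.
by rewrite dbarD // mulrDr.
Qed.

Lemma LbarM a f g z : wdiffable f z -> wdiffable g z ->
  Lbar a (fun w => f w * g w) z = Lbar a f z * g z + f z * Lbar a g z.
Proof.
move=> hf hg; rewrite /Lbar mulr_suml mulr_sumr -big_split /=; apply: eq_bigr => j _.
by rewrite dbarM //; ring.
Qed.

Lemma Lbar_sum a (I : Type) (s : seq I) (F : I -> 'cV[C]_n -> C) z : U z ->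
  (forall i, Smooth (F i)) ->
  Lbar a (fun w => \sum_(i <- s) F i w) z = \sum_(i <- s) Lbar a (F i) z.
Proof.
move=> Uz hF; elim: s => [|i s IH].
  rewrite big_nil; under eq_fun do rewrite big_nil.
  rewrite /Lbar big1 // => j _.
  by rewrite (dbar_holo j (@holo_cst _ _ U 0) Uz) mulr0.
rewrite big_cons -IH -LbarD; last 2 first.
- exact: Smooth_wdiffable.
- by apply: Smooth_wdiffable => //; exact: Smooth_sum.
by congr (Lbar a _ z); apply/funext => w; rewrite big_cons.
Qed.

Lemma Lbar_holo a f z : holo U f -> U z -> Lbar a f z = 0.
Proof. by move=> hf Uz; rewrite /Lbar big1 // => j _; rewrite (dbar_holo j hf Uz) mulr0. Qed.

Definition smooth_field a := forall j, Smooth (fun z => a z j 0).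

(** The condition a(z) . z = 0 says that \sum_j a_j d/d(conj z_j) kills
    \sum_j z_j (conj z_j), that is, that the field is tangent to the sphere.
    Off the sphere a is arbitrary. *)
Definition tangential a := smooth_field a /\ forall z, U z -> sphere z -> dot (a z) z = 0.

Lemma Smooth_Lbar a f : smooth_field a -> Smooth f -> Smooth (Lbar a f).
Proof.
move=> ha hf; apply: Smooth_sum => j.
by apply: SmoothM; [exact: ha | exact: Smooth_dbar].
Qed.

(** This is [tangent_dbar]. Applied to a difference, it shows that the
    tangential derivatives of a function at the points of the sphere only
    depend on its values there. *)
Lemma Lbar_sphere0 a f z : tangential a -> Smooth f ->
  (forall w, U w -> sphere w -> f w = 0) -> U z -> sphere z -> Lbar a f z = 0.
Proof.
move=> [_ ta] sf f0 Uz Sz; have [al [be h]] := Smooth_wdiffable sf Uz.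
rewrite /Lbar; under eq_bigr do rewrite (dbarE _ h).
apply: (tangent_dbar Sz h _ (ta z Uz Sz)).
by apply: filterS (open_near oU Uz) => w; exact: f0.
Qed.

(** What the differentiation of the coefficients of b contributes when a is
    applied to a derivative along b. *)
Definition Lbar_field a b : field := fun z => \col_j Lbar a (fun w => b w j 0) z.

Lemma Lbar_fieldE a b j : (fun z => Lbar_field a b z j 0) = Lbar a (fun w => b w j 0).
Proof. by apply/funext => z; rewrite mxE. Qed.

(** Apply a to b(z) . z, which vanishes on the sphere; the factor z is
    holomorphic, so only b is differentiated. *)
Lemma tangential_Lbar_field a b : tangential a -> tangential b -> tangential (Lbar_field a b).
Proof.
move=> ta tb; have [sa _] := ta; have [sb b0] := tb; split.
  by move=> j; rewrite Lbar_fieldE; exact: Smooth_Lbar.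
move=> z Uz Sz.
have s j : Smooth (fun w => b w j 0 * w j 0).
  by apply: SmoothM => //; apply: Smooth_holo; exact: holo_coord.
have := Lbar_sphere0 (f := fun w => dot (b w) w) ta (Smooth_sum _ s) b0 Uz Sz.
rewrite Lbar_sum // => <-; apply: eq_bigr => j _.
rewrite LbarM; last 2 first.
- exact: Smooth_wdiffable.
- by apply: Smooth_wdiffable => //; apply: Smooth_holo; exact: holo_coord.
by rewrite (Lbar_holo _ (@holo_coord _ _ U j)) // mulr0 addr0 -Lbar_fieldE.
Qed.

(** The iterated derivative of q in the directions bs(z), taken as constant
    directions, at the point conj z. Thus fderivs bs q is the part of the
    highest order in q of the composition of the fields bs applied to q(conj
    z). *)
Definition fderivs bs q z := conj_eval (dpolys [seq b z | b : field <- bs] q) z.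

Lemma fderivs_cons b bs q z :
  fderivs (b :: bs) q z = \sum_j b z j 0 * fderivs bs (mderiv j q) z.
Proof.
rewrite /fderivs /= dpolyE conj_eval_sum; apply: eq_bigr => j _.
by rewrite mderiv_dpolys.
Qed.

Fixpoint tangentials bs : Prop :=
  if bs is b :: bs' then tangential b /\ tangentials bs' else True.

Lemma Smooth_fderivs bs q : tangentials bs -> Smooth (fderivs bs q).
Proof.
elim: bs q => [|b bs IH] q; first by move=> _; exact: Smooth_conj_eval.
move=> [[sb _] /IH tbs].
rewrite (_ : fderivs _ _ = fun z => \sum_j b z j 0 * fderivs bs (mderiv j q) z).
  by apply: Smooth_sum => j; apply: SmoothM; [exact: sb | exact: tbs].
by apply/funext => z; rewrite fderivs_cons.
Qed.

(** Sums of terms with fewer than r derivatives of q, in tangential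
    directions. Such are the error terms produced when the coefficients of
    fields are differentiated. The operators, and not only their values, are
    recorded, as they are applied to the partial derivatives of q in
    [lower_order_prepend]. *)
Inductive lower_order (r : nat) : ({mpoly C[n]} -> 'cV[C]_n -> C) -> Prop :=
| lower_term c bs : Smooth c -> tangentials bs -> (size bs < r)%N ->
    lower_order r (fun q z => c z * fderivs bs q z)
| lower_add F G : lower_order r F -> lower_order r G ->
    lower_order r (fun q z => F q z + G q z)
| lower_zero : lower_order r (fun _ _ => 0)
| lower_eq F G : (forall q z, U z -> F q z = G q z) -> lower_order r F -> lower_order r G.

Lemma lower_order_Smooth r F q : lower_order r F -> Smooth (F q).
Proof.
elim=> [c bs sc tbs _|{}F G _ IH _ IH'||{}F G FG _ IH].
- by apply: SmoothM => //; exact: Smooth_fderivs.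
- exact: SmoothD.
- by apply: Smooth_holo; exact: holo_cst.
- by apply: Smooth_eq IH => z; exact: FG.
Qed.

Lemma lower_orderW r s F : (r <= s)%N -> lower_order r F -> lower_order s F.
Proof.
move=> rs; elim=> [c bs sc tbs br|{}F G _ IH _ IH'||{}F G FG _ IH].
- by apply: lower_term => //; exact: leq_trans rs.
- exact: lower_add.
- exact: lower_zero.
- exact: lower_eq FG IH.
Qed.

Lemma Smooth_cst (c : C) : Smooth (fun=> c).
Proof. by apply: Smooth_holo; exact: holo_cst. Qed.

Lemma lower_orderM r c F : Smooth c -> lower_order r F ->
  lower_order r (fun q z => c z * F q z).
Proof.
move=> sc; elim=> [c' bs sc' tbs br|{}F G _ IH _ IH'||{}F G FG _ IH].
- have l : lower_order r (fun q z => (c z * c' z) * fderivs bs q z).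
    by apply: lower_term => //; exact: SmoothM.
  by apply: lower_eq l => q z _; rewrite mulrA.
- by apply: lower_eq (lower_add IH IH') => q z _; rewrite mulrDr.
- by apply: lower_eq (lower_zero _) => q z _; rewrite mulr0.
- by apply: lower_eq IH => q z Uz; rewrite FG.
Qed.

Lemma lower_order_prepend r F b : tangential b -> lower_order r F ->
  lower_order r.+1 (fun q z => \sum_j b z j 0 * F (mderiv j q) z).
Proof.
move=> tb; elim=> [c bs sc tbs br|{}F G _ IH _ IH'||{}F G FG _ IH].
- have l : lower_order r.+1 (fun q z => c z * fderivs (b :: bs) q z) by apply: lower_term.
  apply: lower_eq l => q z _; rewrite fderivs_cons mulr_sumr; apply: eq_bigr => j _.
  by rewrite mulrCA.
- apply: lower_eq (lower_add IH IH') => q z _; rewrite -big_split /=.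
  by apply: eq_bigr => j _; rewrite mulrDr.
- apply: lower_eq (lower_zero _) => q z _; rewrite big1 // => j _.
  by rewrite mulr0.
- apply: lower_eq IH => q z Uz; apply: eq_bigr => j _; by rewrite FG.
Qed.

(** The field a differentiates either q or one of the fields in bs; in the
    latter case b is replaced by [Lbar_field a b], which is tangential too,
    and the number of derivatives of q does not increase. *)
Lemma Lbar_fderivs a bs : tangential a -> tangentials bs ->
  exists2 F, lower_order (size bs).+1 F &
    forall q z, U z -> Lbar a (fderivs bs q) z = fderivs (a :: bs) q z + F q z.
Proof.
move=> ta; elim: bs => [_|b bs IH [tb tbs]].
  exists (fun _ _ => 0) => [|q z Uz]; first exact: lower_zero.
  rewrite addr0 fderivs_cons; apply: eq_bigr => j _.
  by rewrite -[fderivs [::] q]/(conj_eval q) dbar_conj_eval.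
have [F lF hF] := IH tbs.
exists (fun q z => 1 * fderivs (Lbar_field a b :: bs) q z + \sum_j b z j 0 * F (mderiv j q) z).
  apply: lower_add (lower_order_prepend tb lF).
  by apply: lower_term => //; [exact: Smooth_cst | split=> //; exact: tangential_Lbar_field].
move=> q z Uz; have [sb _] := tb.
have -> : fderivs (b :: bs) q = fun w => \sum_j b w j 0 * fderivs bs (mderiv j q) w.
  by apply/funext => w; rewrite fderivs_cons.
rewrite Lbar_sum //; last by move=> j; apply: SmoothM => //; exact: Smooth_fderivs.
rewrite mul1r addrCA fderivs_cons.
have -> : fderivs (a :: b :: bs) q z = \sum_j b z j 0 * fderivs (a :: bs) (mderiv j q) z.
  by rewrite -fderivs_cons /fderivs /= dpolyC.
rewrite -!big_split /=; apply: eq_bigr => j _.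
rewrite LbarM; last 2 first.
- exact: Smooth_wdiffable.
- by apply: Smooth_wdiffable => //; exact: Smooth_fderivs.
by rewrite hF // mulrDr -Lbar_fieldE.
Qed.

Lemma Lbar_lower_order r F a : tangential a -> lower_order r F ->
  lower_order r.+1 (fun q => Lbar a (F q)).
Proof.
move=> ta; have [sa _] := ta.
elim=> [c bs sc tbs br|{}F G lF IH lG IH'||{}F G FG lF IH].
- have [E lE hE] := Lbar_fderivs ta tbs.
  have l1 : lower_order r.+1 (fun q z => Lbar a c z * fderivs bs q z).
    by apply: lower_term => //; [exact: Smooth_Lbar | exact: ltnW].
  have l2 : lower_order r.+1 (fun q z => c z * fderivs (a :: bs) q z).
    by apply: lower_term => //; split.
  have l3 : lower_order r.+1 (fun q z => c z * E q z).
    by apply: lower_orderM => //; apply: lower_orderW lE; exact: leqW.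
  apply: lower_eq (lower_add l1 (lower_add l2 l3)) => q z Uz.
  rewrite LbarM ?hE //; first by rewrite mulrDr.
    exact: Smooth_wdiffable.
  by apply: Smooth_wdiffable => //; exact: Smooth_fderivs.
- apply: lower_eq (lower_add IH IH') => q z Uz.
  rewrite LbarD //; apply: Smooth_wdiffable => //.
    exact: lower_order_Smooth lF.
  exact: lower_order_Smooth lG.
- apply: lower_eq (lower_zero _) => q z Uz.
  by rewrite (Lbar_holo _ (@holo_cst _ _ U 0)).
- apply: lower_eq IH => q z Uz; apply: Lbar_eq => // [w|]; first exact: FG.
  by apply: Smooth_wdiffable => //; exact: lower_order_Smooth lF.
Qed.

End TangentialFields.

(** * Compositions of tangential fields *)

Section Words.
Context {R : realType} {n : nat}.
Local Notation C := (CC R).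
Local Notation field := ('cV[C]_n -> 'cV[C]_n).
Variable U : set 'cV[C]_n.
Hypothesis oU : open U.
Context {I : Type} (a : I -> field).
Hypothesis ta : forall k, tangential U (a k).
Implicit Types (f g u : 'cV[C]_n -> C) (q : {mpoly C[n]}) (z p v : 'cV[C]_n) (s : seq I).

Definition Lbars s f := foldr (fun k => Lbar (a k)) f s.

Lemma Smooth_Lbars s f : Smooth U f -> Smooth U (Lbars s f).
Proof.
move=> sf; elim: s => [//|k s IH] /=; apply: Smooth_Lbar => //.
by have [] := ta k.
Qed.

(** By [Lbar_sphere0] for the difference, one field at a time. *)
Lemma Lbars_sphere s f g : Smooth U f -> Smooth U g ->
  (forall z, U z -> sphere z -> f z = g z) ->
  forall z, U z -> sphere z -> Lbars s f z = Lbars s g z.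
Proof.
move=> sf sg fg; elim: s => [//|k s IH] z Uz Sz /=.
have sF := Smooth_Lbars s sf; have sG := Smooth_Lbars s sg.
have sN : Smooth U (fun w => -1 * Lbars s g w).
  by apply: SmoothM => //; exact: Smooth_cst.
have := Lbar_sphere0 oU (f := fun w => Lbars s f w + -1 * Lbars s g w) (ta k)
   (SmoothD oU sF sN) _ Uz Sz.
rewrite LbarD; last 2 first; [exact: Smooth_wdiffable | exact: Smooth_wdiffable |].
rewrite (LbarM _ (Smooth_wdiffable (Smooth_cst oU _) Uz) (Smooth_wdiffable sG Uz)).
rewrite (Lbar_holo _ (@holo_cst _ _ U (-1)) Uz) mul0r add0r mulN1r.
move=> h; apply/eqP; rewrite -subr_eq0 h // => w Uw Sw.
by rewrite IH // mulN1r addrN.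
Qed.

(** Fields of type (0,1) kill holomorphic functions, which behave as
    constants. *)
Lemma Lbars_holo_comb s (J : Type) (r : seq J) (c : J -> 'cV[C]_n -> C)
    (F : J -> 'cV[C]_n -> C) :
  (forall j, holo U (c j)) -> (forall j, Smooth U (F j)) ->
  forall z, U z ->
  Lbars s (fun w => \sum_(j <- r) c j w * F j w) z = \sum_(j <- r) c j z * Lbars s (F j) z.
Proof.
move=> hc sF; elim: s => [//|k s IH] z Uz /=.
have sc j : Smooth U (c j) by exact: Smooth_holo.
have sL j : Smooth U (Lbars s (F j)) by exact: Smooth_Lbars.
rewrite (@Lbar_eq _ _ _ oU _ _ (fun w => \sum_(j <- r) c j w * Lbars s (F j) w)) //.
  rewrite (Lbar_sum oU) // => [|j]; last exact: SmoothM.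
  apply: eq_bigr => j _; rewrite LbarM ?(Lbar_holo _ (hc j) Uz) ?mul0r ?add0r //.
    exact: Smooth_wdiffable.
  exact: Smooth_wdiffable.
apply: (@Smooth_wdiffable _ _ U) => //; apply: Smooth_Lbars.
by apply: Smooth_sum => // j; exact: SmoothM.
Qed.

(** The composition of fields equals its part of highest order up to fewer
    tangential derivatives of q. This triangular shape allows an induction
    on the number of derivatives. *)
Lemma Lbars_expand u s : Smooth U u ->
  exists2 F, lower_order U (size s) F & forall q z, U z ->
    Lbars s (fun w => u w * conj_eval q w) z = u z * fderivs (map a s) q z + F q z.
Proof.
move=> su; elim: s => [|k s [F lF hF]].
  by exists (fun _ _ => 0) => [|q z _]; [exact: lower_zero | rewrite addr0].
have tas : tangentials U (map a s) by elim: (s) => [//|i s' IH] /=; split.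
have [sk _] := ta k.
have [E lE hE] := Lbar_fderivs oU (ta k) tas; rewrite size_map in lE.
exists (fun q z => Lbar (a k) u z * fderivs (map a s) q z +
   (u z * E q z + Lbar (a k) (F q) z)).
  apply: lower_add.
    by apply: lower_term => //; [exact: Smooth_Lbar | rewrite size_map].
  by apply: lower_add; [exact: lower_orderM | exact: Lbar_lower_order].
move=> q z Uz; have sfd : Smooth U (fderivs (map a s) q) by exact: Smooth_fderivs.
have sF : Smooth U (F q) by exact: lower_order_Smooth lF.
have hu := Smooth_wdiffable su Uz; have hfd := Smooth_wdiffable sfd Uz.
rewrite [LHS]/= (@Lbar_eq _ _ _ oU _ _ (fun w => u w * fderivs (map a s) q w + F q w)) //.
- rewrite LbarD; last 2 first; [exact: wdiffableM | exact: Smooth_wdiffable |].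
  by rewrite LbarM // hE // [map a (k :: s)]/=; ring.
- by move=> w Uw; exact: hF.
- apply: (@Smooth_wdiffable _ _ U) => //; apply: Smooth_Lbars; apply: SmoothM => //.
  exact: Smooth_conj_eval.
Qed.

Lemma lower_order_eval r F q p : U p -> sphere p ->
  (forall vs, (size vs < r)%N -> (forall v, v \in vs -> dot v p = 0) ->
     conj_eval (dpolys vs q) p = 0) ->
  lower_order U r F -> F q p = 0.
Proof.
move=> Up Sp h; elim=> [c bs sc tbs br|{}F G _ -> _ ->||{}F G FG _ IH].
- rewrite /fderivs h ?mulr0 ?size_map // => v.
  elim: bs tbs {br} => [//|b bs IH] [[_ tb] tbs]; rewrite inE => /orP[/eqP ->|]; last exact: IH.
  exact: tb.
- by rewrite addr0.
- by [].
- by rewrite -FG.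
Qed.

End Words.

(** * Vanishing of all tangential derivatives at a point *)

Section FiniteOrder.
Context {R : realType} {n : nat}.
Local Notation C := (CC R).
Local Notation field := ('cV[C]_n -> 'cV[C]_n).
Variable U : set 'cV[C]_n.
Hypothesis oU : open U.
Variables (a : 'I_n.-1 -> field) (p : 'cV[C]_n).
Hypotheses (ta : forall k, tangential U (a k)) (Up : U p) (Sp : sphere p) (n0 : (0 < n)%N).
Hypothesis fa : free [tuple a k p | k < n.-1].
Implicit Types (f g u : 'cV[C]_n -> C) (q : {mpoly C[n]}) (z v : 'cV[C]_n).

(** The fields in the order in which [Lbar_pow] composes them. *)
Definition word (al : 'X_{1..n.-1}) : seq 'I_n.-1 :=
  flatten [seq nseq (al k) k | k <- enum 'I_n.-1].

Lemma Lbar_powE al f : Lbar_pow a al f = Lbars a (word al) f.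
Proof.
rewrite /Lbar_pow /word /Lbars; elim: (enum _) => [//|k s IH] /=.
by rewrite foldr_cat -IH; elim: (al k) => [//|i IHi] /=; rewrite IHi.
Qed.

Lemma perm_word (s : seq 'I_n.-1) :
  perm_eq s (word [multinom count_mem k s | k < n.-1]).
Proof.
apply/allP => x _ /=; apply/eqP; rewrite /word count_flatten -map_comp sumnE big_map.
rewrite big_enum (bigD1 x) //= big1 => [|k /negPf kx]; last by rewrite count_nseq /= kx.
by rewrite count_nseq mnmE /= eqxx mul1n addn0.
Qed.

(** The iterated derivative is multilinear and symmetric in its directions,
    so it suffices to know it on a basis of the vectors v with v . p = 0.
    The vectors of vs are expanded one at a time. *)
Lemma dpolys_span q r :
  (forall s : seq 'I_n.-1, size s = r -> conj_eval (dpolys [seq a k p | k <- s] q) p = 0) ->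
  forall vs, size vs = r -> (forall v, v \in vs -> dot v p = 0) ->
  conj_eval (dpolys vs q) p = 0.
Proof.
move=> h vs vr vsp.
suff H : forall s, (size vs + size s)%N = r ->
    conj_eval (dpolys (vs ++ [seq a k p | k <- s]) q) p = 0.
  by have := H [::]; rewrite addn0 cats0; exact.
move: vr => _; elim: vs vsp => [|v vs IH] vsp s; first exact: h.
move=> vr; have vp : dot v p = 0 by rewrite vsp ?mem_head.
have ap k : dot (a k p) p = 0 by have [_] := ta k; apply.
have [c ->] := tangent_span n0 Sp fa ap vp.
rewrite /= dpoly_suml conj_eval_sum big1 // => k _.
rewrite -dpolys_mid -[_ :: _]/[seq a k p | k <- k :: s] IH ?mulr0 //.
  by move=> w ws; rewrite vsp // inE ws orbT.
by rewrite -vr /= addnS.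
Qed.

(** The points conj z with z in the Segre variety of p form the hyperplane z
    . p = 1. It passes through conj p in the directions a_k(p). By
    [Lbars_expand] and induction on the order, all the tangential
    derivatives of u(z) q(conj z) vanish at p exactly when all the
    derivatives of q at conj p along the hyperplane vanish, and by Taylor's
    formula when q vanishes on the hyperplane. *)
Lemma Lbar_pow_hyperplane u q : Smooth U u -> u p != 0 ->
  (forall al, Lbar_pow a al (fun z => u z * conj_eval q z) p = 0) <->
  (forall z, dot z p = 1 -> q.@[z^~ 0] = 0).
Proof.
move=> su up; have pp : dot (conjv p) p = 1 by rewrite dotC -sqnormE.
have ap k : dot (a k p) p = 0 by have [_] := ta k; apply.
split=> h; last first.
  move=> al; rewrite Lbar_powE.
  have [F lF ->] := Lbars_expand oU ta (word al) su => //.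
  have z0 vs : (forall v, v \in vs -> dot v p = 0) -> conj_eval (dpolys vs q) p = 0.
    by move=> vsp; exact: (dpolys_hyperplane vsp h).
  rewrite (lower_order_eval Up Sp _ lF) => [|vs _]; last exact: z0.
  rewrite addr0 /fderivs z0 ?mulr0 // => v; rewrite -map_comp => /mapP[k _ ->].
  exact: ap.
have D0 r : forall vs, size vs = r -> (forall v, v \in vs -> dot v p = 0) ->
    conj_eval (dpolys vs q) p = 0.
  elim/ltn_ind: r => r IH; apply: dpolys_span => s sr.
  have := h [multinom count_mem k s | k < n.-1]; rewrite Lbar_powE.
  have [F lF ->] := Lbars_expand oU ta (word [multinom count_mem k s | k < n.-1]) su => //.
  have sw := perm_word s.
  rewrite (lower_order_eval Up Sp _ lF) => [|vs vr]; last first.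
    by apply: IH (erefl _); rewrite -sr (perm_size sw).
  rewrite addr0 => /eqP; rewrite mulf_eq0 (negPf up) /= => /eqP.
  by rewrite /fderivs -map_comp -(dpolys_perm _ _ sw).
(* the Taylor expansion at conj p, in a direction parallel to the hyperplane *)
move=> z zp; have -> : z = conjv p + (z - conjv p) by rewrite addrC subrK.
apply: meval_taylor0 => r.
have -> : iter r (dpoly (z - conjv p)) q = dpolys (nseq r (z - conjv p)) q.
  by elim: r => [//|r IH] /=; rewrite IH.
apply: (D0 r); first by rewrite size_nseq.
by move=> v; rewrite mem_nseq => /andP[_ /eqP ->]; rewrite dotDl dotNl zp pp subrr.
Qed.

End FiniteOrder.

(** * The homogeneous sphere map *)

Section PolynomialFunctions.
Context {R : realType} {n : nat}.
Local Notation C := (CC R).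
Implicit Types (q : {mpoly C[n]}) (z p v : 'cV[C]_n).

Lemma dpoly_delta j q : dpoly (delta_mx j 0) q = mderiv j q.
Proof.
rewrite /dpoly (bigD1 j) //= big1 => [|i /negPf ij]; rewrite mxE ?eqxx ?scale1r ?addr0 //.
by rewrite ij scale0r.
Qed.

Lemma meval_origin q : q.@[(0 : 'cV[C]_n)^~ 0] = q@_0%MM.
Proof.
elim/mpoly_ring_ind: q => [c|i|p q hp hq|p q hp hq].
- by rewrite mevalC mcoeffC eqxx mulr1.
- by rewrite mevalXU mxE mcoeffX mnm1_eq0.
- by rewrite mevalD mcoeffD hp hq.
- by rewrite mevalM hp hq; exact/esym/(rmorphM (mcoeff 0%MM)).
Qed.

(** A polynomial function that is zero has zero derivatives, and its
    coefficients are values at the origin of derivatives, up to factorials. *)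
Lemma mpoly_eq0_fun q : (forall z, q.@[z^~ 0] = 0) -> q = 0.
Proof.
move=> q0; apply/mpolyP => m; rewrite mcoeff0.
move E : (mdeg m) => k; elim: k m q q0 E => [|k IH] m q q0 E.
  by have /eqP := E; rewrite mdeg_eq0 => /eqP ->; rewrite -meval_origin.
have [b [i [-> bk]]] := multinom_succ E.
have : (mderiv i q)@_b = 0.
  apply: IH => // z; rewrite -dpoly_delta.
  have l0 : linep z (delta_mx i 0) q = 0.
    by apply: poly_eq0_fun => t; rewrite linep_horner q0.
  have := linep_horner z (delta_mx i 0) (dpoly (delta_mx i 0) q) 0.
  by rewrite -linep_deriv l0 deriv0 horner0 scale0r addr0.
by rewrite mcoeff_deriv => /eqP; rewrite mulrn_eq0 /= => /eqP.
Qed.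

End PolynomialFunctions.

Section HomogeneousMap.
Context {R : realType} {n : nat}.
Local Notation C := (CC R).
Variable d : nat.
Hypothesis n0 : (0 < n)%N.
Implicit Types (z p v : 'cV[C]_n) (c : 'cV[C]_(K n d)).

Definition mindex (j : 'I_(K n d)) : 'X_{1..n} := nth 0%MM (multiindices n d) j.

Definition mweight (j : 'I_(K n d)) : C := sqrtC ((d`!)%:R / \prod_i ((mindex j i)`!)%:R).

Lemma mweight_gt0 j : 0 < mweight j.
Proof.
rewrite sqrtC_gt0 divr_gt0 ?ltr0n ?fact_gt0 //.
by apply: prodr_gt0 => i _; rewrite ltr0n fact_gt0.
Qed.

Lemma mdeg_mindex j : mdeg (mindex j) = d.
Proof.
apply/eqP; rewrite -mem_multiindices mem_nth // size_multiindices //.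
Qed.

Lemma mindex_inj : injective mindex.
Proof.
move=> i j /eqP; rewrite nth_uniq ?size_multiindices ?uniq_multiindices //.
by move/eqP/val_inj.
Qed.

(** A linear form in the components of the homogeneous map, as a polynomial
    in the conjugate variables: see [dot_Hnd]. *)
Definition hpoly c : {mpoly C[n]} := \sum_j (c j 0 * mweight j) *: 'X_[mindex j].

Lemma conj_monom z (a : 'X_{1..n}) : (monom z a)^* = monom (conjv z) a.
Proof. by rewrite /monom rmorph_prod; apply: eq_bigr => i _; rewrite rmorphXn mxE. Qed.

Lemma conj_Hnd z j : (Hnd d z j 0)^* = mweight j * monom (conjv z) (mindex j).
Proof.
have -> : Hnd d z j 0 = mweight j * monom z (mindex j) by rewrite mxE.
by rewrite rmorphM /= conj_monom conj_Creal //; exact/gtr0_real/mweight_gt0.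
Qed.

Lemma hpoly_eval c z : (hpoly c).@[z^~ 0] = \sum_j c j 0 * (mweight j * monom z (mindex j)).
Proof.
by rewrite /hpoly raddf_sum; apply: eq_bigr => j _; rewrite /= mevalZ monomE mulrA.
Qed.

Lemma dot_Hnd c z : dot c (conjv (Hnd d z)) = conj_eval (hpoly c) z.
Proof.
by rewrite /conj_eval hpoly_eval; apply: eq_bigr => j _; rewrite conjvE conj_Hnd.
Qed.

Lemma mcoeff_hpoly c j : (hpoly c)@_(mindex j) = c j 0 * mweight j.
Proof.
rewrite /hpoly raddf_sum (bigD1 j) //= mcoeffZ mcoeffX eqxx mulr1 big1 ?addr0 // => i ij.
by rewrite mcoeffZ mcoeffX (inj_eq mindex_inj) (negPf ij) mulr0.
Qed.

Lemma monomZ (t : C) z (a : 'X_{1..n}) : monom (t *: z) a = t ^+ mdeg a * monom z a.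
Proof.
rewrite /monom mdegE -prodrXr -big_split /=; apply: eq_bigr => i _.
by rewrite mxE exprMn.
Qed.

Lemma hpoly_homog c (t : C) z : (hpoly c).@[(t *: z)^~ 0] = t ^+ d * (hpoly c).@[z^~ 0].
Proof.
rewrite !hpoly_eval mulr_sumr; apply: eq_bigr => j _.
by rewrite monomZ mdeg_mindex; ring.
Qed.

(** A homogeneous polynomial vanishing on an affine hyperplane not through
    the origin vanishes on the cone over it, which is the complement of a
    hyperplane. So its product with a nonzero linear form is zero. *)
Lemma hpoly_hyperplane c p : p != 0 ->
  (forall z, dot z p = 1 -> (hpoly c).@[z^~ 0] = 0) -> c = 0.
Proof.
move=> p0 h; pose l : {mpoly C[n]} := \sum_j p j 0 *: 'X_j.
have lE z : l.@[z^~ 0] = dot z p.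
  rewrite /l raddf_sum; apply: eq_bigr => j _; by rewrite /= mevalZ mevalXU mulrC.
have l0 : l != 0.
  apply: contraNneq p0 => l0; apply/eqP/cV_eqP => j.
  by rewrite -delta_dot -lE l0 meval0 mxE.
have : hpoly c * l = 0.
  apply: mpoly_eq0_fun => z; rewrite mevalM lE.
  have [->|zp] := eqVneq (dot z p) 0; first by rewrite mulr0.
  rewrite (_ : z = dot z p *: ((dot z p)^-1 *: z)); last by rewrite scalerA divff ?scale1r.
  by rewrite hpoly_homog h ?mulr0 ?mul0r // dotZl mulVf.
move/eqP; rewrite mulf_eq0 (negPf l0) orbF => /eqP h0.
apply: cV_eqP => j; rewrite mxE; apply/eqP.
have := mcoeff_hpoly c j; rewrite h0 mcoeff0 => /esym/eqP.
by rewrite mulf_eq0 (gt_eqF (mweight_gt0 j)) orbF.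
Qed.

Lemma hpoly_is_sum c z (u : C) :
  u * conj_eval (hpoly c) z =
  \sum_j c j 0 * (u * conj_eval (hpoly (delta_mx j 0)) z).
Proof.
rewrite -dot_Hnd /dot mulr_sumr; apply: eq_bigr => j _.
by rewrite -dot_Hnd delta_dot mulrCA.
Qed.

End HomogeneousMap.

(** * Tangential derivatives and the homogeneous map *)

Section Frames.
Context {R : realType} {n : nat}.
Local Notation C := (CC R).
Implicit Types (p z : 'cV[C]_n) (W : set 'cV[C]_n).

(** The neighbourhood can be shrunk, for instance to a set where the
    denominator Q has no zero. *)
Lemma cr_frame_tangential p (a : 'I_n.-1 -> 'cV[C]_n -> 'cV[C]_n) W :
  sphere p -> cr_frame p a -> open W -> W p ->
  exists U, [/\ open U, U p, U `<=` W, forall k, tangential U (a k)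
    & free [tuple a k p | k < n.-1]].
Proof.
move=> Sp [U [[oU Up] ra tg fr]] oW Wp; exists (U `&` W).
have oUW : open (U `&` W) by exact: openI.
split; [exact: oUW | by split | by move=> z [] | move=> k | exact: fr].
split=> [j l|z [Uz _] Sz].
  by apply: smooth_real_analytic => // z [Uz _]; exact: ra.
rewrite -(tg k z Uz Sz) /Lbar; apply: eq_bigr => j _.
by rewrite dbar_sqnorm.
Qed.

End Frames.

Section Central.
Context {R : realType} {n : nat}.
Local Notation C := (CC R).
Local Notation field := ('cV[C]_n -> 'cV[C]_n).
Variables (d : nat) (U : set 'cV[C]_n) (a : 'I_n.-1 -> field) (p : 'cV[C]_n).
Hypotheses (oU : open U) (ta : forall k, tangential U (a k)) (Up : U p) (Sp : sphere p).
Hypotheses (n0 : (0 < n)%N) (fa : free [tuple a k p | k < n.-1]).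

Lemma sphere_neq0 (z : 'cV[C]_n) : sphere z -> z != 0.
Proof.
apply: contraPneq => ->; rewrite /sphere /= sqnormE dot0v => /eqP.
by rewrite eq_sym oner_eq0.
Qed.

(** The core of both parts. Tangential fields do not see the holomorphic
    coefficients c, which can be frozen at p. What remains is u(z) q(conj z)
    with q homogeneous, and q = 0 by [Lbar_pow_hyperplane] and
    [hpoly_hyperplane]. *)
Lemma Lbar_pow_Hnd (c : 'cV[C]_n -> 'cV[C]_(K n d)) (u g : 'cV[C]_n -> C) :
  (forall j, holo U (fun z => c z j 0)) -> Smooth U u -> u p != 0 -> Smooth U g ->
  (forall z, U z -> sphere z -> g z = u z * dot (c z) (conjv (Hnd d z))) ->
  (forall al, Lbar_pow a al g p = 0) <-> c p = 0.
Proof.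
move=> hc su up sg gE.
pose F j z := u z * conj_eval (hpoly (delta_mx j 0 : 'cV[C]_(K n d))) z.
have sF j : Smooth U (F j) by apply: SmoothM => //; exact: Smooth_conj_eval.
have sG : Smooth U (fun z => \sum_j c z j 0 * F j z).
  by apply: Smooth_sum => // j; apply: SmoothM => //; exact: Smooth_holo.
have E al : Lbar_pow a al g p = Lbar_pow a al (fun z => u z * conj_eval (hpoly (c p)) z) p.
  rewrite !Lbar_powE (@Lbars_sphere _ _ _ oU _ _ ta _ _ _ sg sG) // => [|z Uz Sz].
    rewrite (Lbars_holo_comb oU ta) //.
    rewrite -(@Lbars_holo_comb _ _ _ oU _ _ ta _ _ _ (fun j _ => c p j 0)) //;
      last by move=> j; exact: holo_cst.
    by congr (Lbars _ _ _ _); apply/funext => z; rewrite hpoly_is_sum.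
  by rewrite gE // dot_Hnd hpoly_is_sum.
have := @Lbar_pow_hyperplane _ _ U oU a p ta Up Sp n0 fa u (hpoly (c p)) su up.
move=> [h1 h2]; split=> [h|cp al].
  apply: (hpoly_hyperplane n0 (sphere_neq0 Sp)); apply: h1 => al; by rewrite -E.
by rewrite E; apply: h2 => z _; rewrite cp hpoly_eval big1 // => j _; rewrite mxE mul0r.
Qed.

End Central.

(** * Rank and spans *)

Section LinearAlgebra.

Lemma rank_inj (F : fieldType) k m (M : 'M[F]_(k, m)) :
  \rank M = m <-> (forall X : 'cV[F]_m, M *m X = 0 -> X = 0).
Proof.
rewrite -mxrank_tr; split=> [rM X MX|h].
  apply: trmx_inj; rewrite trmx0; apply/eqP.
  have fM : row_free M^T by rewrite /row_free rM.
  by rewrite -(mulmx_free_eq0 _ fM) -trmx_mul MX trmx0.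
apply/eqP; rewrite -/(row_free _) -kermx_eq0; apply/eqP/row_matrixP => i.
rewrite row0; apply: trmx_inj; rewrite trmx0; apply: h; apply: trmx_inj.
by rewrite trmx_mul trmxK trmx0 -row_mul mulmx_ker row0.
Qed.

Context {R : realType}.
Local Notation C := (CC R).

Lemma dot_span m (s : seq 'cV[C]_m) (X : 'cV[C]_m) : (forall v, v \in s -> dot X v = 0) ->
  forall v, v \in span s -> dot X v = 0.
Proof.
elim: s => [|w s IH] h v; first by rewrite span_nil memv0 => /eqP ->; rewrite dotv0.
rewrite span_cons => /memv_addP[_ /vlineP[k ->] [y ys ->]].
rewrite dotDr dotZr h ?mem_head // mulr0 add0r; apply: IH => // u us.
by apply: h; rewrite inE us orbT.
Qed.

Lemma dot_nondegenerate m (X : 'cV[C]_m) : (forall v, dot X v = 0) -> X = 0.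
Proof. by move=> h; apply: cV_eqP => j; rewrite -dot_delta h mxE. Qed.

Lemma orthogonal_vector m (E : {vspace 'cV[C]_m}) : E != fullv ->
  exists2 X : 'cV[C]_m, X != 0 & forall v, v \in E -> dot X v = 0.
Proof.
move=> Ef; pose M : 'M[C]_(\dim E, m) := \matrix_(i, j) (vbasis E)`_i j 0.
have MX (X : 'cV[C]_m) : M *m X = 0 -> forall v, v \in E -> dot X v = 0.
  move=> h v vE; apply: (@dot_span _ (vbasis E)) => [w|]; last by rewrite (span_basis (vbasisP E)).
  move=> wE; have /(nthP 0)[i iE0 <-] : w \in tval (vbasis E) by [].
  have iE : (i < \dim E)%N by rewrite -(size_tuple (vbasis E)).
  move/matrixP/(_ (Ordinal iE) 0) : h; rewrite !mxE => h; rewrite -[RHS]h /dot.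
  by apply: eq_bigr => j _; rewrite mxE mulrC.
apply: contrapT => h; case/negP: Ef; rewrite eqEdim subvf dimvf /dim /= muln1.
suff rM : \rank M = m by apply: leq_trans (rank_leq_row M); rewrite rM.
apply/rank_inj => X /MX hX; apply: contrapT => X0.
by apply: h; exists X => //; apply/eqP.
Qed.

(** The spans increase with k, so one of them has the largest dimension and
    contains all the vectors; it is the whole space unless some X is
    orthogonal to it. *)
Lemma span_eventually_full N m (L : 'X_{1..N} -> 'cV[C]_m) :
  (exists k, <<[seq L al | al : 'X_{1..N < k.+1}]>>%VS = fullv) <->
  (forall X : 'cV[C]_m, (forall al, dot X (L al) = 0) -> X = 0).
Proof.
pose E k := <<[seq L al | al : 'X_{1..N < k.+1}]>>%VS.
have inE' k al : (mdeg al <= k)%N -> L al \in E k.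
  move=> alk; apply: memv_span; apply/mapP.
  by exists (BMultinom (alk : (mdeg al < k.+1)%N)); rewrite ?mem_enum.
have Emono k l : (k <= l)%N -> (E k <= E l)%VS.
  move=> kl; apply/span_subvP => _ /mapP[al _ ->]; apply: inE'.
  by apply: leq_trans kl; rewrite -ltnS bmdeg.
split=> [[k Ek] X XL|h].
  apply: dot_nondegenerate => v; apply: (@dot_span _ [seq L al | al : 'X_{1..N < k.+1}]).
    by move=> _ /mapP[al _ ->].
  by rewrite Ek memvf.
pose dims (e : nat) := `[< exists k, \dim (E k) = e >].
have exd : exists e, dims e by exists (\dim (E 0)); apply/asboolP; exists 0%N.
have led e : dims e -> (e <= m)%N.
  by move=> /asboolP[k <-]; have := dimvS (subvf (E k)); rewrite dimvf /dim /= muln1.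
have [_ /asboolP[k <-] kmax] := ex_maxnP exd led.
exists k; apply/eqP; apply: contrapT => /negP/orthogonal_vector[X X0 XE].
case/eqP: X0; apply: h => al; apply: XE.
have kl : (E k <= E (maxn k (mdeg al)))%VS by apply: Emono; exact: leq_maxl.
have -> : <<[seq L al | al : 'X_{1..N < k.+1}]>>%VS = E (maxn k (mdeg al)).
  apply/eqP; rewrite eqEdim kl; apply: kmax; apply/asboolP; by eexists.
by apply: inE'; exact: leq_maxr.
Qed.

End LinearAlgebra.

(** * Finite nondegeneracy *)

Section SphereMap.
Context {R : realType} {n m : nat}.
Local Notation C := (CC R).
Variables (d : nat) (P : 'I_m -> {mpoly C[n]}) (Q : {mpoly C[n]}).
Variable (V : 'M[{mpoly C[n]}]_(K n d, m)).
Hypotheses (n0 : (0 < n)%N) (hV : is_VH d P V).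
Hypothesis degP : forall i, (msize (P i) <= d.+1)%N.
Hypothesis Q0 : forall z : 'cV[C]_n, sphere z -> Q.@[z^~ 0] != 0.

Lemma conj_poly (q : {mpoly C[n]}) :
  exists q', forall z : 'cV[C]_n, (q.@[z^~ 0])^* = conj_eval q' z.
Proof.
elim/mpoly_ring_ind: q => [c|i|p q [p' hp] [q' hq]|p q [p' hp] [q' hq]].
- by exists (c^*)%:MP => z; rewrite mevalC conj_evalC.
- by exists 'X_i => z; rewrite mevalXU conj_evalXU.
- by exists (p' + q') => z; rewrite mevalD rmorphD /= hp hq conj_evalD.
- by exists (p' * q') => z; rewrite mevalM rmorphM /= hp hq conj_evalM.
Qed.

(** On the sphere the powers of the norm in the definition of V_H are 1, and
    the homogeneous parts of P add up to P. *)
Lemma VH_sphere (X : 'cV[C]_m) (z : 'cV[C]_n) : sphere z ->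
  dot (mx_at V z *m X) (conjv (Hnd d z)) = \sum_i X i 0 * ((P i).@[z^~ 0])^*.
Proof.
move=> Sz; rewrite hV; apply: eq_bigr => i _; congr (_ * _).
rewrite summxE [in RHS](pihomog_partitionE (degP i)) (raddf_sum (meval _)) rmorph_sum.
by apply: eq_bigr => k _; rewrite Sz expr1n scale1r !mxE.
Qed.

Lemma mx_at_mulE (X : 'cV[C]_m) z j :
  (mx_at V z *m X) j 0 = \sum_i (V j i).@[z^~ 0] * X i 0.
Proof. by rewrite mxE; apply: eq_bigr => i _; rewrite mxE. Qed.

Definition nonzero_locus : set 'cV[C]_n := [set z | Q.@[z^~ 0] != 0].

Lemma open_nonzero_locus : open nonzero_locus.
Proof.
apply: (@open_comp _ _ (fun z : 'cV[C]_n => Q.@[z^~ 0]) [set x | x != 0]).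
  move=> z _; have [al h] := @holo_poly _ _ setT Q z I.
  exact: wdiff_continuous h.
exact: open_neq0.
Qed.

Lemma conj_ratmapE z i : conjv (ratmap P Q z) i 0 =
  ((Q.@[z^~ 0])^*)^-1 * ((P i).@[z^~ 0])^*.
Proof. by rewrite !mxE rmorphM fmorphV mulrC. Qed.

(** On the sphere X . conj H = (V_H X . conj (H^d)) / conj Q. Its tangential
    derivatives at p all vanish if and only if V_H(p) X = 0. So the vectors
    L^al conj H at p span C^m if and only if V_H(p) is injective. *)
Lemma finitely_nondegenerate_rank (p : 'cV[C]_n) (a : 'I_n.-1 -> 'cV[C]_n -> 'cV[C]_n) :
  sphere p -> cr_frame p a ->
  finitely_nondegenerate a (ratmap P Q) p <-> \rank (mx_at V p) = m.
Proof.
move=> Sp fr.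
have [U [oU Up UQ ta fa]] := cr_frame_tangential Sp fr open_nonzero_locus (Q0 Sp).
have [Q' hQ'] := conj_poly Q.
pose u z := (conj_eval Q' z)^-1.
have cQ0 z : nonzero_locus z -> conj_eval Q' z != 0 by move=> Qz; rewrite -hQ' conjC_eq0.
have su : Smooth U u.
  move=> k; apply: smoothV => // [z /UQ|]; [exact: cQ0 | exact: smooth_conj_eval].
have up : u p != 0 by rewrite invr_eq0 cQ0 //; exact: UQ.
have sH i : Smooth U (fun z => conjv (ratmap P Q z) i 0).
  have [Pi hPi] := conj_poly (P i).
  rewrite (_ : (fun z => _) = fun z => u z * conj_eval Pi z).
    by apply: SmoothM => //; exact: Smooth_conj_eval.
  by apply/funext => z; rewrite conj_ratmapE hQ' hPi.
apply: (iff_trans (span_eventually_full (fun al => Lbar_conj a (ratmap P Q) al p))).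
apply: (iff_trans _ (iff_sym (rank_inj (mx_at V p)))).
suff key (X : 'cV[C]_m) : (forall al, dot X (Lbar_conj a (ratmap P Q) al p) = 0) <->
    mx_at V p *m X = 0.
  by split=> h X hX; apply: h; apply/key.
pose g z := \sum_i X i 0 * conjv (ratmap P Q z) i 0.
have hc : forall j, holo U (fun z => (mx_at V z *m X) j 0).
  move=> j; rewrite (_ : (fun z => _) = fun z : 'cV[C]_n => \sum_i (V j i).@[z^~ 0] * X i 0).
    by apply: holo_sum => i; apply: holoM; [exact: holo_poly | exact: holo_cst].
  by apply/funext => z; exact: mx_at_mulE.
have sg : Smooth U g.
  by apply: Smooth_sum => // i; apply: SmoothM => //; exact: Smooth_cst.
have gE z : U z -> sphere z -> g z = u z * dot (mx_at V z *m X) (conjv (Hnd d z)).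
  move=> Uz Sz; rewrite VH_sphere // mulr_sumr; apply: eq_bigr => i _.
  by rewrite conj_ratmapE hQ' mulrCA.
apply: (iff_trans _ (Lbar_pow_Hnd oU ta Up Sp n0 fa hc su up sg gE)).
have E al : dot X (Lbar_conj a (ratmap P Q) al p) = Lbar_pow a al g p.
  rewrite Lbar_powE (@Lbars_holo_comb _ _ _ oU _ _ ta _ _ _ (fun i _ => X i 0)) //.
    by apply: eq_bigr => i _; rewrite mxE Lbar_powE.
  by move=> i; exact: holo_cst.
by split=> h al; [rewrite -E | rewrite E].
Qed.

End SphereMap.

(** * The identity theorem for holomorphic functions along the sphere *)

Section IdentityTheorem.
Context {R : realType} {n : nat}.
Local Notation C := (CC R).
Implicit Types (f g : 'cV[C]_n -> C) (z p v w : 'cV[C]_n) (U : set 'cV[C]_n)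
  (js : seq 'I_n).

Definition partials js f := foldr (fun j => real_deriv (delta_mx j 0)) f js.

Lemma psum_origin (c : 'X_{1..n} -> C) : psum c (0 : 'cV[C]_n) = c 0%MM.
Proof.
have u0 k : (hpart c k).@[(0 : 'cV[C]_n)^~ 0] = if k == 0%N then c 0%MM else 0.
  by rewrite meval_origin mcoeff_hpart mdeg0 eq_sym.
apply: psum_unique; have := @series_finite R (fun k => (hpart c k).@[(0 : 'cV[C]_n)^~ 0]) 1.
rewrite big_nat1 u0 /=; apply => k k0; rewrite u0; by case: eqP k0 => // ->.
Qed.

(** Up to factorials the coefficients are the values at z of the iterated
    partial derivatives. *)
Lemma psum_at_coef0 f z c : psum_at id f z c -> (forall js, partials js f z = 0) ->
  forall a, c a = 0.
Proof.
move=> fc pf a; move E : (mdeg a) => k; elim: k a f c fc pf E => [|k IH] a f c fc pf E.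
  have /eqP := E; rewrite mdeg_eq0 => /eqP ->.
  have [r [M [_ _ /nbhs_singleton]]] := fc.
  by rewrite addr0 psum_origin => <-; exact: (pf [::]).
have [b [i [-> bk]]] := multinom_succ E.
have := IH b _ _ (psum_at_partial i fc) _ bk.
move=> /(_ _)/eqP; rewrite mulrn_eq0 /= => h; apply/eqP; apply: h => js.
by have := pf (rcons js i); rewrite /partials foldr_rcons.
Qed.

Lemma psum_at_partials f z js : (exists c, psum_at id f z c) ->
  exists c, psum_at id (partials js f) z c.
Proof.
elim: js => [//|j js IH] /IH[c hc] /=; exists (dcoef j c); exact: psum_at_partial.
Qed.

Lemma psum_at_holo U f : (forall z, U z -> exists c, psum_at id f z c) -> holo U f.
Proof.
move=> hf z /hf[c hc].
by have /nbhs_singleton := psum_at_wdiff hc; rewrite addr0 => ?; eexists; eassumption.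
Qed.

Lemma partials_near0 f p js : (\forall z \near p, f z = 0) ->
  \forall z \near p, partials js f z = 0.
Proof.
elim: js => [//|j js IH] /IH/nbhs_interior; apply: filterS => z hz /=.
have h0 : wdiff (partials js f) z 0 0.
  apply: wdiff_near (wdiff_cst 0 z); apply: filterS hz => w /= ->. by [].
by rewrite (real_derivE _ h0) !dot0v addr0.
Qed.

(** By [holo_vanish_derivative] a partial derivative of a holomorphic
    function vanishing on the sphere vanishes there again. *)
Lemma holo_sphere_partials U f : open U -> (@sphere R n `<=` U) ->
  (forall z, U z -> exists c, psum_at id f z c) ->
  (forall z, sphere z -> f z = 0) ->
  forall js z, sphere z -> partials js f z = 0.
Proof.
move=> oU SU hf f0; elim=> [//|j js IH] z Sz /=.
have [al h] := psum_at_holo (fun w Uw => psum_at_partials js (hf w Uw)) (SU _ Sz).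
have al0 : al = 0.
  by apply: holo_vanish_derivative Sz h _; apply: filterE => w; exact: IH.
by rewrite (real_derivE _ h) al0 !dot0v addr0.
Qed.

(** The set of zeros of infinite order of f is open, since f is zero near
    them by its power series; closed in U, since the partial derivatives are
    continuous; and it contains the sphere. *)
Lemma identity_theorem U f : open U -> connected U -> (@sphere R n `<=` U) ->
  (exists z, @sphere R n z) ->
  (forall z, U z -> exists c, psum_at id f z c) ->
  (forall z, sphere z -> f z = 0) -> forall z, U z -> f z = 0.
Proof.
move=> oU cU SU [z0 Sz0] hf f0.
pose Z : set 'cV[C]_n := [set z | U z /\ forall js, partials js f z = 0].
suff ZU : Z = U by move=> z; rewrite -{1}ZU => -[_ /(_ [::])].
apply: cU.
- exists z0; split; first exact: SU.
  by move=> js; exact: (holo_sphere_partials oU SU hf f0).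
- exists Z; last by apply/seteqP; split=> [z Zz|z [_ //]]; split=> //; case: Zz.
  rewrite openE => z [Uz Zz]; have [c hc] := hf z Uz.
  have c0 := psum_at_coef0 hc Zz; have [r [M [_ _ fc]]] := hc.
  have fz0 : \forall w \near z, f w = 0.
    apply/nbhs0P; apply: filterS fc => w ->; apply: psum_unique.
    have := @series_finite R (fun k => (hpart c k).@[(id w)^~ 0]) 0.
    rewrite big_geq //; apply => k _; rewrite hpart_eval big1 // => a _.
    by rewrite c0 mul0r.
  have := nbhs_interior fz0; have := open_near oU Uz.
  apply: filterS2 => w Uw fw; split=> // js.
  exact: (nbhs_singleton (partials_near0 js fw)).
- exists (closure Z); first exact: closed_closure.
  apply/seteqP; split=> [z Zz|z [Uz cZ]]; first by split; [case: Zz|exact: subset_closure].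
  split=> // js; apply: contrapT => /eqP g0.
  have [al /wdiff_continuous h] := psum_at_holo (fun w Uw => psum_at_partials js (hf w Uw)) Uz.
  have [w [[_ Zw] /=]] := cZ _ (h _ (open_nbhs_nbhs (conj open_neq0 g0))).
  by rewrite Zw eqxx.
Qed.

End IdentityTheorem.

(** * Polynomials on the sphere *)

Section PolynomialsOnTheSphere.
Context {R : realType} {n : nat}.
Local Notation C := (CC R).
Implicit Types (q : {mpoly C[n]}) (z p v w : 'cV[C]_n).

(** The iterated derivatives of q vanish on the sphere near p too, by
    [holo_vanish_derivative], and Taylor's formula at p applies. *)
Lemma poly_sphere_eq0 q p : sphere p ->
  (\forall z \near p, sphere z -> q.@[z^~ 0] = 0) -> q = 0.
Proof.
move=> Sp q0; apply: mpoly_eq0_fun => z.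
have -> : z = p + (z - p) by rewrite addrC subrK.
set v := z - p; apply: meval_taylor0 => r.
suff: \forall z \near p, sphere z -> (iter r (dpoly v) q).@[z^~ 0] = 0.
  by move/nbhs_singleton; apply.
elim: r => [//|r /nbhs_interior]; apply: filterS => w hw Sw.
have [al h alE] := wdiff_poly (iter r (dpoly v) q) w.
have al0 := holo_vanish_derivative Sw h hw.
have d0 j : (mderiv j (iter r (dpoly v) q)).@[w^~ 0] = 0 by rewrite -alE al0 mxE.
rewrite iterS dpolyE (raddf_sum (meval _)) big1 // => j _.
by rewrite /= mevalZ d0 mulr0.
Qed.

Lemma translate_poly q z : exists q', forall w, q.@[(z + w)^~ 0] = q'.@[w^~ 0].
Proof.
elim/mpoly_ring_ind: q => [c|i|p q [p' hp] [q' hq]|p q [p' hp] [q' hq]].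
- by exists c%:MP => w; rewrite !mevalC.
- by exists ((z i 0)%:MP + 'X_i) => w; rewrite mevalD mevalC !mevalXU mxE.
- by exists (p' + q') => w; rewrite !mevalD hp hq.
- by exists (p' * q') => w; rewrite !mevalM hp hq.
Qed.

Lemma holomorphic_poly q z : holomorphic_at (fun w => q.@[w^~ 0]) z.
Proof.
have [q' hq] := translate_poly q z; exists (fun a => q'@_a); apply: filterE => w.
by rewrite hq; exact: poly_power_series.
Qed.

End PolynomialsOnTheSphere.

Section Connected.
Context {R : realType} {n : nat}.
Local Notation C := (CC R).

(** A union of segments from the origin. *)
Lemma connected_cV : connected [set: 'cV[C]_n].
Proof.
pose f (z : 'cV[C]_n) (t : R) : 'cV[C]_n := (t%:C)%C *: z.
have cf z : continuous (f z).
  move=> s A /nbhs_ballP[e /= e0 eA].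
  have [b zb] : exists b : R, `|z| = (b%:C)%C.
    by have /complex_realP[e' ?] := ger0_real (normr_ge0 z); exists e'.
  have b0 : 0 <= b by move: (normr_ge0 z); rewrite zb lecR.
  have [e' ee'] : exists e' : R, e = (e'%:C)%C.
    by have /complex_realP[e' ?] := gtr0_real e0; exists e'.
  have e'0 : 0 < e' by move: e0; rewrite ee' ltcR.
  have b1 : 0 < b + 1 by rewrite ltr_wpDl.
  suff: \forall t \near s, A (f z t) by [].
  have d0 : 0 < e' / (b + 1) by rewrite divr_gt0.
  apply/nbhs_ballP; exists (e' / (b + 1)) => //= t; rewrite -ball_normE /= => st.
  apply: eA; rewrite -ball_normE /= /f -scalerBl -rmorphB normrZ zb.
  have -> : `|((s - t)%:C)%C : C| = (`|s - t|%:C)%C.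
    by rewrite normc_def /= expr0n addr0 sqrtr_sqr.
  rewrite -rmorphM ee' ltcR; apply: le_lt_trans (_ : `|s - t| * (b + 1) < e').
    by rewrite ler_wpM2l // lerDl.
  by rewrite -ltr_pdivlMr.
have -> : [set: 'cV[C]_n] = \bigcup_(z in setT) (f z @` `[0, 1]%classic).
  apply/seteqP; split=> // z _; exists z => //; exists 1; last by rewrite /f scale1r.
  by rewrite /= in_itv /= ler01 lexx.
apply: bigcup_connected.
  exists 0 => z _; exists 0; last by rewrite /f scale0r.
  by rewrite /= in_itv /= ler01 lexx.
move=> z _; apply: connected_continuous_connected; first exact: segment_connected.
by apply: continuous_subspaceT; exact: cf.
Qed.

End Connected.

(** * Polynomial kernel vectors *)

Section FractionKernel.

Lemma fraction_numden (D : idomainType) (x : {fraction D}) :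
  exists c : D * D, c.2 != 0 /\ x * tofrac c.2 = tofrac c.1.
Proof.
elim/quotW: x => r; exists ((frac r).1, (frac r).2); split; first exact: denom_ratioP.
unlock tofrac; rewrite -[LHS]FracField.pi_mul; apply/eqmodP.
rewrite /= FracField.equivfE /FracField.mulf.
rewrite !numden_Ratio ?mulr1 ?oner_neq0 ?mulf_neq0 ?denom_ratioP //.
by rewrite mulrC.
Qed.

(** Over the fraction field, either some maximal minor is nonzero or there
    is a kernel vector, whose denominators can be cleared. *)
Lemma minor_or_kernel (D : idomainType) k m (V : 'M[D]_(k, m)) :
  (exists f : 'I_m -> 'I_k, \det (rowsub f V) != 0) \/
  (exists2 Y : 'cV[D]_m, Y != 0 & V *m Y = 0).
Proof.
pose F : fieldType := {fraction D}.
pose tf : {rmorphism D -> F} := @tofrac D.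
have tf_inj : injective tf by move=> x y /eqP; rewrite tofrac_eq => /eqP.
have [full|] := boolP (row_full (map_mx tf V)).
  left; exists (fullrankfun full).
  have := fullrowsub_unit full; rewrite unitmxE unitfE -map_mxsub det_map_mx.
  by apply: contraNneq => ->; rewrite rmorph0.
move=> nfull; right.
have [Y [MY Y0]] : exists Y : 'cV[F]_m, map_mx tf V *m Y = 0 /\ Y != 0.
  apply: contrapT => h; move/negP: nfull; apply; apply/eqP/rank_inj => X MX.
  by apply: contrapT => /eqP X0; apply: h; exists X.
have fracE (x : F) : exists c : D * D, c.2 != 0 /\ x * tf c.2 = tf c.1.
  exact: fraction_numden.
have [c cP] := all_sig (fun i => cid (fracE (Y i 0))).
(* the numerators over the common denominator \prod_j (c j).2 *)
pose b i := \prod_(j | j != i) (c j).2.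
have bE i : tf (\prod_j (c j).2) = tf (c i).2 * tf (b i).
  by rewrite -rmorphM /b (bigD1 i).
have YE i : Y i 0 * tf (\prod_j (c j).2) = tf ((c i).1 * b i).
  by rewrite (bE i) mulrA (cP i).2 rmorphM.
exists (\col_i ((c i).1 * b i)).
  apply: contraNneq Y0 => h; apply/eqP/matrixP => i j; rewrite ord1 mxE.
  have := YE i; have := congr1 (fun M : 'cV[D]_m => M i 0) h; rewrite !mxE => ->.
  rewrite rmorph0 => /eqP; rewrite mulf_eq0 rmorph_prod => /orP[/eqP //|].
  rewrite prodf_seq_eq0 => /hasP[l _ /=].
  by rewrite -(rmorph0 tf) (inj_eq tf_inj) (negPf (cP l).1).
set y := \col_i _; have ty : map_mx tf y = tf (\prod_j (c j).2) *: Y.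
  by apply/matrixP => i j; rewrite !mxE ord1 -YE mulrC.
have h : map_mx tf (V *m y) = 0 by rewrite map_mxM ty -scalemxAr MY scaler0.
apply/matrixP => i j; apply: tf_inj.
have := congr1 (fun M : 'M[F]_(k, 1) => M i j) h.
by rewrite mxE [RHS]mxE => ->; rewrite mxE rmorph0.
Qed.

End FractionKernel.

(** * Holomorphic nondegeneracy *)

Section HolomorphicNondegeneracy.
Context {R : realType} {n m : nat}.
Local Notation C := (CC R).
Variables (d : nat) (P : 'I_m -> {mpoly C[n]}) (Q : {mpoly C[n]}).
Variable (V : 'M[{mpoly C[n]}]_(K n d, m)).
Hypotheses (n0 : (0 < n)%N) (hV : is_VH d P V).
Hypothesis degP : forall i, (msize (P i) <= d.+1)%N.
Hypothesis Q0 : forall z : 'cV[C]_n, sphere z -> Q.@[z^~ 0] != 0.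
Local Notation H := (ratmap P Q).

Lemma dot_conj_ratmap (X : 'cV[C]_m) (z : 'cV[C]_n) : sphere z ->
  dot X (conjv (H z)) = ((Q.@[z^~ 0])^*)^-1 * dot (mx_at V z *m X) (conjv (Hnd d z)).
Proof.
move=> Sz; rewrite (VH_sphere hV) // mulr_sumr; apply: eq_bigr => i _.
by rewrite conj_ratmapE mulrCA.
Qed.

Lemma sphere_inhabited : exists z : 'cV[C]_n, sphere z.
Proof.
exists (delta_mx (Ordinal n0) 0); rewrite /sphere /= sqnormE delta_dot conjvE mxE !eqxx.
exact: conjC1.
Qed.

(** [Lbar_pow_Hnd] with g = 0 and u = 1, in a frame near each point of the
    sphere. *)
Lemma orthogonal_kernel (U : set 'cV[C]_n) (Y : 'cV[C]_n -> 'cV[C]_m) :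
  open U -> (forall i, holo U (fun z => Y z i 0)) ->
  (forall z, U z -> sphere z -> dot (Y z) (conjv (H z)) = 0) ->
  forall z, U z -> sphere z -> mx_at V z *m Y z = 0.
Proof.
move=> oU hY YH z Uz Sz; have [a fr] := cr_frame_exists Sz.
have [W [oW Wz WU ta fa]] := cr_frame_tangential Sz fr oU Uz.
have hc j : holo W (fun w => (mx_at V w *m Y w) j 0).
  rewrite (_ : (fun w => _) = fun w : 'cV[C]_n => \sum_i (V j i).@[w^~ 0] * Y w i 0).
    apply: holo_sum => i; apply: holoM; first exact: holo_poly.
    by move=> w /WU; exact: hY.
  by apply/funext => w; exact: mx_at_mulE.
have s1 := Smooth_cst oW (1 : C); have s0 := Smooth_cst oW (0 : C).
have gE w : W w -> sphere w -> 0 = 1 * dot (mx_at V w *m Y w) (conjv (Hnd d w)).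
  move=> Ww Sw; have := YH w (WU w Ww) Sw; rewrite dot_conj_ratmap // mul1r => /eqP.
  by rewrite mulf_eq0 invr_eq0 conjC_eq0 (negPf (Q0 Sw)) => /eqP ->.
apply/(Lbar_pow_Hnd oW ta Wz Sz n0 fa hc s1 (oner_neq0 _) s0 gE) => al.
rewrite Lbar_powE.
(* the derivatives of 0, as the derivatives of an empty combination *)
have := @Lbars_holo_comb _ _ _ oW _ _ ta (word al) void [::]
  (fun _ _ => 0) (fun _ _ => 0) (of_void _) (of_void _) z Wz.
by rewrite !big_nil.
Qed.

(** By [orthogonal_kernel] Y vanishes where V_H has rank m, so by density on
    the sphere, and therefore everywhere. *)
Lemma generic_rank_nondegenerate : generically_rank_m V -> holomorphically_nondegenerate H.
Proof.
move=> [W [oW dW rW]] [U [Y [[oU cU SU] hY [z1 Uz1 Yz1] YH]]].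
have hYU i : holo U (fun z => Y z i 0) by apply: holo_holomorphic => z; exact: hY.
have VY := orthogonal_kernel oU hYU (fun z _ => YH z).
have YW z : W z -> sphere z -> Y z = 0.
  by move=> Wz Sz; have /rank_inj := rW z Wz Sz; apply; apply: VY => //; exact: SU.
have YS z i : sphere z -> Y z i 0 = 0.
  move=> Sz; apply: contrapT => /eqP Yz.
  have [al /wdiff_continuous h] := hYU i z (SU _ Sz).
  have [w [[Ww Sw] /=]] := dW _ Sz _ (h _ (open_nbhs_nbhs (conj open_neq0 Yz))).
  by rewrite YW // mxE eqxx.
case/eqP: Yz1; apply: cV_eqP => i; rewrite mxE.
apply: (identity_theorem (f := fun z => Y z i 0) oU cU SU sphere_inhabited) => //.
- by move=> z Uz; apply: holomorphic_psum_at; exact: hY.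
- by move=> z; exact: YS.
Qed.

Lemma rowsub_mulmx k l (f : 'I_l -> 'I_k) (A : 'M[C]_(k, m)) (X : 'cV[C]_m) :
  rowsub f A *m X = rowsub f (A *m X).
Proof. by apply/matrixP => i j; rewrite !mxE; apply: eq_bigr => l' _; rewrite !mxE. Qed.

(** Either a maximal minor of V_H is a nonzero polynomial, whose zeros on
    the sphere have a dense complement, or a polynomial vector Y with V_H Y
    = 0 is orthogonal to conj H along the sphere. *)
Lemma nondegenerate_generic_rank : holomorphically_nondegenerate H -> generically_rank_m V.
Proof.
move=> hH; have [[f f0]|[Y Y0 VY]] := minor_or_kernel V.
  pose q : {mpoly C[n]} := \det (rowsub f V).
  exists (nonzero_locus q); split; first exact: open_nonzero_locus.
    move=> p Sp B Bp; apply: contrapT => h; case/eqP: f0.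
    apply: (poly_sphere_eq0 Sp); apply: filterS Bp => z Bz Sz.
    by apply: contrapT => /eqP qz; apply: h; exists z.
  move=> z qz Sz; apply/rank_inj => X VX.
  have : rowsub f (mx_at V z) *m X = 0.
    by rewrite rowsub_mulmx VX; apply/matrixP => i j; rewrite !mxE.
  have qE : \det (rowsub f (mx_at V z)) = q.@[z^~ 0].
    by rewrite /q /mx_at -map_mxsub det_map_mx.
  have U : rowsub f (mx_at V z) \in unitmx by rewrite unitmxE unitfE qE.
  by move/(congr1 (mulmx (invmx (rowsub f (mx_at V z))))); rewrite mulKmx // mulmx0.
exfalso; apply: hH; exists setT, (fun z => \col_i (Y i 0).@[z^~ 0]); split.
- split; [exact: openT | exact: connected_cV | by []].
- move=> i z _; have := holomorphic_poly (Y i 0) z.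
  by congr holomorphic_at; apply/funext => w; rewrite mxE.
- have [i Yi] : exists i, Y i 0 != 0.
    apply: contrapT => h; case/eqP: Y0; apply/matrixP => i j; rewrite ord1 mxE.
    by apply: contrapT => /eqP Yi; apply: h; exists i.
  have [z Yz] : exists z : 'cV[C]_n, (Y i 0).@[z^~ 0] != 0.
    apply: contrapT => h; case/eqP: Yi; apply: mpoly_eq0_fun => z.
    by apply: contrapT => /eqP Yz; apply: h; exists z.
  exists z => //; apply: contraNneq Yz => /matrixP/(_ i 0).
  by rewrite !mxE => ->.
- move=> z Sz; rewrite dot_conj_ratmap //.
  rewrite (_ : mx_at V z *m _ = 0) ?dot0v ?mulr0 //.
  rewrite (_ : \col_i _ = map_mx (meval (z^~ 0)) Y); last first.
    by apply/matrixP => i j; rewrite !mxE ord1.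
  by rewrite -map_mxM VY map_mx0.
Qed.

End HolomorphicNondegeneracy.

Theorem theorem1 (R : realType) (n m d : nat)
    (hn : (2 <= n)%N) (hm : (1 <= m)%N) (hd : (1 <= d)%N)
    (P : 'I_m -> {mpoly (CC R)[n]}) (Q : {mpoly (CC R)[n]})
    (hH : rational_sphere_map d P Q)
    (V : 'M[{mpoly (CC R)[n]}]_(K n d, m)) (hV : is_VH d P V) :
  (forall (p : 'cV[CC R]_n), sphere p ->
     forall a : 'I_n.-1 -> 'cV[CC R]_n -> 'cV[CC R]_n, cr_frame p a ->
       (finitely_nondegenerate a (ratmap P Q) p <-> \rank (mx_at V p) = m)) /\
  (holomorphically_nondegenerate (ratmap P Q) <-> generically_rank_m V).
Proof.
have [_ Q0 _ dE] := hH; have n0 : (0 < n)%N by exact: ltnW.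
have degP i : (msize (P i) <= d.+1)%N.
  have h : (msize (P i) <= maxn (\max_i msize (P i)) (msize Q))%N.
    by rewrite leq_max leq_bigmax.
  by rewrite -dE; apply: leq_trans h _; exact: leqSpred.
split; first by move=> p Sp a fr; exact: (finitely_nondegenerate_rank n0 hV degP Q0 Sp fr).
split.
  exact: (nondegenerate_generic_rank hV degP).
exact: (generic_rank_nondegenerate n0 hV degP Q0).
Qed.
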